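(* Let $S\subset\mathbb{R}^n$ be a closed set and let $n<p<\infty$. (i) A function $f$ defined on $S$ can be extended to a (continuous) function $F\in L^1_p(\mathbb{R}^n)$ if and only if $f^\sharp_{\infty,S}\in L_p(\mathbb{R}^n)$. Moreover, $$\|f\|_{L^1_p(\mathbb{R}^n)|_S}\sim\|f^\sharp_{\infty,S}\|_{L_p(\mathbb{R}^n)},$$ with constants of equivalence depending only on $n$ and $p$. (ii) Given $\varepsilon>0$ and $\theta\ge1$, let $S_\varepsilon$ be the $\varepsilon$-neighborhood of $S$ and let $T:S_\varepsilon\to S$ be a measurable mapping such that $\|T(x)-x\|\le\theta\operatorname{dist}(x,S)$ for every $x\in S_\varepsilon$. A function $f$ defined on $S$ is an element of $W^1_p(\mathbb{R}^n)|_S$ if and only if $f\circ T$ and $f^\sharp_{\infty,S}$ are both in $L_p(S_\varepsilon)$. Furthermore, $$\|f\|_{W^1_p(\mathbb{R}^n)|_S}\sim\|f\circ T\|_{L_p(S_\varepsilon)}+\|f^\sharp_{\infty,S}\|_{L_p(S_\varepsilon)},$$ with constants of equivalence depending only on $n,p,\varepsilon$ and $\theta$.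
   Context: Distances in $\mathbb{R}^n$ are measured in the norm $\|x\|=\max_i|x_i|$. $Q(x,r)=\{y:\|y-x\|\le r\}$ is the closed cube centered at $x$ with side length $2r$. The $\varepsilon$-neighborhood of $S$ is the set of points at distance less than $\varepsilon$ from $S$. For $f:S\to\mathbb{R}$, $$f^\sharp_{\infty,S}(x):=\sup\{|f(y)-f(z)|/r:\ r>0,\ y,z\in Q(x,r)\cap S\},\qquad x\in\mathbb{R}^n.$$ $W^1_p(\mathbb{R}^n)$ is the Sobolev space with norm $\|F\|_{L_p}+\|\nabla F\|_{L_p}$; $L^1_p(\mathbb{R}^n)$ is the homogeneous Sobolev space with seminorm $\|\nabla F\|_{L_p}$. Since $p>n$, elements of these spaces are identified with their unique continuous representatives. For $X=W^1_p(\mathbb{R}^n)$ or $X=L^1_p(\mathbb{R}^n)$, the trace space $X|_S$ consists of all $f:S\to\mathbb{R}$ for which there is a continuous $F\in X$ with $F|_S=f$, and $\|f\|_{X|_S}=\inf\{\|F\|_X:F\in X\text{ continuous},\ F|_S=f\}$. $A\sim B$ means $A/C\le B\le CA$ for a constant $C\ge1$. *)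

(* Defs.v *)
From HB Require Import structures.
From mathcomp Require Import all_boot all_order all_algebra.
From mathcomp Require Import all_classical all_reals all_analysis.
From mathcomp Require Import measurable_realfun.

Set Implicit Arguments.
Unset Strict Implicit.
Unset Printing Implicit Defensive.
Import Order.TTheory GRing.Theory Num.Theory.
Import numFieldNormedType.Exports.
Local Open Scope classical_set_scope.
Local Open Scope ring_scope.

(* R^n with n >= 1 is 'rV[R]_n.+1; its library norm `|x| is the max norm. *)

(* Lebesgue measure on R^n, by Caratheodory's construction from volumes of
   boxes. When b 0 i < a 0 i for some i the box is empty and has volume 0. *)
Section lebesgue_measure_rV.
Variables (R : realType) (n : nat).
Local Notation V := 'rV[R]_n.+1.

Definition box (u : V * V) : set V :=
  [set x | forall i, u.1 0 i <= x 0 i <= u.2 0 i].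

Definition box_vol (u : V * V) : R :=
  \prod_i Num.max 0 (u.2 0 i - u.1 0 i).

Definition leb_outer (A : set V) : \bar R :=
  ereal_inf [set (\sum_(k <oo) (box_vol (u k))%:E)%E |
    u in [set u : nat -> V * V | A `<=` \bigcup_k box (u k)]].

Lemma box_vol_ge0 u : (0 <= (box_vol u)%:E)%E.
Proof. by rewrite lee_fin prodr_ge0// => i _; rewrite le_max lexx. Qed.
#[local] Hint Resolve box_vol_ge0 : core.

Lemma leb_outer_ge0 A : (0 <= leb_outer A)%E.
Proof. by apply: le_ereal_inf_tmp => _ [u _ <-]; exact: nneseries_ge0. Qed.

Lemma leb_outer0 : leb_outer set0 = 0%E.
Proof.
apply/eqP; rewrite eq_le leb_outer_ge0 andbT.
apply: ereal_inf_lbound; exists (fun=> (0, 0)) => //=.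
apply: eseries0 => k _ _; rewrite /box_vol big_ord_recl/= mxE subr0 maxxx.
by rewrite mul0r.
Qed.

Lemma le_leb_outer : {homo leb_outer : A B / A `<=` B >-> (A <= B)%E}.
Proof.
move=> A B AB; apply: ereal_inf_le_tmp => _ [u Bu <-].
by exists u => //; exact: subset_trans Bu.
Qed.

Lemma leb_outer_sigma_subadditive : sigma_subadditive leb_outer.
Proof.
move=> A; have [[i ioo]|] := pselect (exists i, leb_outer (A i) = +oo%E).
  rewrite (eseries_pinfty _ _ ioo) ?leey// => n0 _.
  by rewrite -ltNye (lt_le_trans _ (leb_outer_ge0 _)).
rewrite -forallNE => Aoo.
suff add2e (e : {posnum R}) : (leb_outer (\bigcup_n A n) <=
    \sum_(i <oo) leb_outer (A i) + e%:num%:E)%E.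
  by apply/lee_addgt0Pr => _/posnumP[].
rewrite (le_trans _ (epsilon_trick _ _ _))//; last first.
  by move=> m; exact: leb_outer_ge0.
pose P m (u : nat -> V * V) := A m `<=` \bigcup_k box (u k) /\
  (\sum_(k <oo) (box_vol (u k))%:E <=
   leb_outer (A m) + (e%:num / (2 ^ m.+1)%:R)%:E)%E.
have [G PG] : {G : nat -> nat -> V * V & forall m, P m (G m)}.
  apply: (@choice _ _ P) => m; rewrite /P /leb_outer.
  set S := (X in ereal_inf X); move infS : (ereal_inf S) => iS.
  case: iS infS => [r Sr|Soo|Soo].
  - have en1 : 0 < e%:num / (2 ^ m.+1)%:R by [].
    have /(lb_ereal_inf_adherent en1) : ereal_inf S \is a fin_num by rewrite Sr.
    move=> [x [u Au ux] xS].
    by exists u; split => //; rewrite ux -Sr; exact/ltW.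
  - by have := Aoo m; rewrite /leb_outer Soo.
  - suff : lbound S 0%E by move/le_ereal_inf_tmp; rewrite Soo.
    by move=> /= _ [u Au <-]; exact: nneseries_ge0.
pose w (i : nat * nat) : \bar R := (box_vol (uncurry G i))%:E.
have w0 i : (0 <= w i)%E by exact: box_vol_ge0.
apply: (@le_trans _ _ (\esum_(i in setT) w i)).
  rewrite /leb_outer; apply: ereal_inf_lbound => /=.
  have /card_esym/ppcard_eqP[f] := card_nat2.
  exists (uncurry G \o f).
    move=> t [i _] /(PG i).1 [j _ Bijt]; exists (f^-1%FUN (i, j)) => //=.
    by rewrite invK ?inE.
  rewrite -(esum_pred_image w _ xpredT) ?[fun=> _]set_true//.
  by rewrite image_eq.
have -> : (\esum_(i in [set: nat * nat]) w i =
    \sum_(i <oo) \sum_(j <oo) w (i, j))%E.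
  pose J : nat -> set (nat * nat) := fun i => [set (i, j) | j in setT].
  rewrite (_ : setT = \bigcup_k J k); last first.
    by rewrite predeqE => -[a b]; split => // _; exists a => //; exists b.
  rewrite esum_bigcupT /=; last 2 first.
    - apply/trivIsetP => i j _ _ ij.
      rewrite predeqE => -[m k] /=; split => //= -[] [_] _ [<-{m} _].
      by move=> [m' _] [] /esym/eqP; rewrite (negbTE ij).
    - by move=> /= [m k]; exact: w0.
  rewrite -(image_id [set: nat]) -fun_true esum_pred_image//; last first.
    by move=> m _; apply: esum_ge0 => *; exact: w0.
  apply: eq_eseriesr => /= j _.
  rewrite -(esum_pred_image w (pair j) predT)//=; last first.
    by move=> ? ? _ _; exact: (@can_inj _ _ _ snd).
  by congr esum; rewrite predeqE => -[a b]; split; move=> [i _ <-]; exists i.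
apply: lee_nneseries => [k _ _|k _]; first exact: nneseries_ge0.
exact: (PG k).2.
Qed.

HB.instance Definition _ := isOuterMeasure.Build R V leb_outer
  leb_outer0 leb_outer_ge0 le_leb_outer leb_outer_sigma_subadditive.

(* Convertible to V; its sigma-algebra consists of the Lebesgue measurable
   sets. *)
Definition lebRn := caratheodory_type leb_outer.
HB.instance Definition _ := Measurable.on lebRn.

Definition lebesgue_measure_rV : set lebRn -> \bar R := leb_outer.

Let lebesgue_measure_rV_semi_sigma_additive :
  semi_sigma_additive lebesgue_measure_rV.
Proof. by move=> F mF tF mUF; exact: caratheodory_measure_sigma_additive. Qed.

HB.instance Definition _ := isMeasure.Build _ _ _ lebesgue_measure_rV
  leb_outer0 leb_outer_ge0 lebesgue_measure_rV_semi_sigma_additive.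

Definition borelRn := g_sigma_algebraType (@open V).
HB.instance Definition _ := Measurable.on borelRn.

End lebesgue_measure_rV.

Section sobolev.
Variables (R : realType) (n : nat).
Local Notation V := 'rV[R]_n.+1.
Local Notation lebRn := (lebRn R n).
Local Notation mu := (@lebesgue_measure_rV R n).
Implicit Types (D S : set V) (F f : V -> R) (G : V -> V) (p : R).

Definition lpnorm p D (g : V -> \bar R) : \bar R :=
  Lnorm mu p%:E (g \_ D : lebRn -> \bar R).

Definition in_Lp p D (g : V -> \bar R) : Prop :=
  measurable_fun (D : set lebRn) (g : lebRn -> \bar R) /\
  (lpnorm p D g < +oo)%E.

Definition loc_integrable F : Prop :=
  measurable_fun [set: lebRn] (F : lebRn -> R) /\
  forall K : set V, compact K ->
    mu.-integrable (K : set lebRn) (EFin \o F : lebRn -> \bar R).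

Definition partial (i : 'I_n.+1) F : V -> R :=
  fun x => 'D_(delta_mx 0 i) F x.

Fixpoint Ck (k : nat) F : Prop :=
  continuous F /\
  if k is k'.+1 then
    forall i : 'I_n.+1,
      (forall x, derivable F x (delta_mx 0 i)) /\ Ck k' (partial i F)
  else True.

Definition test_function F : Prop :=
  (forall k, Ck k F) /\ compact (closure [set x | F x != 0]).

Definition is_weak_gradient F G : Prop :=
  forall i : 'I_n.+1,
    loc_integrable (fun x => G x 0 i) /\
    forall phi : V -> R, test_function phi ->
      (\int[mu]_x (F x * partial i phi x) = - \int[mu]_x (G x 0 i * phi x))%R.

(* A weak gradient is unique up to a null set, so that lpnorm does not depend
   on the one chosen here. *)
Definition weak_gradient F : V -> V :=
  xget (fun=> 0) [set G | is_weak_gradient F G].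

Definition eucl_norm (v : V) : R := Num.sqrt (\sum_i (v 0 i) ^+ 2).

Definition grad_abs F : V -> \bar R :=
  fun x => (eucl_norm (weak_gradient F x))%:E.

Definition L1p p : set (V -> R) :=
  [set F | [/\ loc_integrable F, exists G, is_weak_gradient F G
             & in_Lp p [set: V] (grad_abs F)]].

Definition L1p_norm p F : \bar R := lpnorm p [set: V] (grad_abs F).

Definition W1p p : set (V -> R) :=
  [set F | in_Lp p [set: V] (EFin \o F) /\ L1p p F].

Definition W1p_norm p F : \bar R :=
  (lpnorm p [set: V] (EFin \o F) + L1p_norm p F)%E.

(* A function on S is encoded by a total f of which only the values on S
   matter. *)
Definition extensions (X : set (V -> R)) S f : set (V -> R) :=
  [set F | [/\ X F, continuous F & forall x, S x -> F x = f x]].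

Definition in_trace (X : set (V -> R)) S f : Prop := extensions X S f !=set0.

Definition trace_norm (X : set (V -> R)) (N : (V -> R) -> \bar R) S f : \bar R :=
  ereal_inf [set N F | F in extensions X S f].

Definition cube (x : V) (r : R) : set V := [set y | `|y - x| <= r].

(* The supremum is taken in [0, +oo]: adding 0 only matters if S is empty. *)
Definition sharp S f (x : V) : \bar R :=
  ereal_sup ([set 0%E] `|`
    [set v | exists (r : R) (y z : V),
      [/\ 0 < r, (cube x r `&` S) y, (cube x r `&` S) z
        & v = (`|f y - f z| / r)%:E]]).

Definition eps_nbhd (eps : R) S : set V := [set x | (edist_inf S x < eps%:E)%E].

End sobolev.

Definition equivalent_up_to (R : realType) (C : R) (a b : \bar R) : Prop :=
  (C^-1%:E * a <= b /\ b <= C%:E * a)%E.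

(* Main.v *)
(* The two halves of the equivalence are pointwise.

   Necessity.  By Morrey's inequality in the form
   |F y - F z| <= C r lam for y, z in Q(x, r), valid as soon as
   \int_{Q(x, 4r)} |grad F|^q 1_{|grad F| > lam} <= lam^q r^d  (d < q < p),
   the level set {F# > C lam} is covered by cubes with a large integral;
   Vitali's lemma bounds its measure, and summing over lam = lam0 2^k gives
   |F#|_p <= C |grad F|_p.  Since f# <= F# for every extension F of f, and
   |f(T x)| <= |F x| + theta eps F#(x), this is the lower bound of the trace
   norm.  Morrey's inequality itself compares means of F against tensor products
   of bumps, whose differences telescope into partial derivatives.

   Sufficiency.  The extension F x is the average over s in [2, 3] of
   inf {f a : a in S, |a - x| <= s dist(x, S)}; it satisfies F# <= 110 f#
   pointwise, and for (ii) it is multiplied by a cutoff of dist(x, S).  A function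
   whose oscillation on Q(x, r) is at most r g(x) for small r, with g in L_p, is
   continuous because d < p, and weak limits of its difference quotients are
   partial derivatives bounded by g.  The fundamental lemma of the calculus of
   variations transfers the bound to the chosen weak gradient. *)

Require Import Defs.
From HB Require Import structures.
From mathcomp Require Import all_boot all_order all_algebra.
From mathcomp Require Import all_classical all_reals all_analysis.
From mathcomp Require Import measurable_realfun.
From mathcomp Require Import lra.

Set Implicit Arguments.
Unset Strict Implicit.
Unset Printing Implicit Defensive.
Import Order.TTheory GRing.Theory Num.Theory.
Import numFieldNormedType.Exports.
Local Open Scope classical_set_scope.
Local Open Scope ring_scope.

(** * Lebesgue measure of boxes *)

(** The extension is not a Whitney sum. Off S, the infimum of f over S in Q(x, s dist(x, S)) jumps
    as x moves, since points of S enter the cube; but it is monotone in s, and a small move of x by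
    h costs at most a shift of s by 4 |h| / dist(x, S). Averaging over an interval of s turns this
    shift into a Lipschitz estimate.

    The strong-type bound at exponent p rests on an estimate at an exponent q strictly between d and
    p that sees only the values of |grad F| above lam. Hence Morrey's inequality is stated with a
    truncated power and not with a norm.

    Weak limits are taken along an ultrafilter: for nonnegative functions dominated by an integrable
    g, the limits of the integrals over measurable sets form a measure, and its Radon-Nikodym
    density is the limit function. As the bound is in L_p and not in L_1, everything is multiplied
    by an integrable weight that is bounded below on bounded sets.

    The measure is given through covers by boxes, so the volume of boxes, translation invariance and
    regularity are all read off from covers. *)

Section measure_basics.
Variable (R : realType).

Lemma lebesgue_measure_itvcc (a b : R) :
  lebesgue_measure (`[a, b]%classic : set R) = (Num.max 0 (b - a))%:E.
Proof.
rewrite lebesgue_measure_itv/= lte_fin; case: ifPn => [ab|].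
  by rewrite -EFinB max_r// subr_ge0 ltW.
by rewrite -leNgt => ba; rewrite max_l// subr_le0.
Qed.

(** Induction on the dimension [m] by slicing. For fixed last coordinate [t], the boxes whose last
    side contains [t] cover the slice of the given box, so its volume is at most the sum of theirs;
    integrating over [t] against one-dimensional Lebesgue measure gives the next dimension. The
    predicate [P] keeps track of the boxes that meet the slices fixed so far, and points are
    functions on [nat] so that the dimension can vary. *)
Lemma box_cover_ge (m : nat) (a b : nat -> R) (u v : nat -> nat -> R)
    (P : nat -> bool) :
  (forall x : nat -> R, (forall i, (i < m)%N -> a i <= x i <= b i) ->
    exists k, P k /\ forall i, (i < m)%N -> u k i <= x i <= v k i) ->
  ((\prod_(0 <= i < m) Num.max 0 (b i - a i))%:E <=
   \sum_(k <oo) ((P k)%:R * \prod_(0 <= i < m) Num.max 0 (v k i - u k i))%:E)%E.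
Proof.
elim: m P => [|m ih] P cov.
  have [//|k [Pk _]] := cov a.
  rewrite big_geq//; under eq_eseriesr do rewrite big_geq// mulr1.
  apply: le_trans (nneseries_lim_ge k.+1 _) => //.
  by rewrite big_nat_recr//= Pk leeDr// sume_ge0.
have vol0 k : 0 <= \prod_(0 <= i < m) Num.max 0 (v k i - u k i).
  by rewrite prodr_ge0// => i _; rewrite le_max lexx.
set c := \prod_(0 <= i < m) Num.max 0 (b i - a i).
(* The volume of the slice at height [t] of the [k]-th box. *)
pose g k (t : R) : \bar R := (((P k)%:R * \prod_(0 <= i < m)
   Num.max 0 (v k i - u k i))%:E * (\1_(`[u k m, v k m]%classic) t)%:E)%E.
have mg k : measurable_fun setT (g k).
  by apply: measurable_funeM; apply/measurable_EFinP.
have g0 k t : (0 <= g k t)%E.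
  by rewrite mule_ge0// lee_fin// mulr_ge0.
have step t : a m <= t <= b m -> (c%:E <= \sum_(k <oo) g k t)%E.
  move=> abt.
  have := ih (fun k => P k && (u k m <= t <= v k m)).
  move=> /(_ _)/le_trans; apply.
    move=> x xab.
    have [i im|k [Pk H]] := cov (fun i => if i == m then t else x i).
      case: eqP => [->//|/eqP im']; apply: xab.
      by rewrite ltn_neqAle im' -ltnS.
    exists k; rewrite Pk /=; split.
      by have := H m (ltnSn _); rewrite eqxx.
    move=> i im; have := H i (ltnW im); rewrite ifF//.
    by apply/negbTE; rewrite ltn_eqF.
  apply: lee_nneseries => [k _ _|k _].
    by rewrite lee_fin mulr_ge0.
  have -> : u k m <= t <= v k m = (t \in `[u k m, v k m]%classic).
    by apply/idP/idP; rewrite inE/= ?in_itv.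
  rewrite /g -EFinM lee_fin indicE mulrAC -natrM mulnb.
  exact: lexx.
rewrite big_nat_recr//=.
rewrite EFinM -(lebesgue_measure_itvcc (a m) (b m)).
rewrite -integral_cst//.
apply: (@le_trans _ _ (\int[lebesgue_measure]_(t in `[a m, b m]) \sum_(k <oo) g k t)%E).
  apply: ge0_le_integral => //.
  - by move=> x _; rewrite lee_fin prodr_ge0// => i _; rewrite le_max lexx.
  - apply: measurable_funTS; apply: ge0_emeasurable_sum => // k _; exact: mg.
rewrite integral_nneseries//; last first.
  by move=> k; apply: measurable_funTS; exact: mg.
apply: lee_nneseries => [k _ _|k _]; first exact: integral_ge0.
apply: (@le_trans _ _ (\int[lebesgue_measure]_t g k t)%E).
  by apply: ge0_subset_integral => //; exact: mg.
rewrite /g ge0_integralZl//; last 2 first.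
  by apply/measurable_EFinP.
  by rewrite lee_fin mulr_ge0.
rewrite integral_indic// setIT [X in (_ * X)%E]lebesgue_measure_itvcc -EFinM.
by rewrite big_nat_recr//= mulrA.
Qed.

End measure_basics.

(** * Volumes, measurable sets and translation invariance in R^n *)

Section lebesgue_rV.
Variables (R : realType) (n : nat).
Local Notation V := 'rV[R]_n.+1.
Local Notation lebRn := (lebRn R n).
Local Notation mu := (@lebesgue_measure_rV R n).

Lemma rV_norm_le (x : V) (r : R) : 0 <= r ->
  (`|x| <= r) <-> (forall i, `|x 0 i| <= r).
Proof.
move=> r0; rewrite [`|x|]/Num.norm/= mx_normrE; split.
  by move=> /bigmax_leP[_ H] i; have := H (0, i); exact.
by move=> H; apply/bigmax_leP; split=> // -[i j] _ /=; rewrite ord1.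
Qed.

Lemma rV_norm_lt (x : V) (r : R) : 0 < r ->
  (`|x| < r) <-> (forall i, `|x 0 i| < r).
Proof.
move=> r0; rewrite [`|x|]/Num.norm/= mx_normrE; split.
  by move=> /bigmax_ltP[_ H] i; have := H (0, i); exact.
by move=> H; apply/bigmax_ltP; split=> // -[i j] _ /=; rewrite ord1.
Qed.

Lemma coord_le_norm (x : V) i : `|x 0 i| <= `|x|.
Proof. by move: i; apply/rV_norm_le. Qed.

Lemma cube_box (x : V) (r : R) : 0 <= r ->
  cube x r = box (x - const_mx r, x + const_mx r).
Proof.
move=> r0; apply/seteqP; split=> y /=.
  move=> /(rV_norm_le _ r0) H i; have := H i; rewrite !mxE.
  by rewrite ler_norml => /andP[h1 h2]; apply/andP; split; lra.
move=> H; apply/rV_norm_le => // i; have := H i; rewrite !mxE.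
by rewrite ler_norml => /andP[h1 h2]; apply/andP; split; lra.
Qed.

(** One inequality is the cover of the box by itself, completed by degenerate boxes of volume 0; the
    other is [box_cover_ge], with coordinates indexed by [nat] through [inord]. *)
Lemma leb_outer_box (u : V * V) : leb_outer (box u) = (box_vol u)%:E.
Proof.
apply/eqP; rewrite eq_le; apply/andP; split.
  apply: ereal_inf_lbound => /=.
  exists (fun k => if k == 0%N then u else (0, 0)).
    by move=> x ux; exists 0%N.
  rewrite (nneseriesD1 (n := 0%N))//=; last by move=> k _; exact: box_vol_ge0.
  rewrite eseries0 ?adde0// => -[//|k] _ _ /=.
  by rewrite /box_vol big_ord_recl/= mxE subr0 maxxx mul0r.
apply: le_ereal_inf_tmp => _ [w cov <-].
pose N (x : V) (i : nat) : R := x 0 (inord i).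
have volE (t : V * V) :
    box_vol t = \prod_(0 <= i < n.+1) Num.max 0 (N t.2 i - N t.1 i).
  by rewrite /box_vol big_mkord; apply: eq_bigr => i _; rewrite /N inord_val.
rewrite volE.
apply: le_trans (@box_cover_ge R n.+1 (N u.1) (N u.2)
  (fun k => N (w k).1) (fun k => N (w k).2) xpredT _) _.
  move=> x xu.
  have /cov[k _ wk] : box u (\row_i x i).
    by move=> i; rewrite mxE; have := xu i (ltn_ord i); rewrite /N inord_val.
  exists k; split=> // i im; have := wk (Ordinal im); rewrite mxE /=.
  by rewrite /N -[inord i]/(inord (Ordinal im)) inord_val.
apply: lee_nneseries => [k _ _|k _]; last by rewrite volE mul1r.
by rewrite mul1r lee_fin prodr_ge0// => i _; rewrite le_max lexx.
Qed.

Lemma box_vol_split (u : V * V) (i : 'I_n.+1) (c : R) :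
  box_vol u =
  box_vol (u.1, \row_j if j == i then Num.min (u.2 0 j) c else u.2 0 j) +
  box_vol (\row_j (if j == i then Num.max (u.1 0 j) c else u.1 0 j), u.2).
Proof.
rewrite /box_vol (bigD1 i)//= [X in _ = X + _](bigD1 i)//=.
rewrite [X in _ = _ + X](bigD1 i)//=.
rewrite [in X in _ = X + _](eq_bigr (fun j => Num.max 0 (u.2 0 j - u.1 0 j)));
  last by move=> j ji; rewrite mxE (negbTE ji).
rewrite [in X in _ = _ + X](eq_bigr (fun j => Num.max 0 (u.2 0 j - u.1 0 j)));
  last by move=> j ji; rewrite mxE (negbTE ji).
rewrite -mulrDl !mxE eqxx; congr (_ * _).
rewrite /Num.max /Num.min.
by do ! case: ifPn; rewrite -?leNgt => *; lra.
Qed.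

(** Caratheodory's criterion: cutting every box of a cover of X along the hyperplane [x 0 i = c]
    yields covers of both parts of X with the same total volume. Letting [H] lie anywhere between
    the open and the closed half-space treats both at once. *)
Lemma halfspace_measurable (i : 'I_n.+1) (c : R) (H : set V) :
  [set x : V | x 0 i < c] `<=` H -> H `<=` [set x : V | x 0 i <= c] ->
  measurable (H : set lebRn).
Proof.
move=> H1 H2; apply: le_caratheodory_measurable => X.
apply: le_ereal_inf_tmp => _ [w cov <-].
pose wl k : V * V := ((w k).1,
  \row_j if j == i then Num.min ((w k).2 0 j) c else (w k).2 0 j).
pose wr k : V * V := (\row_j (if j == i then Num.max ((w k).1 0 j) c
  else (w k).1 0 j), (w k).2).
apply: (@le_trans _ _ (\sum_(k <oo) (box_vol (wl k))%:E +
    \sum_(k <oo) (box_vol (wr k))%:E)%E); last first.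
  rewrite -nneseriesD; try by move=> k _ _; exact: box_vol_ge0.
  by under [leRHS]eq_eseriesr do rewrite (box_vol_split _ i c) EFinD.
apply: leeD; apply: ereal_inf_lbound => /=.
  exists wl => // x [/cov[k _ wk] /H2/= xc].
  exists k => //= j; have /andP[h1 h2] := wk j; rewrite h1 mxE.
  by case: eqP => [->|//]; rewrite le_min xc andbT; have /andP[_ ->] := wk i.
exists wr => // x [/cov[k _ wk] Hx].
have cx : c <= x 0 i.
  by rewrite leNgt; apply/negP => /H1.
exists k => //= j; have /andP[h1 h2] := wk j; rewrite h2 mxE andbT.
by case: eqP => [->|//]; rewrite ge_max cx andbT; have /andP[->] := wk i.
Qed.

Lemma box_measurable (u : V * V) : measurable (box u : set lebRn).
Proof.
have -> : box u = \bigcap_(i in [set: 'I_n.+1])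
    ([set x : V | x 0 i <= u.2 0 i] `\` [set x : V | x 0 i < u.1 0 i]).
  apply/seteqP; split => x /=.
    move=> ux i _; have /andP[h1 h2] := ux i.
    by split => //; apply/negP; rewrite -leNgt.
  move=> ux i; have [/= h1 /negP] := ux i I.
  by rewrite -leNgt => ->; rewrite h1.
apply: fin_bigcap_measurable => [|i _]; first exact: finite_finset.
apply: measurableD.
  by apply: (@halfspace_measurable i (u.2 0 i)) => // x /ltW.
by apply: (@halfspace_measurable i (u.1 0 i)) => // x /ltW.
Qed.

Lemma cube_measurable (x : V) r : measurable (cube x r : set lebRn).
Proof.
have [r0|r0] := leP 0 r; first by rewrite cube_box//; exact: box_measurable.
rewrite (_ : cube x r = set0) ?measurable0// -subset0 => y /= yr.
by have := le_lt_trans yr r0; rewrite normr_lt0.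
Qed.

Lemma mu_cube (x : V) r : 0 <= r -> mu (cube x r) = ((2 * r) ^+ n.+1)%:E.
Proof.
move=> r0; rewrite /lebesgue_measure_rV cube_box// leb_outer_box; congr EFin.
rewrite /box_vol (eq_bigr (fun=> 2 * r)).
  by rewrite prodr_const card_ord.
move=> i _; rewrite !mxE max_r; first by lra.
lra.
Qed.

Lemma rat_rV_dense (x : V) (e : R) : 0 < e ->
  exists q : 'rV[rat]_n.+1, `|map_mx ratr q - x| < e.
Proof.
move=> e0.
have H i : exists q : rat, `|ratr q - x 0 i| < e.
  have /rat_in_itvoo[q] : x 0 i < x 0 i + e by rewrite ltrDl.
  rewrite in_itv/= => /andP[h1 h2]; exists q.
  by rewrite ltr_norml; apply/andP; split; lra.
have [q qP] := choice H.
exists (\row_i q i); apply/rV_norm_lt => // i.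
by rewrite !mxE.
Qed.

(** An open set is the countable union of the cubes with rational center and radius [k.+1%:R^-1]
    that it contains. *)
Lemma open_measurable_lebRn (U : set V) : open U -> measurable (U : set lebRn).
Proof.
move=> oU.
pose c (k : 'rV[rat]_n.+1 * nat) : set V :=
  cube (map_mx ratr k.1) k.2.+1%:R^-1.
have -> : U = \bigcup_(k in [set k | c k `<=` U]) c k.
  apply/seteqP; split=> [x Ux|x [k kU]]; last exact: kU.
  have /nbhs_ballP[e/= e0 eU] := open_nbhs_nbhs (conj oU Ux).
  have [k ke] : exists k : nat, k.+1%:R^-1 < e / 2.
    have e20 : 0 < e / 2 by rewrite divr_gt0.
    have [k _ /(_ k (leqnn _))] := near_infty_natSinv_lt (PosNum e20).
    by exists k.
  have k0 : 0 < k.+1%:R^-1 :> R by rewrite invr_gt0.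
  have [q qx] := rat_rV_dense x k0.
  exists (q, k) => /=; last by rewrite /c /cube/= distrC ltW.
  move=> y; rewrite /c/cube/= => yq; apply: eU; rewrite mx_norm_ball /ball_/=.
  rewrite -(subrKA (map_mx ratr q)) (le_lt_trans (ler_normD _ _))//.
  rewrite (splitr e) ltrD//; first by rewrite distrC (lt_trans qx).
  by rewrite distrC (le_lt_trans yq).
have -> : [set k | c k `<=` U] = [set` (fun k => `[< c k `<=` U >])].
  by apply/seteqP; split=> k /= /asboolP.
rewrite bigcup_mkcond; apply: countable_bigcupT_measurable => [|k].
  exact: countableP.
by case: ifP => _; [exact: cube_measurable|exact: measurable0].
Qed.

Lemma mu_bounded_lty (A : set V) : bounded_set A -> (mu A < +oo)%E.
Proof.
move=> [M' [_ /(_ (M' + 1))]]; rewrite ltrDl ltr01 => /(_ isT).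
move: (M' + 1) => {M'}M AM; apply: (@le_lt_trans _ _ (mu (cube 0 (Num.max 0 M)))).
  by apply: le_leb_outer => x /AM; rewrite /cube/= subr0 => xM; rewrite le_max xM orbT.
by rewrite mu_cube ?ltry// le_max lexx.
Qed.

Lemma mu_sigma_finite : sigma_finite [set: lebRn] mu.
Proof.
exists (fun k => cube (0 : V) k%:R).
  apply/esym; rewrite -subTset => x _.
  exists (Num.bound `|x|) => //=; rewrite /cube/= subr0 ltW//.
  exact: archi_boundP.
by move=> k; split; [exact: cube_measurable|rewrite [ltLHS]mu_cube ?ltry].
Qed.

HB.instance Definition _ :=
  Measure_isSigmaFinite.Build _ lebRn R mu mu_sigma_finite.

Definition rV_shift (h x : V) : V := x + h.

(** Covers can be translated box by box; the inequality for the opposite shift gives equality. *)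
Lemma leb_outer_shift (h : V) (A : set V) :
  leb_outer (rV_shift h @^-1` A) = leb_outer A.
Proof.
have le h' (B : set V) : (leb_outer (rV_shift h' @^-1` B) <= leb_outer B)%E.
  apply: le_ereal_inf_tmp => _ [w cov <-]; apply: ereal_inf_lbound => /=.
  exists (fun k => ((w k).1 - h', (w k).2 - h')).
    move=> x /cov[k _ wk]; exists k => // i; have := wk i.
    by rewrite !mxE => /andP[h1 h2]; apply/andP; split; lra.
  apply: eq_eseriesr => k _; congr EFin; apply: eq_bigr => i _.
  by rewrite !mxE; congr Num.max; lra.
apply/eqP; rewrite eq_le le /=.
have {1}-> : A = rV_shift (- h) @^-1` (rV_shift h @^-1` A).
  by apply/seteqP; split=> x; rewrite /rV_shift/= subrK.
exact: le.
Qed.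

Lemma measurable_shift (h : V) :
  measurable_fun setT (rV_shift h : lebRn -> lebRn).
Proof.
move=> _ A mA; rewrite setTI; apply: le_caratheodory_measurable => X /=.
have -> : X = rV_shift h @^-1` (rV_shift (- h) @^-1` X).
  by apply/seteqP; split=> x; rewrite /rV_shift/= addrK.
rewrite preimage_setC -!preimage_setI !leb_outer_shift.
by rewrite -[leRHS](leb_outer_shift (- h)) (mA (rV_shift (- h) @^-1` X)).
Qed.

Lemma ge0_integral_shift (h : V) (f : V -> \bar R) :
  measurable_fun setT (f : lebRn -> \bar R) -> (forall x, 0 <= f x)%E ->
  (\int[mu]_x f (x + h)%R = \int[mu]_x f x)%E.
Proof.
move=> mf f0.
have /esym E := @ge0_integral_pushforward _ _ lebRn lebRn R _
  (measurable_shift h) mu setT f measurableT mf (fun y _ => f0 y).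
rewrite preimage_setT in E; rewrite [LHS]E.
refine (@eq_measure_integral _ lebRn R setT mu _ f _) => A mA _.
exact: leb_outer_shift.
Unshelve. exact: measurable_shift.
Qed.

Lemma integral_shift (h : V) (f : V -> \bar R) :
  measurable_fun setT (f : lebRn -> \bar R) ->
  (\int[mu]_x f (x + h)%R = \int[mu]_x f x)%E.
Proof.
move=> mf; rewrite integralE [RHS]integralE; congr (_ - _)%E.
  rewrite -[RHS](ge0_integral_shift h (measurable_funepos mf) (funepos_ge0 f)).
  by apply: eq_integral => x _; rewrite unlock.
rewrite -[RHS](ge0_integral_shift h (measurable_funeneg mf) (funeneg_ge0 f)).
by apply: eq_integral => x _; rewrite unlock.
Qed.

Lemma measurable_fun_shift (h : V) (f : V -> \bar R) :
  measurable_fun setT (f : lebRn -> \bar R) ->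
  measurable_fun setT ((fun x => f (x + h)) : lebRn -> \bar R).
Proof. by move=> mf; exact: (measurableT_comp mf (measurable_shift h)). Qed.

Lemma continuous_measurable_lebRn (f : V -> R) : continuous f ->
  measurable_fun setT (f : lebRn -> R).
Proof.
move=> /continuousP cf.
apply: (measurability _ (RGenOpens.measurableE R)) => // _ [_ [a [b ->]] <-].
by rewrite setTI; apply: open_measurable_lebRn; apply: cf; exact: interval_open.
Qed.

End lebesgue_rV.

(** * Smooth steps and bumps *)

Section smooth_functions.
Variable R : realType.
Implicit Types (f g : R -> R) (k : nat).

(** The one-variable counterpart of [Ck]. The derivative is quantified existentially, so that sums,
    products and inverses are treated by induction on [k] with an explicit candidate. *)
Fixpoint smoothn k f : Prop :=
  continuous f /\
  if k is k'.+1 then exists g, (forall x : R, is_derive x 1 f (g x)) /\ smoothn k' g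
  else True.

Lemma is_derive1_continuous f (x df : R) : is_derive x 1 f df -> {for x, continuous f}.
Proof.
by move=> [fx _]; apply: differentiable_continuous; exact/derivable1_diffP.
Qed.

Lemma smoothnS k f g :
  (forall x : R, is_derive x 1 f (g x)) -> smoothn k g -> smoothn k.+1 f.
Proof.
move=> fg sg; split; last by exists g.
by move=> x; exact: is_derive1_continuous (fg x).
Qed.

Lemma smoothn_continuous k f : smoothn k f -> continuous f.
Proof. by case: k => [|k] []. Qed.

Lemma smoothnW k f : smoothn k.+1 f -> smoothn k f.
Proof.
elim: k f => [|k ih] f [cf [g [fg sg]]]; first by split.
by apply: smoothnS fg _; exact: ih.
Qed.

Lemma smoothn_cst k (c : R) : smoothn k (fun=> c).
Proof.
elim: k c => [|k ih] c; first by split => //; exact: cst_continuous.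
apply: (@smoothnS k _ (fun=> 0)); last exact: ih.
Qed.

Lemma smoothnD k f g : smoothn k f -> smoothn k g ->
  smoothn k (fun t => f t + g t).
Proof.
elim: k f g => [|k ih] f g [cf sf] [cg sg].
  by split => // x; apply: cvgD; [exact: cf|exact: cg].
case: sf sg => [f' [ff' sf']] [g' [gg' sg']].
apply: (@smoothnS k _ (fun x => f' x + g' x)); last exact: ih.
Qed.

Lemma smoothnM k f g : smoothn k f -> smoothn k g ->
  smoothn k (fun t => f t * g t).
Proof.
elim: k f g => [|k ih] f g [cf sf] [cg sg].
  by split => // x; apply: cvgM; [exact: cf|exact: cg].
case: (sf) (sg) => [f' [ff' sf']] [g' [gg' sg']].
apply: (@smoothnS k _ (fun x => f x * g' x + g x * f' x)).
by apply: smoothnD; apply: ih => //; apply: smoothnW; split.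
Qed.

Lemma smoothn_affine k f (a b : R) : smoothn k f ->
  smoothn k (fun t => f (a * t + b)).
Proof.
have dl (x : R) : is_derive x 1 (fun t : R => a * t + b) a.
  have dD := is_deriveD (is_deriveZ a (is_derive_id x (1 : R)))
    (is_derive_cst b x (1 : R)).
  by apply: (is_derive_eq dD); rewrite addr0 [LHS]mulr1.
elim: k f => [|k ih] f [cf sf].
  split => // x; apply: continuous_comp; last exact: cf.
  exact: is_derive1_continuous (dl x).
case: sf => [f' [ff' sf']].
apply: (@smoothnS k _ (fun x => f' (a * x + b) * a)).
by apply: smoothnM; [exact: ih|exact: smoothn_cst].
Qed.

Lemma smoothnV k f : (forall x, f x != 0) -> smoothn k f ->
  smoothn k (fun t => (f t)^-1).
Proof.
move=> f0; elim: k => [|k ih] [cf sf].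
  by split => // x; apply: cvgV => //; exact: cf.
case: (sf) => [f' [ff' sf']].
apply: (@smoothnS k _ (fun x => -1 * ((f x)^-1 * (f x)^-1) * f' x)).
  move=> x; apply: (is_derive_eq (is_deriveV (f0 x) (ff' x))).
  by rewrite mulN1r -expr2 exprVn.
have sV : smoothn k (fun t => (f t)^-1) by apply: ih; apply: smoothnW; split.
by do ! apply: smoothnM => //; exact: smoothn_cst.
Qed.

(** The function exp(-1/t) with a factor t^-k, which makes the family stable under differentiation
    up to linear combinations. *)
Definition flat k (t : R) : R := if 0 < t then t^-1 ^+ k * expR (- t^-1) else 0.

Lemma flat_ge0 k t : 0 <= flat k t.
Proof.
rewrite /flat; case: ifPn => // t0.
by rewrite mulr_ge0 ?expR_ge0// exprn_ge0// invr_ge0 ltW.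
Qed.

Lemma flat_gt0 k t : 0 < t -> 0 < flat k t.
Proof.
by move=> t0; rewrite /flat t0 mulr_gt0 ?expR_gt0// exprn_gt0// invr_gt0.
Qed.

Lemma flat_eq0 k t : t <= 0 -> flat k t = 0.
Proof. by move=> t0; rewrite /flat ltNge t0. Qed.

(** With u = 1/t, one term of the exponential series gives u^(k+2) <= (k+2)! exp u. The quadratic
    bound makes the derivative at 0 vanish. *)
Lemma flat_le k t : flat k t <= (k.+2)`!%:R * t ^+ 2.
Proof.
rewrite /flat; case: ifPn => t0; last by rewrite mulr_ge0// sqr_ge0.
set u := t^-1; have u0 : 0 < u by rewrite invr_gt0.
rewrite expRN ler_pdivrMr ?expR_gt0//.
have -> : u ^+ k = t ^+ 2 * u ^+ k.+2.
  by rewrite -(addn2 k) exprD mulrCA -exprMn divff ?gt_eqF// expr1n mulr1.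
rewrite [leRHS]mulrAC [leRHS]mulrC; apply: ler_wpM2l; first exact: sqr_ge0.
rewrite -ler_pdivrMl ?ltr0n ?fact_gt0// mulrC.
by apply: le_trans (@expR_ge1Dxn _ u k.+1 (ltW u0)); rewrite lerDr.
Qed.

Lemma is_derive_sqr_le f (C : R) : (forall t, `|f t| <= C * t ^+ 2) ->
  is_derive (0 : R) 1 f 0.
Proof.
move=> fC.
have f0 : f 0 = 0.
  by apply/eqP; rewrite -normr_le0 (le_trans (fC 0))// expr0n mulr0.
have C0 : 0 <= C.
  by have := le_trans (normr_ge0 _) (fC 1); rewrite expr1n mulr1.
have lim0 : h^-1 *: ((f \o shift 0) (h *: (1 : R)) - f 0) @[h --> 0^'] --> (0 : R).
  apply/cvgrPdist_le => e e0.
  have eC : 0 < e / (C + 1) by rewrite divr_gt0// ltr_wpDl.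
  near=> h; rewrite f0 subr0 sub0r normrN normrZ normfV /= addr0.
  have h0 : 0 < `|h| by rewrite normr_gt0; near: h; exact: nbhs_dnbhs_neq.
  rewrite ler_pdivrMl//; apply: le_trans (fC _) _.
  rewrite [h *: 1]mulr1 -real_normK ?num_real// expr2 mulrA [leRHS]mulrC.
  rewrite ler_wpM2r//.
  have : `|h| <= e / (C + 1) by near: h; exact: dnbhs0_le.
  rewrite ler_pdivlMr ?ltr_wpDl// => /(le_trans _); apply.
  by rewrite mulrC ler_wpM2l// lerDl.
apply: DeriveDef; first by apply/cvg_ex; exists 0.
exact: cvg_lim lim0.
Unshelve. all: by end_near. Qed.

Lemma flat_le_sqr k t : `|flat k t| <= (k.+2)`!%:R * t ^+ 2.
Proof. by rewrite ger0_norm ?flat_ge0// flat_le. Qed.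

Lemma is_derive_flat k (t : R) :
  is_derive t 1 (flat k) (flat k.+2 t + (- k%:R) * flat k.+1 t).
Proof.
have [t0|t0|->] := ltgtP t 0.
- rewrite !flat_eq0 ?ltW// mulr0 addr0.
  apply: (@near_eq_is_derive _ _ _ (cst 0)).
    near=> y; rewrite flat_eq0//; apply: ltW; near: y; exact: lt_nbhsl.
- rewrite /flat t0.
  apply: (@near_eq_is_derive R _ _ (fun y : R => y^-1 ^+ k * expR (- y^-1))).
  + by near=> y; rewrite ifT//; near: y; exact: lt_nbhsr.
  + have tn0 : t != 0 by rewrite gt_eqF.
    have dV := is_deriveV tn0 (is_derive_id t 1).
    have dX := @is_deriveX _ _ _ k _ _ _ dV.
    have dE := @is_derive1_comp R expR (fun y => - y^-1) t _ _
      (is_derive_expR (- t^-1)) (is_deriveN dV).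
    have -> : (fun y : R => y^-1 ^+ k * expR (- y^-1)) =
        GRing.inv ^+ k * (expR \o (fun y : R => - y^-1)).
      by apply/funext => y; rewrite /= exprfctE.
    apply: (is_derive_eq (is_deriveM dX dE)).
    rewrite exprfctE /GRing.scale/= -exprVn; set u := t^-1; set E := expR (- u).
    case: k {dX} => [|k] /=; rewrite ?exprS ?expr0 ?expr2; last first.
      lra.
    lra.
- rewrite !flat_eq0// mulr0 addr0.
  exact: (is_derive_sqr_le (C := (k.+2)`!%:R) (flat_le_sqr k)).
Unshelve. all: by end_near. Qed.

End smooth_functions.

(** * Smooth transitions and their derivatives *)

Section smooth_step.
Variable R : realType.
Implicit Types (t c s : R).

Let den t := flat 0 (1 + t) + flat 0 (1 - t).

Let den_gt0 t : 0 < den t.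
Proof.
have [t0|t0] := leP 0 t.
  by rewrite ltr_wpDr ?flat_ge0// flat_gt0// ltr_wpDr.
by rewrite ltr_wpDl ?flat_ge0// flat_gt0// subr_gt0 (lt_trans t0).
Qed.

Definition step t := flat 0 (1 + t) / den t.

(* The derivative of [step], as [flat 2] is that of [flat 0]. *)
Definition bump t := (flat 2 (1 + t) * flat 0 (1 - t) +
  flat 0 (1 + t) * flat 2 (1 - t)) / den t ^+ 2.

Lemma smoothn_flat k j : smoothn k (@flat R j).
Proof.
elim: k j => [|k ih] j.
  by split=> // t; exact: is_derive1_continuous (is_derive_flat j t).
apply: smoothnS (is_derive_flat j) _.
by apply: smoothnD => //; apply: smoothnM => //; exact: smoothn_cst.
Qed.

Let is_derive_1D t : is_derive t 1 (fun t => flat 0 (1 + t)) (flat 2 (1 + t)).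
Proof.
have d1 : is_derive t 1 (fun t : R => 1 + t) 1.
  apply: (is_derive_eq (is_deriveD (is_derive_cst (1 : R) t 1) (is_derive_id t 1))).
  by rewrite add0r.
apply: (is_derive_eq (is_derive1_comp (is_derive_flat 0 (1 + t)) d1)).
by rewrite oppr0 mul0r addr0 mulr1.
Qed.

Let is_derive_1B t : is_derive t 1 (fun t => flat 0 (1 - t)) (- flat 2 (1 - t)).
Proof.
have d1 : is_derive t 1 (fun t : R => 1 - t) (-1).
  apply: (is_derive_eq (is_deriveB (is_derive_cst (1 : R) t 1) (is_derive_id t 1))).
  by rewrite sub0r.
apply: (is_derive_eq (@is_derive1_comp R (flat 0) (fun t => 1 - t) t _ _
  (is_derive_flat 0 (1 - t)) d1)).
by rewrite oppr0 mul0r addr0 mulrN1.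
Qed.

Lemma is_derive_step t : is_derive t 1 step (bump t).
Proof.
have dD : is_derive t 1 den (flat 2 (1 + t) - flat 2 (1 - t)).
  exact: is_deriveD.
have d0 : den t != 0 by rewrite gt_eqF.
apply: (is_derive_eq (is_deriveM (is_derive_1D t) (is_deriveV d0 dD))).
rewrite /bump /GRing.scale/= -exprVn.
have : den t * (den t)^-1 = 1 by rewrite divff.
rewrite {1}/den; move: (den t)^-1 => u; rewrite expr2 => H.
set a := flat 0 (1 + t) in H *; set b := flat 0 (1 - t) in H *.
set a' := flat 2 (1 + t); set b' := flat 2 (1 - t).
have -> : u * a' = u * a' * ((a + b) * u) by rewrite H mulr1.
lra.
Qed.

Lemma step_ge0_le1 t : 0 <= step t <= 1.
Proof.
rewrite /step divr_ge0 ?flat_ge0 ?(ltW (den_gt0 _))//= ler_pdivrMr// mul1r.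
by rewrite lerDl flat_ge0.
Qed.

Lemma step_le t : t <= -1 -> step t = 0.
Proof. by move=> t1; rewrite /step flat_eq0 ?mul0r//; lra. Qed.

Lemma step_ge t : 1 <= t -> step t = 1.
Proof.
move=> t1; rewrite /step /den (@flat_eq0 _ _ (1 - t)) ?addr0; last by lra.
by rewrite divff// gt_eqF// flat_gt0//; lra.
Qed.

Lemma bump_ge0 t : 0 <= bump t.
Proof.
by rewrite /bump divr_ge0 ?exprn_ge0 ?addr_ge0 ?mulr_ge0 ?flat_ge0 ?(ltW (den_gt0 _)).
Qed.

Lemma bump_gt0 : 0 < bump 0.
Proof.
rewrite /bump divr_gt0 ?exprn_gt0// addr0 subr0.
by rewrite addr_gt0// mulr_gt0// flat_gt0.
Qed.

Lemma bump_eq0 t : 1 <= `|t| -> bump t = 0.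
Proof.
rewrite /bump ler_normr => /orP[t1|t1].
  by rewrite ![flat _ (1 - t)]flat_eq0 ?mulr0 ?addr0 ?mul0r//; lra.
by rewrite ![flat _ (1 + t)]flat_eq0 ?mul0r ?addr0 ?mul0r//; lra.
Qed.

Lemma smoothn_bump k : smoothn k bump.
Proof.
have sp j i : smoothn j (fun t => @flat R i (1 + t)).
  have := smoothn_affine 1 1 (@smoothn_flat j i); congr smoothn.
  by apply/funext => t; rewrite mul1r addrC.
have sm j i : smoothn j (fun t => @flat R i (1 - t)).
  have := smoothn_affine (-1) 1 (@smoothn_flat j i); congr smoothn.
  by apply/funext => t; rewrite mulN1r addrC.
apply: smoothnM; first by apply: smoothnD; exact: smoothnM.
apply: smoothnV => [t|]; first by rewrite expf_neq0 ?gt_eqF.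
have sd : smoothn k den by exact: smoothnD.
by have := smoothnM sd sd; congr smoothn; apply/funext => t; rewrite expr2.
Qed.

Lemma smoothn_step k : smoothn k step.
Proof.
apply: smoothnW; apply: smoothnS is_derive_step _; exact: smoothn_bump.
Qed.

Lemma bump_bounded : exists K, 1 <= K /\ forall t, bump t <= K.
Proof.
have : compact (bump @` `[-1, 1]).
  apply: continuous_compact; last exact: segment_compact.
  apply: continuous_subspaceT; exact: smoothn_continuous (smoothn_bump 0).
move=> /compact_bounded[M [_ /(_ (Num.max 1 (M + 1)))]].
rewrite lt_max ltrDl ltr01 orbT => /(_ isT) H.
exists (Num.max 1 (M + 1)); rewrite le_max lexx; split=> // t.
have [t1|t1] := leP `|t| 1; last by rewrite bump_eq0 ?(ltW t1)// le_max ler01.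
rewrite (le_trans (ler_norm _))// H//=; exists t => //.
by rewrite in_itv/= -ler_norml.
Qed.

(** Rescalings to the interval of center [c] and radius [s]. The division by [s] in [bumpI] makes it
    the derivative of [stepI], whose total increase is 1 at every scale. *)
Definition stepI c s t := step ((t - c) / s).
Definition bumpI c s t := bump ((t - c) / s) / s.

Lemma smoothn_rescale k (f : R -> R) c s : smoothn k f ->
  smoothn k (fun t => f ((t - c) / s)).
Proof.
move=> /(smoothn_affine s^-1 (- c / s)); congr smoothn; apply/funext => t.
by rewrite mulrC -mulrDl.
Qed.

Lemma is_derive_stepI c s t : is_derive t 1 (stepI c s) (bumpI c s t).
Proof.
have dl : is_derive t 1 (fun t : R => (t - c) / s) (s^-1).
  rewrite (_ : (fun t => (t - c) / s) = s^-1 \*: (id - cst c)); last first.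
    by apply/funext => y; rewrite /= mulrC.
  apply: (is_derive_eq (is_deriveZ s^-1
    (is_deriveB (is_derive_id t (1 : R)) (is_derive_cst c t (1 : R))))).
  by rewrite subr0 [LHS]mulr1.
exact: (is_derive1_comp (is_derive_step _) dl).
Qed.

Lemma smoothn_stepI k c s : smoothn k (stepI c s).
Proof. exact/smoothn_rescale/smoothn_step. Qed.

Lemma smoothn_bumpI k c s : smoothn k (bumpI c s).
Proof.
apply: smoothnM; last exact: smoothn_cst.
exact/smoothn_rescale/smoothn_bump.
Qed.

Lemma bumpI_ge0 c s t : 0 < s -> 0 <= bumpI c s t.
Proof. by move=> s0; rewrite /bumpI divr_ge0 ?bump_ge0 ?ltW. Qed.

Lemma bumpI_eq0 c s t : 0 < s -> s <= `|t - c| -> bumpI c s t = 0.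
Proof.
move=> s0 st; rewrite /bumpI bump_eq0 ?mul0r// normrM normfV (gtr0_norm s0).
by rewrite ler_pdivlMr// mul1r.
Qed.

Lemma stepI_eq c s t : 0 < s -> s <= `|t - c| ->
  stepI c s t = (c <= t)%R%:R.
Proof.
move=> s0; rewrite ler_normr /stepI => /orP[st|st].
  by rewrite step_ge ?ler_pdivlMr// ?mul1r// (_ : c <= t)//; lra.
rewrite step_le ?ler_pdivrMr//; last by lra.
by rewrite (_ : c <= t = false)//; apply/negbTE; rewrite -ltNge; lra.
Qed.

End smooth_step.

(** * Tensor products of one-variable functions as test functions *)

Section product_test_functions.
Variables (R : realType) (n : nat).
Local Notation V := 'rV[R]_n.+1.
Implicit Types (h : 'I_n.+1 -> R -> R) (x : V).

Definition prodfn h : V -> R := fun x => \prod_i h i (x 0 i).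

Lemma continuous_big_prod (T : topologicalType) (I : Type) (r : seq I)
    (f : I -> T -> R) :
  (forall i, continuous (f i)) -> continuous (fun x : T => \prod_(i <- r) f i x).
Proof.
move=> cf; elim: r => [|i r ih] x.
  have -> : (fun x : T => \prod_(i <- [::]) f i x) = cst 1.
    by apply/funext => y; rewrite big_nil.
  exact: cst_continuous.
have -> : (fun x : T => \prod_(j <- i :: r) f j x) =
    (fun x : T => f i x * \prod_(j <- r) f j x).
  by apply/funext => y; rewrite big_cons.
by apply: cvgM; [exact: cf|exact: ih].
Qed.

Lemma continuous_prodfn h : (forall i, continuous (h i)) ->
  continuous (prodfn h).
Proof.
move=> ch; apply: continuous_big_prod => i x.
by apply: continuous_comp; [exact: coord_continuous|exact: ch].
Qed.

Lemma is_derive_prodfn h (j : 'I_n.+1) (h' : R) x :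
  is_derive (x 0 j) 1 (h j) h' ->
  is_derive x (delta_mx 0 j) (prodfn h) (h' * \prod_(i | i != j) h i (x 0 i)).
Proof.
move=> [dh vh]; set c := \prod_(i | i != j) _.
have quotE : (fun t : R => t^-1 *: ((prodfn h \o shift x) (t *: delta_mx 0 j) -
     prodfn h x)) =
   (fun t : R => (t^-1 *: ((h j \o shift (x 0 j)) (t *: (1 : R)) - h j (x 0 j))) * c).
  apply/funext => t; rewrite /prodfn /= (bigD1 j)//= [X in _ - X](bigD1 j)//=.
  rewrite !mxE !eqxx -/c [t *: 1]/(t * 1).
  rewrite (eq_bigr (fun i => h i (x 0 i))); last first.
    by move=> i ij; rewrite !mxE eqxx (negbTE ij)/= mulr0 add0r.
  by rewrite -/c -mulrBl [LHS]mulrA.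
have lim : t^-1 *: ((prodfn h \o shift x) (t *: delta_mx 0 j) - prodfn h x)
    @[t --> 0^'] --> h' * c.
  by rewrite quotE; apply: cvgMl; rewrite -vh; exact: dh.
apply: DeriveDef; first by apply/cvg_ex; exists (h' * c).
exact: cvg_lim lim.
Qed.

Definition subst_fn h (j : 'I_n.+1) (g : R -> R) : 'I_n.+1 -> R -> R :=
  fun i => if i == j then g else h i.

Lemma partial_prodfn h (j : 'I_n.+1) (g : R -> R) :
  (forall t : R, is_derive t 1 (h j) (g t)) ->
  partial j (prodfn h) = prodfn (subst_fn h j g).
Proof.
move=> hg; apply/funext => x.
rewrite /partial; have [_ ->] := is_derive_prodfn (hg (x 0 j)).
rewrite /prodfn [RHS](bigD1 j)//= /subst_fn eqxx; congr (_ * _).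
by apply: eq_bigr => i /negbTE ->.
Qed.

Lemma Ck_prodfn k h : (forall i, smoothn k (h i)) -> Ck k (prodfn h).
Proof.
elim: k h => [|k ih] h sh.
  by split=> //; apply: continuous_prodfn => i; exact: smoothn_continuous (sh i).
split.
  by apply: continuous_prodfn => i; exact: smoothn_continuous (sh i).
move=> j; have [_ [g [hg sg]]] := sh j.
split; first by move=> x; have [] := is_derive_prodfn (hg (x 0 j)).
rewrite (partial_prodfn hg); apply: ih => i; rewrite /subst_fn.
by case: eqP => // _; exact: smoothnW.
Qed.

Lemma prodfn_test_function h (M : R) :
  (forall i k, smoothn k (h i)) -> (forall i t, M < `|t| -> h i t = 0) ->
  test_function (prodfn h).
Proof.
move=> sh h0; split=> [k|]; first exact: Ck_prodfn.
apply: bounded_closed_compact; last exact: closed_closure.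
have M0 : 0 <= Num.max 0 M by rewrite le_max lexx.
have cl : closed (cube (0 : V) (Num.max 0 M)).
  rewrite /cube (_ : mkset _ = (fun x : V => `|x|) @^-1` [set y | y <= Num.max 0 M]).
    by apply: closed_comp => //; move=> *; exact: norm_continuous.
  by apply/seteqP; split => y /=; rewrite subr0.
exists (Num.max 0 M); split; first exact: num_real.
move=> N MN x cx.
have : cube (0 : V) (Num.max 0 M) x.
  apply: cl; apply: closure_subset cx => y /= py.
  rewrite /cube/= subr0; apply/rV_norm_le => // i.
  rewrite leNgt; apply/negP; rewrite gt_max => /andP[_ /h0 hi].
  by move: py; rewrite /prodfn (bigD1 i)//= hi mul0r eqxx.
by rewrite /cube/= subr0 => /le_trans; apply; exact: ltW.
Qed.

(** The factors are exchanged one index at a time. For products of bumps, the single difference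
    factor is the derivative of a difference of steps, which makes each term a partial
    derivative. *)
Lemma prod_telescope (a b : 'I_n.+1 -> R) :
  \prod_i a i - \prod_i b i = \sum_(m < n.+1)
    \prod_(i < n.+1) (if (i < m)%N then b i else if i == m then a i - b i else a i).
Proof.
pose P (m : nat) := \prod_(i < n.+1) (if (i < m)%N then b i else a i).
have -> : \prod_i a i = P 0%N by apply: eq_bigr.
have -> : \prod_i b i = P n.+1 by apply: eq_bigr => i _; rewrite ltn_ord.
rewrite -opprB -telescope_sumr// big_mkord -sumrN; apply: eq_bigr => m _.
rewrite opprB /P (bigD1 m)//= [X in _ - X](bigD1 m)//= [RHS](bigD1 m)//=.
rewrite ltnn ltnSn eqxx mulrBl; congr (_ * _ - _ * _).
  by apply: eq_bigr => i /negbTE ->.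
apply: eq_bigr => i im; rewrite ltnS leq_eqVlt (negbTE im) /=.
by rewrite -[i == m :> nat]/(i == m) (negbTE im).
Qed.

End product_test_functions.

(** * Weak gradients of locally dominated functions *)

Section banach_limit.
Variable R : realType.
Implicit Types a b : nat -> R.

(** The limit along an ultrafilter finer than [\oo]; it exists on bounded sequences because closed
    intervals are compact. This positive linear functional does the work of extracting weakly
    convergent subsequences. *)
Lemma banach_limit : exists Lim : (nat -> R) -> R,
  [/\ (forall a b, bounded_set (range a) -> bounded_set (range b) ->
        Lim (fun k => a k + b k) = Lim a + Lim b),
      (forall c a, bounded_set (range a) -> Lim (fun k => c * a k) = c * Lim a),
      (forall a, bounded_set (range a) -> (forall k, 0 <= a k) -> 0 <= Lim a)
    & forall a l, a @ \oo --> l -> Lim a = l].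
Proof.
have [U [UU ooU]] := @ultraFilterLemma nat \oo _.
have PU := ultra_proper.
have cv a : bounded_set (range a) -> a @ U --> lim (a @ U).
  move=> [M [_ /(_ (M + 1))]]; rewrite ltrDl ltr01 => /(_ isT) aM.
  apply/cvg_ex.
  have := @segment_compact R (- (M + 1)) (M + 1); rewrite compact_ultra => co.
  have UaU : UltraFilter (a @ U).
    split=> [|G PG UG]; first exact: fmap_proper_filter.
    apply/seteqP; split => [A GA|]; last exact: UG.
    have [//|Ua] := in_ultra_setVsetC (a @^-1` A) UU.
    have /UG GCA : (a @ U) (~` A) by [].
    have : G (A `&` ~` A) by exact: filterI.
    by rewrite setICr => /filter_not_empty.
  have [|l [_ al]] := co _ UaU; last by exists l.
  apply: (@filterS _ U _ setT) => [k _ /=|]; last exact: filterT.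
  rewrite in_itv/= -ler_norml.
  by apply: aM; exists k.
exists (fun a => lim (a @ U)); split.
- by move=> a b /cv ca /cv cb; apply: cvg_lim => //; exact: cvgD.
- by move=> c a /cv ca; apply: cvg_lim => //; apply: cvgMr.
- by move=> a /cv ca a0; apply: limr_ge; [apply/cvg_ex; eexists; exact: ca|
    exact: nearW].
- move=> a l al; apply: cvg_lim => //.
  by move=> A /al; exact: ooU.
Qed.

End banach_limit.

(** * Weak limits of dominated sequences through Radon-Nikodym *)

Section dominated_weak_limit.
Context d (T : measurableType d) (R : realType)
  (mu : {sigma_finite_measure set T -> \bar R}).
Variable Lim : (nat -> R) -> R.
Hypothesis LimD : forall a b : nat -> R, bounded_set (range a) -> bounded_set (range b) ->
  Lim (fun k => a k + b k) = Lim a + Lim b.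
Hypothesis LimZ : forall (c : R) (a : nat -> R), bounded_set (range a) ->
  Lim (fun k => c * a k) = c * Lim a.
Hypothesis Lim_ge0 : forall a : nat -> R, bounded_set (range a) ->
  (forall k, 0 <= a k) -> 0 <= Lim a.
Hypothesis Lim_cvg : forall (a : nat -> R) (l : R), a @ \oo --> l -> Lim a = l.

Lemma bounded_range (a : nat -> R) M : (forall k, `|a k| <= M) ->
  bounded_set (range a).
Proof.
move=> aM; exists M; split; first exact: num_real.
by move=> N MN _ [k _ <-] /=; rewrite (le_trans (aM k))// ltW.
Qed.

Lemma Lim_cst c : Lim (fun=> c) = c.
Proof. by apply: Lim_cvg; exact: cvg_cst. Qed.

Lemma Lim_le a b M : (forall k, `|a k| <= M) -> (forall k, `|b k| <= M) ->
  (forall k, a k <= b k) -> Lim a <= Lim b.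
Proof.
move=> aM bM ab; rewrite -subr_ge0.
have ba := bounded_range aM; have bb := bounded_range bM.
have bNa : bounded_set (range (fun k => -1 * a k)).
  by apply: (@bounded_range _ M) => k; rewrite mulN1r normrN.
rewrite -[X in _ - X]mul1r -mulNr -LimZ// -LimD//; apply: Lim_ge0.
  apply: (@bounded_range _ (M + M)) => k.
  by rewrite (le_trans (ler_normD _ _))// mulN1r normrN lerD.
by move=> k; rewrite mulN1r subr_ge0.
Qed.

Section nonneg.
Variables (g : T -> R) (v : nat -> T -> R).
Hypothesis ig : mu.-integrable setT (EFin \o g).
Hypothesis mv : forall k, measurable_fun setT (v k).
Hypothesis v0 : forall k x, 0 <= v k x.
Hypothesis vg : forall k x, v k x <= g x.

Let iv k : mu.-integrable setT (EFin \o v k).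
Proof.
apply: le_integrable ig => //; first exact/measurable_EFinP.
move=> x _; rewrite /= lee_fin !ger0_norm//.
exact: le_trans (v0 k x) (vg k x).
Qed.

Let igA A : measurable A -> mu.-integrable A (EFin \o g).
Proof. by move=> mA; exact: integrableS ig. Qed.

Let ivA k A : measurable A -> mu.-integrable A (EFin \o v k).
Proof. by move=> mA; exact: integrableS (iv k). Qed.

Let L (A : set T) : R := \int[mu]_(x in A) g x.
Let a (A : set T) k : R := \int[mu]_(x in A) v k x.

Let a_ge0 A k : 0 <= a A k.
Proof. by apply: Rintegral_ge0 => x _. Qed.

Let a_le A k : measurable A -> a A k <= L A.
Proof. by move=> mA; apply: le_Rintegral => //; [exact: ivA|exact: igA]. Qed.

Let a_norm A k : measurable A -> `|a A k| <= L A.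
Proof. by move=> mA; rewrite ger0_norm//; exact: a_le. Qed.

(** A measure has to be nonnegative on all sets, including those where nothing is known of [Lim];
    the maximum with 0 ensures this and changes nothing on measurable sets. *)
Definition weak_limit_set (A : set T) : \bar R :=
  (Num.max 0 (Lim (fun k => \int[mu]_(x in A) v k x)))%:E.

Let N (A : set T) : R := Lim (a A).

Let N_ge0 A : measurable A -> 0 <= N A.
Proof.
by move=> mA; apply: Lim_ge0 => //; apply: (@bounded_range _ (L A)) => k; exact: a_norm.
Qed.

Let N_le A : measurable A -> N A <= L A.
Proof.
move=> mA; rewrite -[leRHS]Lim_cst; apply: (@Lim_le _ _ (L A)) => k.
- exact: a_norm.
- by rewrite ger0_norm// (le_trans (a_ge0 A 0))// a_le.
- exact: a_le.
Qed.

Let N_U A B : measurable A -> measurable B -> [disjoint A & B] ->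
  N (A `|` B) = N A + N B.
Proof.
move=> mA mB AB; rewrite /N -LimD.
- congr Lim; apply/funext => k; apply: Rintegral_setU => //.
  by apply: ivA; exact: measurableU.
- by apply: (@bounded_range _ (L A)) => k; exact: a_norm.
- by apply: (@bounded_range _ (L B)) => k; exact: a_norm.
Qed.

Let L_U A B : measurable A -> measurable B -> [disjoint A & B] ->
  L (A `|` B) = L A + L B.
Proof.
by move=> mA mB AB; apply: Rintegral_setU => //; apply: igA; exact: measurableU.
Qed.

Let weak_limitE A : measurable A -> weak_limit_set A = (N A)%:E.
Proof. by move=> mA; rewrite /weak_limit_set max_r//; exact: N_ge0. Qed.

Let weak_limit_set0 : weak_limit_set set0 = 0%E.
Proof.
rewrite weak_limitE//; congr EFin; rewrite -[RHS]Lim_cst; congr Lim.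
by apply/funext => k; rewrite /a Rintegral_set0.
Qed.

Let weak_limit_set_ge0 A : (0 <= weak_limit_set A)%E.
Proof. by rewrite lee_fin le_max lexx. Qed.

Let N_bigU (F : nat -> set T) n : (forall i, measurable (F i)) ->
  trivIset setT F ->
  N (\big[setU/set0]_(i < n) F i) = \sum_(i < n) N (F i) /\
  L (\big[setU/set0]_(i < n) F i) = \sum_(i < n) L (F i).
Proof.
move=> mF tF; elim: n => [|n [ih1 ih2]].
  rewrite !big_ord0 /L Rintegral_set0; split=> //.
  by have := weak_limitE measurable0; rewrite weak_limit_set0 => -[].
have mU : measurable (\big[setU/set0]_(i < n) F i).
  by apply: bigsetU_measurable => i _; exact: mF.
have dis : [disjoint \big[setU/set0]_(i < n) F i & F n].
  apply/disj_set2P/seteqP; split=> // x [].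
  rewrite -bigcup_mkord => -[i /= ilt Fi] Fn.
  have E := tF i n I I (ex_intro _ x (conj Fi Fn)).
  by rewrite E ltnn in ilt.
by rewrite !big_ord_recr/= N_U// L_U// ih1 ih2.
Qed.

(** Finite additivity passes to [Lim]. Countable additivity follows because the mass of a tail is at
    most the integral of [g] over it, and these integrals tend to 0. *)
Let weak_limit_set_semi_sigma_additive : semi_sigma_additive weak_limit_set.
Proof.
move=> F mF tF mUF.
have mU n : measurable (\big[setU/set0]_(i < n) F i).
  by apply: bigsetU_measurable => i _; exact: mF.
pose Tl n := \bigcup_i F i `\` \big[setU/set0]_(i < n) F i.
have mT n : measurable (Tl n) by exact: measurableD.
have split_ n : \bigcup_i F i = \big[setU/set0]_(i < n) F i `|` Tl n.
  rewrite setDUK// => x; rewrite -bigcup_mkord => -[i _ Fi]; by exists i.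
have dis n : [disjoint \big[setU/set0]_(i < n) F i & Tl n].
  by apply/disj_set2P; rewrite setDIK.
rewrite weak_limitE//.
have -> : (fun n => \sum_(0 <= i < n) weak_limit_set (F i))%E =
    EFin \o (fun n => \sum_(i < n) N (F i)).
  apply/funext => n /=; rewrite big_mkord -sumEFin.
  by apply: eq_bigr => i _; rewrite weak_limitE.
apply: cvg_EFin; first by near=> n.
rewrite -[fine \o _]/(fun n => \sum_(i < n) N (F i)).
have Lcv : (fun n => \sum_(i < n) L (F i)) @ \oo --> L (\bigcup_i F i).
  have LE A : measurable A -> (L A)%:E = (\int[mu]_(x in A) (g x)%:E)%E.
    by move=> mA; rewrite fineK//; apply: integrable_fin_num => //; exact: igA.
  have g0 x : 0 <= g x by exact: le_trans (v0 0 x) (vg 0 x).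
  have E : (EFin \o (fun n => \sum_(i < n) L (F i))) @ \oo -->
      (L (\bigcup_i F i))%:E.
    rewrite LE// ge0_integral_bigcup//; last 2 first.
    - by apply: measurable_funTS; case/integrableP : ig.
    - by move=> x _; rewrite lee_fin.
    have -> : EFin \o (fun n => \sum_(i < n) L (F i)) =
        (fun n => \sum_(0 <= i < n) \int[mu]_(x in F i) (g x)%:E)%E.
      by apply/funext => n /=; rewrite big_mkord -sumEFin; apply: eq_bigr => i _;
        rewrite LE.
    apply: is_cvg_nneseries => i _ _; apply: integral_ge0 => x _.
    by rewrite lee_fin.
  exact: (fine_cvg E).
(* Lower bound for the squeeze: the part of the union beyond the first [n] sets has [N] at most its
   [L]. *)
have lowcv : (fun n => N (\bigcup_i F i) - (L (\bigcup_i F i) -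
    \sum_(i < n) L (F i))) @ \oo --> N (\bigcup_i F i).
  rewrite -[X in _ --> X]subr0 -[X in _ --> _ - X](subrr (L (\bigcup_i F i))).
  by apply: cvgB; [exact: cvg_cst|apply: cvgB => //; exact: cvg_cst].
apply: (squeeze_cvgr _ lowcv (cvg_cst _)); near=> n => /=.
have [<- <-] := N_bigU n mF tF.
rewrite (split_ n) N_U// L_U//.
have := N_ge0 (mT n); have := N_le (mT n); lra.
Unshelve. all: by end_near. Qed.

HB.instance Definition _ := isMeasure.Build _ T R weak_limit_set
  weak_limit_set0 weak_limit_set_ge0 weak_limit_set_semi_sigma_additive.

Let weak_limit_set_fin : fin_num_fun weak_limit_set.
Proof. by move=> A mA; rewrite weak_limitE. Qed.

HB.instance Definition _ := Measure_isFinite.Build _ T R weak_limit_set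
  weak_limit_set_fin.

Lemma dominated_weak_limit_ge0 : exists f : T -> R,
  [/\ mu.-integrable setT (EFin \o f), (forall x, 0 <= f x) &
    forall A, measurable A ->
      Lim (fun k => \int[mu]_(x in A) v k x) = \int[mu]_(x in A) f x].
Proof.
have dom : weak_limit_set `<< mu.
  apply/null_content_dominatesP => A mA A0; rewrite weak_limitE//.
  congr EFin; rewrite -[RHS]Lim_cst; congr Lim; apply/funext => k.
  by rewrite /a /Rintegral null_set_integral//; case/integrableP: (ivA k mA).
have [f [f0 ffin if_ fE]] := radon_nikodym_sigma_finite dom.
exists (fine \o f); split.
- apply: eq_integrable if_ => //; by move=> x _; rewrite /= fineK.
- by move=> x; exact: fine_ge0.
- move=> A mA; have := fE A mA; rewrite [LHS]weak_limitE// => NE.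
  rewrite -/(a A) -/(N A) -[LHS]/(fine (N A)%:E) NE; congr fine.
  by apply: eq_integral => x _; rewrite /= fineK.
Qed.

End nonneg.

(** Adding [g] to [u k] makes the sequence nonnegative and bounded by [g + g]; subtracting [g] from
    the density recovers the signed limit. *)
Lemma dominated_weak_limit (g : T -> R) (u : nat -> T -> R) :
  mu.-integrable setT (EFin \o g) ->
  (forall k, measurable_fun setT (u k)) ->
  (forall k x, `|u k x| <= g x) ->
  exists f : T -> R,
  [/\ mu.-integrable setT (EFin \o f),
    (forall A, measurable A -> `|\int[mu]_(x in A) f x| <= \int[mu]_(x in A) g x) &
    forall A, measurable A ->
      Lim (fun k => \int[mu]_(x in A) u k x) = \int[mu]_(x in A) f x].
Proof.
move=> ig mu_ ug.
have mg : measurable_fun setT g by case/integrableP : (ig) => /measurable_EFinP.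
have ig2 : mu.-integrable setT (EFin \o (fun x => g x + g x)).
  by apply: eq_integrable (integrableD measurableT ig ig).
have [|||f [if_ f0 fE]] := @dominated_weak_limit_ge0 (fun x => g x + g x)
    (fun k x => u k x + g x) ig2.
- by move=> k; exact: measurable_funD.
- by move=> k x; have := ug k x; rewrite ler_norml => /andP[+ _]; rewrite -subr_ge0 opprK.
- by move=> k x; rewrite lerD2r (le_trans (ler_norm _)).
have iu k : mu.-integrable setT (EFin \o u k).
  apply: le_integrable ig => //; first exact/measurable_EFinP.
  by move=> x _; rewrite /= lee_fin (le_trans (ug k x))// ler_norm.
have iS (h : T -> R) A : measurable A -> mu.-integrable setT (EFin \o h) ->
  mu.-integrable A (EFin \o h) by move=> mA; exact: integrableS.
have bd A k : measurable A -> `|\int[mu]_(x in A) u k x| <= \int[mu]_(x in A) g x.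
  move=> mA; apply: (le_trans (le_normr_Rintegral _ _)) => //; first exact: iS.
  apply: le_Rintegral => //; last exact: iS.
  by apply: iS => //; exact: integrable_norm.
have fE' A : measurable A ->
    Lim (fun k => \int[mu]_(x in A) u k x) = \int[mu]_(x in A) (f x - g x).
  move=> mA; rewrite RintegralB//; [|exact: iS|exact: iS].
  rewrite -fE//.
  have -> : (fun k => \int[mu]_(x in A) (u k x + g x)) =
      (fun k => \int[mu]_(x in A) u k x + \int[mu]_(x in A) g x).
    by apply/funext => k; rewrite RintegralD//; exact: iS.
  rewrite LimD ?Lim_cst ?addrK//.
    by apply: (@bounded_range _ (\int[mu]_(x in A) g x)) => k; exact: bd.
  by apply: (@bounded_range _ `|\int[mu]_(x in A) g x|).
exists (fun x => f x - g x); split=> //.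
- by apply: eq_integrable (integrableB measurableT if_ ig).
- move=> A mA; rewrite -fE'//.
  have H : forall k, `|\int[mu]_(x in A) u k x| <= \int[mu]_(x in A) g x.
    by move=> k; exact: bd.
  have G0 : 0 <= \int[mu]_(x in A) g x := le_trans (normr_ge0 _) (H 0).
  set G := \int[mu]_(x in A) g x in H G0 *.
  have Hl k : - G <= \int[mu]_(x in A) u k x.
    by have := H k; rewrite ler_norml => /andP[].
  have Hr k : \int[mu]_(x in A) u k x <= G.
    by have := H k; rewrite ler_norml => /andP[].
  have nG : `|G| <= G by rewrite ger0_norm.
  rewrite ler_norml; apply/andP; split.
    rewrite -[leLHS]Lim_cst; apply: (@Lim_le _ _ G) => // k.
    by rewrite normrN.
  by rewrite -[leRHS]Lim_cst; apply: (@Lim_le _ _ G).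
Qed.

End dominated_weak_limit.

(** * From integrals over sets to pairings with bounded functions *)

Section dominated_weak_limit_pairing.
Context d (T : measurableType d) (R : realType)
  (mu : {sigma_finite_measure set T -> \bar R}).
Variable Lim : (nat -> R) -> R.
Hypothesis LimD : forall a b : nat -> R, bounded_set (range a) ->
  bounded_set (range b) -> Lim (fun k => a k + b k) = Lim a + Lim b.
Hypothesis LimZ : forall (c : R) (a : nat -> R), bounded_set (range a) ->
  Lim (fun k => c * a k) = c * Lim a.
Hypothesis Lim_ge0 : forall a : nat -> R, bounded_set (range a) ->
  (forall k, 0 <= a k) -> 0 <= Lim a.
Hypothesis Lim_cvg : forall (a : nat -> R) (l : R), a @ \oo --> l -> Lim a = l.
Variables (g f : T -> R) (u : nat -> T -> R).
Hypothesis ig : mu.-integrable setT (EFin \o g).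
Hypothesis mu_ : forall k, measurable_fun setT (u k).
Hypothesis ug : forall k x, `|u k x| <= g x.
Hypothesis if_ : mu.-integrable setT (EFin \o f).
Hypothesis ufE : forall A, measurable A ->
  Lim (fun k => \int[mu]_(x in A) u k x) = \int[mu]_(x in A) f x.

Let iu k : mu.-integrable setT (EFin \o u k).
Proof.
apply: le_integrable ig => //; first exact/measurable_EFinP.
by move=> x _; rewrite /= lee_fin (le_trans (ug k x))// ler_norm.
Qed.

Lemma integrable_bounded_mul (h phi : T -> R) (K : R) :
  mu.-integrable setT (EFin \o h) ->
  measurable_fun setT phi -> (forall x, `|phi x| <= K) ->
  mu.-integrable setT (EFin \o (fun x => h x * phi x)).
Proof.
move=> ih mphi phiK.
have bp : [bounded phi x | x in [set: T]].
  by exists K; split; [exact: num_real|move=> N KN x _ /=;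
    exact: le_trans (phiK x) (ltW KN)].
by apply: eq_integrable (integrableMl measurableT ih mphi bp).
Qed.

Lemma Rintegral_bounded_mul_le (h phi : T -> R) (K : R) :
  mu.-integrable setT (EFin \o h) ->
  measurable_fun setT phi -> (forall x, `|phi x| <= K) ->
  `|\int[mu]_x (h x * phi x)| <= K * \int[mu]_x `|h x|.
Proof.
move=> ih mphi phiK.
have ihp := integrable_bounded_mul ih mphi phiK.
have inh : mu.-integrable setT (EFin \o (fun x => `|h x|)).
  by apply: eq_integrable (integrable_abse ih).
apply: le_trans (le_normr_Rintegral measurableT ihp) _.
rewrite -RintegralZl//; apply: le_Rintegral => //.
- by apply: eq_integrable (integrable_abse ihp).
- by apply: eq_integrable (integrableZl measurableT K inh) => // x _; rewrite /= EFinM.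
- by move=> x _; rewrite normrM mulrC ler_wpM2r.
Qed.

Let P (phi : T -> R) := [/\ measurable_fun setT phi,
  (exists K : R, forall x, `|phi x| <= K) &
  Lim (fun k => \int[mu]_x (u k x * phi x)) = \int[mu]_x (f x * phi x)].

Let G := \int[mu]_x g x.

Let bu (phi : T -> R) (K : R) k : measurable_fun setT phi -> (forall x, `|phi x| <= K) ->
  `|\int[mu]_x (u k x * phi x)| <= K * G.
Proof.
move=> mphi phiK; apply: le_trans (Rintegral_bounded_mul_le (iu k) mphi phiK) _.
have K0 : 0 <= K by exact: le_trans (normr_ge0 _) (phiK point).
rewrite ler_wpM2l//; apply: le_Rintegral => //.
by apply: eq_integrable (integrable_abse (iu k)).
Qed.

Let bru (phi : T -> R) (K : R) : measurable_fun setT phi -> (forall x, `|phi x| <= K) ->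
  bounded_set (range (fun k => \int[mu]_x (u k x * phi x))).
Proof.
by move=> mphi phiK; apply: (@bounded_range _ _ (K * G)) => k; exact: bu.
Qed.

Let P_indic A : measurable A -> P (\1_A).
Proof.
move=> mA; split.
- exact: measurable_indic.
- by exists 1 => x; rewrite indicE; case: (x \in A); rewrite ?normr1 ?normr0.
- have E (h : T -> R) : \int[mu]_x (h x * \1_A x) = \int[mu]_(x in A) h x.
    rewrite [RHS]Rintegral_mkcond; apply: eq_Rintegral => x _.
    by rewrite patchE indicE; case: ifP => _; rewrite ?mulr1 ?mulr0.
  by rewrite E -ufE//; congr Lim; apply/funext => k; exact: E.
Qed.

Let P_lin (c : R) (phi psi : T -> R) : P phi -> P psi -> P (fun x => phi x + c * psi x).
Proof.
move=> [m1 [K1 b1] e1] [m2 [K2 b2] e2].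
have m3 : measurable_fun setT (fun x => c * psi x).
  by apply: measurable_funM.
have b3 x : `|c * psi x| <= `|c| * K2 by rewrite normrM ler_wpM2l.
have E (h : T -> R) : mu.-integrable setT (EFin \o h) ->
    \int[mu]_x (h x * (phi x + c * psi x)) =
    \int[mu]_x (h x * phi x) + c * \int[mu]_x (h x * psi x).
  move=> ih.
  have i1 := integrable_bounded_mul ih m1 b1.
  have i2 := integrable_bounded_mul ih m2 b2.
  have i3 : mu.-integrable setT (EFin \o (fun x => c * (h x * psi x))).
    by apply: eq_integrable (integrableZl measurableT c i2) => // x _;
      rewrite /= EFinM.
  rewrite -RintegralZl// -RintegralD//.
  by apply: eq_Rintegral => x _; lra.
split.
- exact: measurable_funD.
- exists (K1 + `|c| * K2) => x.
  by rewrite (le_trans (ler_normD _ _))// lerD.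
- rewrite E// -e1 -e2 -LimZ; last exact: bru.
  rewrite -LimD; [|exact: bru|].
    by congr Lim; apply/funext => k; rewrite E.
  apply: (@bounded_range _ _ (`|c| * (K2 * G))) => k.
  by rewrite normrM ler_wpM2l// bu.
Qed.

Let P_unif (phi : T -> R) (K : R) : measurable_fun setT phi -> (forall x, `|phi x| <= K) ->
  (forall e, 0 < e -> exists psi, P psi /\ forall x, `|phi x - psi x| <= e) ->
  P phi.
Proof.
move=> m1 b1 app; split=> //; first by exists K.
apply/eqP; rewrite -subr_eq0 -normr_le0; apply/ler_addgt0Pl => e e0.
rewrite addr0.
pose If := \int[mu]_x `|f x|.
have If0 : 0 <= If by apply: Rintegral_ge0.
have G0 : 0 <= G.
  by apply: Rintegral_ge0 => x _; exact: le_trans (ug 0 x).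
have D0 : 0 < G + If + 1 by rewrite ltr_wpDl// addr_ge0.
(* The uniform error is scaled so that its effect on both sides, at most its product with [G + If],
   stays below [e]. *)
have [psi [Ppsi pe]] := app (e / (G + If + 1)) (divr_gt0 e0 D0).
have [m2 [K2 b2] e2] := Ppsi.
have mD : measurable_fun setT (fun x => phi x - psi x) by exact: measurable_funB.
set D := e / _ in pe.
have E (h : T -> R) : mu.-integrable setT (EFin \o h) ->
    \int[mu]_x (h x * phi x) =
    \int[mu]_x (h x * (phi x - psi x)) + \int[mu]_x (h x * psi x).
  move=> ih; rewrite -RintegralD//.
  - by apply: eq_Rintegral => x _; lra.
  - exact: integrable_bounded_mul pe.
  - exact: integrable_bounded_mul b2.
have -> : (fun k => \int[mu]_x (u k x * phi x)) = (fun k =>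
    \int[mu]_x (u k x * (phi x - psi x)) + \int[mu]_x (u k x * psi x)).
  by apply/funext => k; rewrite E.
rewrite LimD; [|exact: (bru mD pe)|exact: (bru m2 b2)].
rewrite e2 E// opprD addrACA subrr addr0.
have h1 : `|Lim (fun k => \int[mu]_x (u k x * (phi x - psi x)))| <= D * G.
  have bb k := bu k mD pe.
  rewrite ler_norml; apply/andP; split.
    rewrite -[leLHS](Lim_cst Lim_cvg); apply: (@Lim_le _ _ LimD LimZ Lim_ge0 _ _ (D * G)) => // k.
      by rewrite normrN ger0_norm// (le_trans (normr_ge0 _) (bb 0)).
    by have := bb k; rewrite ler_norml => /andP[].
  rewrite -[leRHS](Lim_cst Lim_cvg); apply: (@Lim_le _ _ LimD LimZ Lim_ge0 _ _ (D * G)) => // k.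
    by rewrite ger0_norm// (le_trans (normr_ge0 _) (bb 0)).
  by have := bb k; rewrite ler_norml => /andP[].
have h2 := Rintegral_bounded_mul_le if_ mD pe.
apply: le_trans (ler_normB _ _) _; apply: le_trans (lerD h1 h2) _.
rewrite -mulrDr /D mulrAC ler_pdivrMr// ler_wpM2l ?(ltW e0)//.
by rewrite lerDl.
Qed.

(* [\sum_(j < N) (j.+1 <= t)%:R] is the integer part of [t], cut off at [N]. *)
Let floor_sum (N : nat) (t : R) : 0 <= t -> t <= N%:R ->
  let s := \sum_(j < N) (j.+1%:R <= t)%R%:R : R in s <= t /\ t - 1 <= s.
Proof.
move=> t0.
suff H : forall M : nat, (M%:R <= t ->
      \sum_(j < M) (j.+1%:R <= t)%R%:R = M%:R :> R) /\
    (t < M%:R -> let s := \sum_(j < M) (j.+1%:R <= t)%R%:R : R in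
      s <= t /\ t - 1 <= s).
  rewrite le_eqVlt => /predU1P[tN|/(H N).2//] /=.
  by rewrite (H N).1 ?tN//; split=> //; lra.
elim=> [|M [ih1 ih2]]; first by split; rewrite big_ord0//= ltNge t0.
rewrite big_ord_recr /=; split=> tM.
  rewrite ih1; first by rewrite tM natr1.
  by rewrite (le_trans _ tM)// ler_nat.
rewrite (leNgt M.+1%:R t) tM addr0; have [Mt|/ih2//] := leP M%:R t.
rewrite ih1//; split=> //; rewrite -natr1 in tM; lra.
Qed.

(** The functions for which the claim holds contain indicators, are stable under linear combinations
    and under uniform limits. A staircase of step [e] built from the superlevel sets of [phi + K]
    approximates [phi] within [e]. *)
Lemma dominated_weak_limit_pairing (phi : T -> R) (K : R) :
  measurable_fun setT phi -> (forall x, `|phi x| <= K) ->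
  Lim (fun k => \int[mu]_x (u k x * phi x)) = \int[mu]_x (f x * phi x).
Proof.
move=> mphi phiK; suff: P phi by case.
have K0 : 0 <= K by exact: le_trans (normr_ge0 _) (phiK point).
apply: (P_unif mphi phiK) => e e0.
(* Enough steps of height [e] to reach [2 * K], the largest possible value of [phi + K]. *)
pose N := Num.bound (2 * K / e).
have KN : 2 * K / e < N%:R by apply: archi_boundP; rewrite divr_ge0 ?mulr_ge0 ?(ltW e0).
pose A (j : nat) := [set x | j.+1%:R * e <= phi x + K].
have mA j : measurable (A j).
  rewrite -[A j]setTI; apply: measurable_fun_le => //.
  exact: measurable_funD.
pose psi M x := - K + e * \sum_(j < M) (\1_(A j) x : R).
have P_psi M : P (psi M).
  elim: M => [|M ih].
    have P0 := P_indic measurable0; have P1 := P_indic measurableT.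
    have := P_lin (- K) P0 P1; congr P; apply/funext => x.
    by rewrite /psi big_ord0 mulr0 addr0 indicE in_set0 add0r indicE in_setT mulr1.
  have := P_lin e ih (P_indic (mA M)); congr P; apply/funext => x.
  by rewrite /psi big_ord_recr/= mulrDr addrA.
exists (psi N); split=> // x.
have /andP[h1 h2] : - K <= phi x <= K by rewrite -ler_norml.
have [||/=] := @floor_sum N ((phi x + K) / e).
- by rewrite divr_ge0 ?(ltW e0)//; lra.
- by rewrite (le_trans _ (ltW KN))// ler_wpM2r ?invr_ge0 ?(ltW e0)//; lra.
rewrite -[_ - 1]/(_ - 1) /psi.
have -> : \sum_(j < N) (j.+1%:R <= (phi x + K) / e)%R%:R =
    \sum_(j < N) \1_(A j) x :> R.
  apply: eq_bigr => j _; rewrite indicE ler_pdivlMr//; congr (nat_of_bool _)%:R.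
  by apply/idP/idP; rewrite inE.
move: (\sum_(j < N) _) => s; rewrite ler_pdivlMr// => h3.
rewrite lerBlDr ler_pdivrMr// => h4.
by rewrite ler_norml; apply/andP; split; lra.
Qed.

End dominated_weak_limit_pairing.

(** * Test functions and difference quotients *)

Section test_function_basics.
Variables (R : realType) (n : nat).
Local Notation V := 'rV[R]_n.+1.
Local Notation lebRn := (lebRn R n).
Local Notation mu := (@lebesgue_measure_rV R n).
Local Notation e_ i := (delta_mx 0 i : V).

Lemma closed_cube (x : V) r : closed (cube x r).
Proof.
have -> : cube x r = (fun y : V => `|y - x|) @^-1` [set t | t <= r] by [].
apply: closed_comp => // y _; apply: continuous_comp; last exact: norm_continuous.
apply: (@continuousD _ _ _ id (cst (- x)) y); last exact: cst_continuous.
exact: cvg_id.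
Qed.

Lemma compact_cube (x : V) r : compact (cube x r).
Proof.
apply: bounded_closed_compact; last exact: closed_cube.
exists (r + `|x|); split; first exact: num_real.
move=> N rN y /= yr; rewrite (le_trans _ (ltW rN))//.
by rewrite -[y](subrK x) (le_trans (ler_normD _ _))// lerD2r.
Qed.

Lemma measurable_compact (K : set V) : compact K -> measurable (K : set lebRn).
Proof.
move=> cK; rewrite -[K]setCK; apply: measurableC; apply: open_measurable_lebRn.
by apply: closed_openC; apply: compact_closed => //; exact: norm_hausdorff.
Qed.

Lemma mu_compact_lty (K : set V) : compact K -> (mu K < +oo)%E.
Proof. by move=> /compact_bounded; exact: mu_bounded_lty. Qed.

Lemma compact_support_bounded (f : V -> R) (M : R) : continuous f ->
  (forall x : V, M < `|x| -> f x = 0) -> exists K, 0 <= K /\ forall x, `|f x| <= K.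
Proof.
move=> cf f0.
have : compact (f @` cube 0 M).
  apply: continuous_compact; last exact: compact_cube.
  exact: continuous_subspaceT.
move=> /compact_bounded[K [_ /(_ (Num.max 0 (K + 1)))]].
rewrite lt_max ltrDl ltr01 orbT => /(_ isT) H.
exists (Num.max 0 (K + 1)); rewrite le_max lexx; split=> // x.
have [xM|Mx] := leP `|x| M; last by rewrite f0// normr0 le_max lexx.
by apply: H; exists x => //; rewrite /cube/= subr0.
Qed.

Lemma test_function_support (phi : V -> R) : test_function phi ->
  exists M, 0 < M /\ forall x : V, M < `|x| -> phi x = 0.
Proof.
move=> [_ /compact_bounded[M [_ /(_ (Num.max 1 (M + 1)))]]].
rewrite lt_max ltrDl ltr01 orbT => /(_ isT) H.
exists (Num.max 1 (M + 1)); rewrite lt_max ltr01; split=> // x Mx.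
apply/eqP; apply: contraPT Mx => px; apply/negP; rewrite -leNgt; apply: H.
exact: subset_closure.
Qed.

Lemma partial_support (phi : V -> R) (M : R) i : (forall x : V, M < `|x| -> phi x = 0) ->
  forall x : V, M < `|x| -> partial i phi x = 0.
Proof.
move=> p0 x Mx; rewrite /partial (@near_eq_derive _ _ _ phi (cst 0)).
  by rewrite derive_cst.
have : \forall y \near x, M < `|y|.
  exact: (cvgr_gt _ (@norm_continuous _ V x)).
by apply: filterS => y /p0.
Qed.

Lemma test_function_continuous (phi : V -> R) : test_function phi -> continuous phi.
Proof. by move=> [/(_ 0%N)[]]. Qed.

Lemma partial_continuous (phi : V -> R) : test_function phi ->
  forall i, continuous (partial i phi).
Proof. by move=> [/(_ 1%N)[_ H] _] i; have [_ []] := H i. Qed.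

Lemma test_function_derivable (phi : V -> R) : test_function phi ->
  forall i x, derivable phi x (e_ i).
Proof. by move=> [/(_ 1%N)[_ H] _] i x; have [] := H i. Qed.

(** The mean value theorem on the line through x in direction [i]. *)
Lemma test_function_lip (phi : V -> R) i (K : R) : test_function phi ->
  (forall x, `|partial i phi x| <= K) ->
  forall x (h : R), `|phi (x + h *: e_ i) - phi x| <= K * `|h|.
Proof.
move=> tphi pK.
have dl (x : V) (t : R) : is_derive t 1 (fun s : R => phi (x + s *: e_ i))
    (partial i phi (x + t *: e_ i)).
  have dx := @test_function_derivable phi tphi i (x + t *: e_ i).
  have E : (fun h : R => h^-1 *: (((fun s : R => phi (x + s *: e_ i)) \o shift t)
      (h *: (1 : R)) - phi (x + t *: e_ i))) =
    (fun h : R => h^-1 *: ((phi \o shift (x + t *: e_ i)) (h *: e_ i) -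
      phi (x + t *: e_ i))).
    apply/funext => h /=; congr (_ *: (phi _ - _)).
    by rewrite [h *: 1]mulr1 scalerDl addrCA.
  by split; [rewrite /derivable E|rewrite /partial /derive E].
have H (x : V) (h : R) : 0 < h -> `|phi (x + h *: e_ i) - phi x| <= K * `|h|.
  move=> h0; have [|c _] := @MVT R (fun s : R => phi (x + s *: e_ i))
      (fun t => partial i phi (x + t *: e_ i)) 0 h h0 (fun t _ => dl x t).
    by apply: continuous_subspaceT => t; exact: is_derive1_continuous (dl x t).
  by rewrite scale0r addr0 subr0 => ->; rewrite normrM ler_wpM2r.
move=> x h; have [h0|h0|<-] := ltgtP 0 h; first exact: H.
  have := H (x + h *: e_ i) (- h); rewrite oppr_gt0 => /(_ h0).
  by rewrite -addrA -scalerDl subrr scale0r addr0 normrN distrC.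
by rewrite scale0r addr0 subrr !normr0 mulr0.
Qed.

Lemma partial_quot_cvg (phi : V -> R) i x (h : nat -> R) : test_function phi ->
  (forall k, h k != 0) -> h @ \oo --> (0 : R) ->
  (fun k => (h k)^-1 * (phi (x + h k *: e_ i) - phi x)) @ \oo --> partial i phi x.
Proof.
move=> tphi h0 hl; have /cvg_ex[l lP] := @test_function_derivable phi tphi i x.
have -> : partial i phi x = l by exact: cvg_lim lP.
have hd : h @ \oo --> (0 : R)^'.
  move=> A [e /= e0 eA]; have [N _ NP] := hl _ (nbhsx_ballx (0 : R) e e0).
  by exists N => // k /NP /eA; apply; exact: h0.
have -> : (fun k => (h k)^-1 * (phi (x + h k *: e_ i) - phi x)) =
    (fun t : R => t^-1 *: ((phi \o shift x) (t *: e_ i) - phi x)) \o h.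
  by apply/funext => k /=; rewrite [x + _]addrC.
exact: (cvg_comp _ _ hd lP).
Qed.

Lemma continuous_loc_integrable (F : V -> R) : continuous F -> loc_integrable F.
Proof.
move=> cF; split; first exact: continuous_measurable_lebRn.
move=> K cK; apply: measurable_bounded_integrable.
- exact: measurable_compact.
- exact: mu_compact_lty.
- by apply: measurable_funTS; exact: continuous_measurable_lebRn.
- have : compact (F @` K) by apply: continuous_compact cK; exact: continuous_subspaceT.
  move=> /compact_bounded[M [Mr MP]]; exists M; split=> // N MN x Kx.
  by apply: (MP N MN); exists x.
Qed.

Lemma loc_integrable_mul (F b : V -> R) (M K : R) : loc_integrable F ->
  measurable_fun setT (b : lebRn -> R) -> (forall x, `|b x| <= K) ->
  (forall x : V, M < `|x| -> b x = 0) ->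
  mu.-integrable setT (EFin \o (fun x => F x * b x) : lebRn -> \bar R).
Proof.
move=> [mF iF] mb bK b0.
have mc : measurable (cube 0 M : set lebRn) by exact: cube_measurable.
have iFc := iF _ (@compact_cube 0 M).
have ir : mu.-integrable setT (EFin \o (F \_ (cube 0 M)) : lebRn -> \bar R).
  by rewrite -restrict_EFin; have := iFc; rewrite (integrable_mkcond _ mc).
apply: eq_integrable (integrable_bounded_mul ir mb bK) => //.
move=> x _ /=; rewrite patchE; case: ifPn => // /negP; rewrite inE /cube/= subr0.
by move=> /negP; rewrite -ltNge => /b0 ->; rewrite !mulr0.
Qed.

Lemma Rintegral_shift (h : V) (f : V -> R) :
  measurable_fun setT (f : lebRn -> R) ->
  \int[mu]_x f (x + h) = \int[mu]_x f x.
Proof.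
move=> mf; rewrite /Rintegral; congr fine.
by apply: (integral_shift h (f := EFin \o f)); exact/measurable_EFinP.
Qed.

Lemma integrable_shift (h : V) (f : V -> R) :
  mu.-integrable setT (EFin \o f : lebRn -> \bar R) ->
  mu.-integrable setT (EFin \o (fun x => f (x + h)) : lebRn -> \bar R).
Proof.
move=> /integrableP[mf fi]; apply/integrableP; split.
  exact: (measurable_fun_shift h mf).
have mnf : measurable_fun setT ((fun x => `|(f x)%:E|%E) : lebRn -> \bar R).
  exact: measurableT_comp.
by rewrite [ltLHS](integral_shift h mnf).
Qed.

(** Discrete integration by parts: translation invariance moves the difference quotient from F to
    [phi] with the opposite increment, and dominated convergence turns it into minus the partial
    derivative of [phi]. *)
Lemma integral_partial_quot (F phi : V -> R) i (h : nat -> R) :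
  loc_integrable F -> test_function phi ->
  (forall k, h k != 0) -> (forall k, `|h k| <= 1) -> h @ \oo --> (0 : R) ->
  (fun k => \int[mu]_x ((h k)^-1 * (F (x + h k *: e_ i) - F x) * phi x)) @ \oo
    --> - \int[mu]_x (F x * partial i phi x).
Proof.
move=> lF tphi h0 h1 hl.
have [M [M0 pM]] := test_function_support tphi.
have cphi := test_function_continuous tphi.
have cpart := @partial_continuous phi tphi i.
have [K1 [K10 pK1]] := compact_support_bounded cphi pM.
have pMp := partial_support i pM.
have [K2 [K20 pK2]] := compact_support_bounded cpart pMp.
have mF := lF.1.
have mphi := continuous_measurable_lebRn cphi.
have mpart := continuous_measurable_lebRn cpart.
pose q k (x : V) := (h k)^-1 * (phi (x - h k *: e_ i) - phi x).
have msh (a : V) (f : V -> R) : measurable_fun setT (f : lebRn -> R) ->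
    measurable_fun setT ((fun x => f (x + a)) : lebRn -> R).
  by move=> mf; exact: (measurableT_comp mf (measurable_shift a)).
have e1 : `|e_ i| <= 1 :> R.
  by apply/rV_norm_le => // j; rewrite mxE eqxx /=; case: (j == i);
    rewrite ?normr1 ?normr0.
have mq k : measurable_fun setT (q k : lebRn -> R).
  have m1 := msh (- (h k *: e_ i)) phi mphi.
  exact: (measurable_funM (measurable_cst _) (measurable_funB m1 mphi)).
have qK k x : `|q k x| <= K2.
  rewrite normrM normfV ler_pdivrMl ?normr_gt0// mulrC.
  have := test_function_lip tphi pK2 x (- h k).
  by rewrite scaleNr normrN.
have qM k x : M + 1 < `|x| -> q k x = 0.
  move=> Mx; rewrite /q !pM ?subrr ?mulr0//; first by rewrite (lt_trans _ Mx)// ltrDl.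
  have : `|h k *: e_ i| <= 1.
    by rewrite normrZ; apply: mulr_ile1.
  by have := ler_normD (x - h k *: e_ i) (h k *: e_ i); rewrite subrK => a b; lra.
have qE k : \int[mu]_x ((h k)^-1 * (F (x + h k *: e_ i) - F x) * phi x) =
    \int[mu]_x (F x * q k x).
  have i1 := loc_integrable_mul lF mphi pK1 pM.
  have mps : measurable_fun setT ((fun x => phi (x - h k *: e_ i)) : lebRn -> R).
    exact: msh.
  have i2 : mu.-integrable setT
      (EFin \o (fun x => F x * phi (x - h k *: e_ i)) : lebRn -> \bar R).
    apply: (loc_integrable_mul (M := M + 1)) lF mps (fun x => pK1 _) _ => x Mx.
    apply: pM; have : `|h k *: e_ i| <= 1 by rewrite normrZ; apply: mulr_ile1.
    by have := ler_normD (x - h k *: e_ i) (h k *: e_ i); rewrite subrK => a b; lra.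
  have i3 : mu.-integrable setT
      (EFin \o (fun x => F (x + h k *: e_ i) * phi x) : lebRn -> \bar R).
    have := integrable_shift (h k *: e_ i) i2.
    by apply: eq_integrable => // x _; rewrite /= addrK.
  have -> : \int[mu]_x ((h k)^-1 * (F (x + h k *: e_ i) - F x) * phi x) =
      (h k)^-1 * (\int[mu]_x (F (x + h k *: e_ i) * phi x) -
                  \int[mu]_x (F x * phi x)).
    rewrite -RintegralB// -RintegralZl//; last first.
      by apply: eq_integrable (integrableB measurableT i3 i1).
    by apply: eq_Rintegral => x _; lra.
  have -> : \int[mu]_x (F x * q k x) = (h k)^-1 *
      (\int[mu]_x (F x * phi (x - h k *: e_ i)) - \int[mu]_x (F x * phi x)).
    rewrite -RintegralB// -RintegralZl//; last first.
      by apply: eq_integrable (integrableB measurableT i2 i1).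
    by apply: eq_Rintegral => x _; rewrite /q; lra.
  congr (_ * (_ - _)).
  rewrite -(@Rintegral_shift (h k *: e_ i) (fun x => F x * phi (x - h k *: e_ i))).
    by apply: eq_Rintegral => x _; rewrite addrK.
  exact: measurable_funM.
under eq_fun do rewrite qE.
(* The majorant: the quotients of [phi] are bounded by the Lipschitz constant [K2] and, since the
   increments are at most 1, vanish outside the cube of radius [M + 1]. *)
pose b (x : V) : R := K2 * (\1_(cube 0 (M + 1)) x : R).
have ib : mu.-integrable setT (EFin \o (fun x => F x * b x) : lebRn -> \bar R).
  have mc : measurable (cube 0 (M + 1) : set lebRn) by exact: cube_measurable.
  have mb : measurable_fun setT (b : lebRn -> R).
    exact: (measurable_funM (measurable_cst K2) (measurable_indic mc)).
  apply: (@loc_integrable_mul F b (M + 1) K2 lF mb).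
  - move=> x; rewrite /b indicE; case: (_ \in _); rewrite ?mulr1 ?mulr0 ?normr0//.
    by rewrite ger0_norm.
  - move=> x Mx; rewrite /b indicE memNset ?mulr0//.
    by rewrite /cube/= subr0; apply/negP; rewrite -ltNge.
have mNp : measurable_fun setT ((fun x => - partial i phi x) : lebRn -> R).
  exact: (measurableT_comp (@oppr_measurable R setT) mpart).
have NpK x : `|- partial i phi x| <= K2 by rewrite normrN.
have NpM (x : V) : M < `|x| -> - partial i phi x = 0.
  by move=> Mx; rewrite pMp ?oppr0.
have iNp := loc_integrable_mul lF mNp NpK NpM.
have -> : - (\int[mu]_x (F x * partial i phi x)) =
    \int[mu]_x (F x * - partial i phi x).
  rewrite -mulN1r -RintegralZl//; last exact: (loc_integrable_mul lF mpart pK2 pMp).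
  by apply: eq_Rintegral => x _; lra.
rewrite /Rintegral; apply: fine_cvg.
rewrite fineK; last exact: integrable_fin_num iNp.
apply: (@dominated_cvg _ lebRn R mu setT measurableT _ _ (fun x => `|(F x * b x)%:E|%E)).
- by move=> k; apply/measurable_EFinP; exact: (measurable_funM mF (mq k)).
- move=> x _; apply: cvg_EFin; first by near=> k.
  apply: cvgMr.
  have : (fun k => (- h k)^-1 * (phi (x + (- h k) *: e_ i) - phi x)) @ \oo -->
      partial i phi x.
    apply: partial_quot_cvg tphi _ _; first by move=> k; rewrite oppr_eq0.
    by rewrite -oppr0; exact: cvgN.
  move=> /cvgN H; rewrite (_ : q ^~ x = - (fun k =>
    (- h k)^-1 * (phi (x + (- h k) *: e_ i) - phi x)))//.
  by apply/funext => k; rewrite /q opprfctE invrN mulNr opprK scaleNr.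
- by [].
- exact: integrable_abse ib.
- move=> k x _ /=; rewrite lee_fin normrM [leRHS]normrM ler_wpM2l// /b.
  have [xM|Mx] := leP `|x : V| (M + 1); last by rewrite qM// normr0.
  rewrite indicE mem_set ?mulr1; last by rewrite /cube/= subr0.
  by rewrite (ger0_norm K20).
Unshelve. all: by end_near. Qed.

End test_function_basics.

(** * From domination of integrals to pointwise domination *)

Section domination_from_integrals.
Context d (T : measurableType d) (R : realType) (mu : {measure set T -> \bar R}).

(** On the set where [g < f], the difference [f - g] is positive with integral at most 0. *)
Lemma integral_le_negligible (f g : T -> R) :
  mu.-integrable setT (EFin \o f) -> mu.-integrable setT (EFin \o g) ->
  (forall A, measurable A -> \int[mu]_(x in A) f x <= \int[mu]_(x in A) g x) ->
  measurable [set x | g x < f x] /\ mu [set x | g x < f x] = 0%E.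
Proof.
move=> if_ ig H; set A := [set x | g x < f x].
have mf : measurable_fun setT f by case/integrableP : (if_) => /measurable_EFinP.
have mg : measurable_fun setT g by case/integrableP : (ig) => /measurable_EFinP.
have mA : measurable A.
  have := measurable_fun_ltr mg mf; rewrite /A.
  move=> /(_ measurableT [set true] _); rewrite setTI; exact.
split=> //.
have ifA := integrableS measurableT mA (@subsetT _ A) if_.
have igA := integrableS measurableT mA (@subsetT _ A) ig.
pose D (x : T) : R := f x - g x.
have iB : mu.-integrable A (EFin \o D).
  by apply: eq_integrable (integrableB mA ifA igA).
have mB : measurable_fun A (EFin \o D) by case/integrableP : iB.
have : (\int[mu]_(x in A) `|(EFin \o D) x|)%E = 0%E.
  rewrite (eq_integral (EFin \o D)); last first.
    by move=> x; rewrite inE => Ax; rewrite /= ger0_norm// subr_ge0 ltW.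
  apply/eqP; rewrite eq_le; apply/andP; split; last first.
    by apply: integral_ge0 => x Ax; rewrite lee_fin subr_ge0 ltW.
  rewrite -[leLHS]fineK; last exact: integrable_fin_num.
  rewrite lee_fin; have := RintegralB mA ifA igA; rewrite /Rintegral => ->.
  by rewrite subr_le0; exact: H.
move=> /(ae_eq_integral_abs mu mA mB)[N [mN N0 sN]].
apply/eqP; rewrite eq_le measure_ge0 andbT -N0; apply: le_measure => //; rewrite ?inE//.
move=> x Ax; apply: sN => /(_ Ax) /= [] /eqP; rewrite subr_eq0 => /eqP fg.
by move: Ax; rewrite /A/= fg ltxx.
Qed.

(** Setting f to 0 on the two exceptional null sets gives a representative bounded by [g] at every
    point. *)
Lemma integral_abs_le_clamp (f g : T -> R) : (forall x, 0 <= g x) ->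
  mu.-integrable setT (EFin \o f) -> mu.-integrable setT (EFin \o g) ->
  (forall A, measurable A -> `|\int[mu]_(x in A) f x| <= \int[mu]_(x in A) g x) ->
  exists f' : T -> R, [/\ mu.-integrable setT (EFin \o f'),
    (forall x, `|f' x| <= g x) & {ae mu, forall x, f x = f' x}].
Proof.
move=> g0 if_ ig H.
have iN : mu.-integrable setT (EFin \o (fun x => - f x)).
  by apply: eq_integrable (integrableN if_).
have [|mA A0] := integral_le_negligible if_ ig.
  by move=> A mA; have := H A mA; rewrite ler_norml => /andP[].
have [|mB B0] := integral_le_negligible iN ig.
  move=> E mE; have := H E mE; rewrite ler_norml => /andP[+ _].
  have ifE := integrableS measurableT mE (@subsetT _ E) if_.
  have -> : \int[mu]_(x in E) (- f x) = - (\int[mu]_(x in E) f x).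
    rewrite -mulN1r -RintegralZl//; apply: eq_Rintegral => x _.
    by rewrite mulN1r.
  lra.
set A := [set x | g x < f x] in mA A0.
set B := [set x | g x < - f x] in mB B0.
have mC : measurable (~` (A `|` B)) by apply: measurableC; exact: measurableU.
exists (f \_ (~` (A `|` B))); split.
- rewrite -restrict_EFin.
  have ifC := integrableS measurableT mC (@subsetT _ _) if_.
  by have := ifC; rewrite (integrable_mkcond _ mC).
- move=> x; rewrite patchE; case: ifPn => [|_]; last by rewrite normr0.
  rewrite inE => /not_orP[/= /negP fA /negP fB].
  by rewrite ler_norml -leNgt in fA *; rewrite fA andbT lerNl leNgt.
- exists (A `|` B); split.
  + exact: measurableU.
  + apply/eqP; rewrite eq_le measure_ge0 andbT -[leRHS]adde0 -{1}A0 -B0.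
    exact: measureU2.
  + move=> x /= nx; apply: contrapT => nAB; apply: nx.
    by rewrite patchE mem_set.
Qed.

End domination_from_integrals.

(** * An integrable weight *)

Section weight.
Variables (R : realType) (n : nat).
Local Notation V := 'rV[R]_n.+1.
Local Notation lebRn := (lebRn R n).
Local Notation mu := (@lebesgue_measure_rV R n).

(** A function of L_p need not be integrable on the whole space, but its product with [w] is. Since
    [w] is bounded below on bounded sets, a test function can be divided by it. *)
Lemma exists_weight : exists w : V -> R, [/\
  mu.-integrable setT (EFin \o w : lebRn -> \bar R),
  (forall x, 0 < w x <= 1) &
  forall M : R, exists c, 0 < c /\ forall x, `|x| <= M -> c <= w x].
Proof.
(* 2^-(k+1) divided by the volume of the cube of radius k+1: each summand of the weight has integral
   2^-(k+1). As that volume is at least 1, the sum is also bounded by 1. *)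
pose a (k : nat) : R := (2 ^ k.+1)%:R^-1 / (2 * k.+1%:R) ^+ n.+1.
have a0 k : 0 < a k by rewrite divr_gt0 ?invr_gt0 ?exprn_gt0 ?mulr_gt0 ?ltr0n ?expn_gt0.
have a1 k : a k <= (2 ^ k.+1)%:R^-1.
  rewrite /a ler_pdivrMr; last by rewrite exprn_gt0// mulr_gt0// ltr0n.
  rewrite ler_pMr ?invr_gt0 ?ltr0n ?expn_gt0//.
  by rewrite exprn_ege1// -natrM ler1n muln_gt0.
pose W (x : V) : \bar R := (\sum_(k <oo) (a k * (\1_(cube 0 k.+1%:R) x : R))%:E)%E.
have t0 (x : V) k : (0 <= (a k * (\1_(cube 0 k.+1%:R) x : R))%:E)%E.
  by rewrite lee_fin mulr_ge0// ltW.
have half : (\sum_(k <oo) ((2 ^ k.+1)%:R^-1 : R)%:E <= 1)%E.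
  have := @epsilon_trick R (fun=> 0%E) 1 xpredT (fun=> lexx _) ler01.
  rewrite [X in (_ <= X + _)%E -> _]eseries0// add0e; apply: le_trans.
  by apply: lee_nneseries => [k _ _|k _]; rewrite ?add0e ?mul1r ?lee_fin.
have W1 (x : V) : (W x <= 1)%E.
  apply: le_trans half; apply: lee_nneseries => // k _.
  rewrite lee_fin (le_trans _ (a1 k))// ler_piMr ?(ltW (a0 k))//.
have W0 (x : V) : (0 <= W x)%E by exact: nneseries_ge0.
have Wge (x : V) k : `|x| <= k.+1%:R -> (((a k)%:E) <= W x)%E.
  move=> xk; apply: le_trans (nneseries_lim_ge k.+1 _) => //.
  rewrite big_nat_recr//= indicE mem_set; last by rewrite /cube/= subr0.
  by rewrite mulr1 leeDr// sume_ge0.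
have Wfin x : W x \is a fin_num.
  by rewrite ge0_fin_numE// (le_lt_trans (W1 x))// ltry.
have mc k : measurable (cube 0 k.+1%:R : set lebRn) by exact: cube_measurable.
have mt k : measurable_fun setT
    ((fun x => (a k * (\1_(cube 0 k.+1%:R) x : R))%:E) : lebRn -> \bar R).
  apply/measurable_EFinP.
  exact: (measurable_funM (measurable_cst (a k)) (measurable_indic (mc k))).
have mW : measurable_fun setT (W : lebRn -> \bar R).
  by apply: ge0_emeasurable_sum => // k _; exact: mt.
exists (fine \o W); split.
- apply: (@eq_integrable _ lebRn R mu setT measurableT W).
    by move=> x _ /=; rewrite fineK.
  apply/integrableP; split=> //.
  rewrite (eq_integral (W : lebRn -> \bar R)); last by move=> x _; rewrite gee0_abs.
  rewrite integral_nneseries//.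
  apply: le_lt_trans (ltry 1); apply: le_trans half.
  apply: lee_nneseries => [k _ _|k _]; first exact: integral_ge0.
  under eq_integral do rewrite EFinM.
  rewrite ge0_integralZl//.
  + rewrite integral_indic// setIT [X in (_ * X)%E]mu_cube// -EFinM lee_fin.
    by rewrite /a divfK// expf_neq0// mulf_neq0// pnatr_eq0.
  + by apply/measurable_EFinP; exact: measurable_indic.
  + by rewrite lee_fin ltW.
- move=> x; rewrite -!lee_fin -lte_fin /= fineK// W1 andbT.
  apply: lt_le_trans (Wge x (Num.bound `|x|) _); first by rewrite lte_fin.
  by rewrite (le_trans (ltW (archi_boundP (normr_ge0 x))))// ler_nat.
- move=> M; exists (a (Num.bound M)); split=> // x xM.
  rewrite -lee_fin /= fineK//; apply: Wge; apply: (le_trans xM).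
  have M0 : 0 <= M by exact: le_trans xM.
  by rewrite (le_trans (ltW (archi_boundP M0)))// ler_nat.
Qed.

End weight.

Lemma lee_poweR (R : realType) (x y : \bar R) (r : R) :
  0 <= r -> (0 <= x)%E -> (x <= y)%E -> (x `^ r <= y `^ r)%E.
Proof.
move=> r0 x0 xy; apply: gt0_ler_poweR => //; rewrite in_itv/= leey andbT//.
exact: le_trans xy.
Qed.

Lemma continuous_dist (R : realType) (n : nat) (F : 'rV[R]_n.+1 -> R) :
  (forall y e, 0 < e -> exists d : R, 0 < d /\
    forall z, `|z - y| <= d -> `|F y - F z| < e) -> continuous F.
Proof.
move=> H y A /nbhs_ballP[e /= e0 eA]; have [d [d0 dP]] := H y e e0.
apply/nbhs_ballP; exists d => //= z; rewrite mx_norm_ball /ball_/= => yz.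
by apply: eA; rewrite /ball/=; apply: dP; rewrite distrC ltW.
Qed.

(** * Hoelder continuity from a dominated oscillation *)

Section local_domination.
Variables (R : realType) (n : nat).
Local Notation V := 'rV[R]_n.+1.
Local Notation lebRn := (lebRn R n).
Local Notation mu := (@lebesgue_measure_rV R n).

(** A bound of the sharp maximal function restricted to radii up to [r0]. The restriction serves
    part (ii), where the dominating function vanishes away from S. *)
Definition locally_dominated (F : V -> R) (g : V -> \bar R) (r0 : R) :=
  forall (x y z : V) (r : R), 0 < r -> r <= r0 ->
    `|y - x| <= r -> `|z - x| <= r -> (`|F y - F z|%:E <= r%:E * g x)%E.

Variables (F : V -> R) (g : V -> \bar R) (r0 p : R).
Hypothesis Fg : locally_dominated F g r0.
Hypothesis r00 : 0 < r0.
Hypothesis mg : measurable_fun setT (g : lebRn -> \bar R).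
Hypothesis g0 : forall x, (0 <= g x)%E.
Hypothesis hp : n.+1%:R < p.
Hypothesis gp : (\int[mu]_x (g x `^ p) < +oo)%E.

Let p0 : 0 < p. Proof. by rewrite (le_lt_trans _ hp). Qed.

Let mgp : measurable_fun setT ((fun x => g x `^ p)%E : lebRn -> \bar R).
Proof. by exact: (measurableT_comp (measurable_poweR p) mg). Qed.

Let a := fine (\int[mu]_x (g x `^ p))%E.

Let aE : (\int[mu]_x (g x `^ p))%E = a%:E.
Proof.
rewrite fineK// ge0_fin_numE//; apply: integral_ge0 => x _; exact: poweR_ge0.
Qed.

Let a0 : 0 <= a.
Proof. by rewrite -lee_fin -aE; apply: integral_ge0 => x _; exact: poweR_ge0. Qed.

(** Every x in Q(y, t/2) has both y and z within t, so the oscillation is at most [t * g x]. Raising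
    to the power p and integrating over this cube, of volume t^(n+1), gives Hoelder continuity of
    exponent 1 - (n+1)/p. *)
Lemma locally_dominated_holder (y z : V) (t : R) : 0 < t -> t <= r0 ->
  `|z - y| <= t / 2 -> `|F y - F z| `^ p <= a * t `^ (p - n.+1%:R).
Proof.
move=> t0 tr0 zy; pose c : R := `|F y - F z|; rewrite -/c.
have t20 : 0 <= t / 2 by rewrite divr_ge0// ltW.
have mc : measurable (cube y (t / 2) : set lebRn) by exact: cube_measurable.
have H : ((c `^ p * t ^+ n.+1)%:E <= (t `^ p * a)%:E)%E.
  have -> : t ^+ n.+1 = (2 * (t / 2)) ^+ n.+1 by congr (_ ^+ _); lra.
  rewrite EFinM -(mu_cube y t20) -integral_cst// EFinM -aE.
  rewrite -(@ge0_integralZl _ lebRn R mu setT measurableT _ mgp (t `^ p)%:E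
    (fun x _ => poweR_ge0 _ _)); last by rewrite lee_fin powR_ge0.
  apply: (@le_trans _ _ (\int[mu]_(x in cube y (t / 2)) ((t `^ p)%:E * g x `^ p))%E).
    apply: (@ge0_le_integral _ lebRn R mu _ mc).
    + by move=> x _; rewrite lee_fin powR_ge0.
    + exact: measurable_cst.
    + by apply: measurable_funTS; exact: measurable_funeM.
    + move=> x; rewrite /cube/= => xy.
      have : (c%:E <= t%:E * g x)%E.
        apply: Fg => //; first by rewrite distrC (le_trans xy)//; lra.
        rewrite -(subrKA y) (le_trans (ler_normD _ _))// [X in _ + X]distrC.
        lra.
      move=> cg; rewrite -!poweR_EFin -poweRM//; last by rewrite lee_fin ltW.
      by apply: lee_poweR; rewrite ?lee_fin ?normr_ge0 ?(ltW p0).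
  apply: (@ge0_subset_integral _ lebRn R mu _ _ mc measurableT _
    (measurable_funeM _ mgp) _ (@subsetT _ _)).
  by move=> x _; rewrite mule_ge0 ?lee_fin ?powR_ge0 ?poweR_ge0.
move: H; rewrite lee_fin.
have -> : t `^ p = t `^ (p - n.+1%:R) * t ^+ n.+1.
  rewrite -(powR_mulrn _ (ltW t0)) -powRD ?subrK//.
  by rewrite (gt_eqF t0) implybT.
rewrite mulrAC [t `^ _ * a]mulrC ler_pM2r//; exact: exprn_gt0.
Qed.

Lemma locally_dominated_continuous : continuous F.
Proof.
apply: continuous_dist => y e e0.
have pn : 0 < p - n.+1%:R by rewrite subr_gt0.
(* This makes [a * b] smaller than the p-th power of [e]; the scale [t] is then chosen with its
   power [p - n.+1%:R] at most [b]. *)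
pose b := e `^ p / (a + 1).
have b0 : 0 < b by rewrite divr_gt0 ?powR_gt0// ltr_wpDl.
pose t := Num.min r0 (b `^ (p - n.+1%:R)^-1).
have t0 : 0 < t by rewrite lt_min r00 powR_gt0.
have tr0 : t <= r0 by rewrite /t ge_min lexx.
have tb : t `^ (p - n.+1%:R) <= b.
  have -> : b = (b `^ (p - n.+1%:R)^-1) `^ (p - n.+1%:R).
    by rewrite -powRrM mulVf ?gt_eqF// powRr1// ltW.
  apply: ge0_ler_powR; rewrite ?(ltW pn)// ?nnegrE ?powR_ge0 ?(ltW t0)//.
  by rewrite /t ge_min lexx orbT.
exists (t / 2); split; first by rewrite divr_gt0.
move=> z zt.
have H := locally_dominated_holder t0 tr0 zt.
rewrite ltNge; apply/negP => eF.
have : e `^ p <= a * b.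
  apply: le_trans (le_trans _ H) _; last by rewrite ler_wpM2l.
  by apply: ge0_ler_powR; rewrite ?nnegrE ?(ltW p0) ?(ltW e0).
have <- : b * (a + 1) = e `^ p by rewrite /b divfK// gt_eqF// ltr_wpDl.
lra.
Qed.

End local_domination.

(** * Weak partial derivatives as limits of difference quotients *)

Section weak_gradient_existence.
Variables (R : realType) (n : nat).
Local Notation V := 'rV[R]_n.+1.
Local Notation lebRn := (lebRn R n).
Local Notation mu := (@lebesgue_measure_rV R n).
Local Notation e_ i := (delta_mx 0 i : V).

Variables (F : V -> R) (g : V -> \bar R) (r0 p : R).
Hypothesis Fg : locally_dominated F g r0.
Hypothesis r00 : 0 < r0.
Hypothesis mg : measurable_fun setT (g : lebRn -> \bar R).
Hypothesis g0 : forall x, (0 <= g x)%E.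
Hypothesis hp : n.+1%:R < p.
Hypothesis gp : (\int[mu]_x (g x `^ p) < +oo)%E.

Let p1 : 1 <= p. Proof. by rewrite (le_trans _ (ltW hp))// ler1n. Qed.

Let mgp : measurable_fun setT ((fun x => g x `^ p)%E : lebRn -> \bar R).
Proof. exact: (measurableT_comp (measurable_poweR p) mg). Qed.

Let igp : mu.-integrable setT ((fun x => g x `^ p)%E : lebRn -> \bar R).
Proof.
apply/integrableP; split; first exact: mgp.
rewrite (eq_integral ((fun x => g x `^ p)%E : lebRn -> \bar R)); first exact: gp.
by move=> x _; rewrite gee0_abs// poweR_ge0.
Qed.

Let G x : R := fine (g x).

Let G0 x : 0 <= G x. Proof. exact: fine_ge0. Qed.

Let mG : measurable_fun setT (G : lebRn -> R).
Proof. exact: (measurableT_comp (fine_measurable measurableT) mg). Qed.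

(** An integrable majorant on bounded sets, by comparison of [g] with 1. The finite part [G] is 0
    where [g] is infinite. *)
Let G_le (x : V) : (((G x)%:E) <= 1 + g x `^ p)%E.
Proof.
rewrite /G; move: (g0 x); case: (g x) => [r| |]//; last first.
  by rewrite poweRyr ?gt_eqF ?(lt_le_trans ltr01)// addey// leey.
rewrite poweR_EFin -EFinD !lee_fin /= => rge0.
have [r1|r1] := leP r 1; first by rewrite ler_wpDr// powR_ge0.
rewrite ler_wpDl//; apply: le_trans (ler_powR (ltW r1) p1).
by rewrite powRr1.
Qed.

Let mN : measurable ([set x | g x = +oo%E] : set lebRn).
Proof.
have := mg measurableT (@emeasurable_set1 R +oo%E).
by rewrite setTI; congr (measurable _).
Qed.

Let N0 : mu [set x | g x = +oo%E] = 0%E.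
Proof.
have [A [mA A0 sA]] := integrable_ae measurableT igp.
apply/eqP; rewrite eq_le measure_ge0 andbT -A0.
apply: le_measure; rewrite ?inE//.
move=> x gx; apply: sA => /(_ I); rewrite gx poweRyr//.
by rewrite gt_eqF// (lt_le_trans ltr01).
Qed.

Lemma integrable_locally_dominated_compact (f : V -> R) :
  measurable_fun setT (f : lebRn -> R) -> (forall x, `|f x| <= G x) ->
  loc_integrable f.
Proof.
move=> mf fG; split=> // K cK.
have mK := measurable_compact cK.
have i1 : mu.-integrable K (EFin \o cst 1 : lebRn -> \bar R).
  apply: measurable_bounded_integrable => //; first exact: mu_compact_lty.
  by exists 1; split; [exact: num_real|move=> N N1 x _; rewrite /= normr1 ltW].
have i2 := integrableS measurableT mK (@subsetT _ K) igp.
apply: (@le_integrable _ lebRn R mu K mK _ (fun x => 1 + g x `^ p)%E).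
- by apply/measurable_EFinP; exact: measurable_funTS.
- move=> x _ /=; rewrite [leRHS]gee0_abs; last by rewrite adde_ge0// poweR_ge0.
  by apply: le_trans (G_le x); rewrite lee_fin.
- exact: (integrableD mK i1 i2).
Qed.

Let cF : continuous F.
Proof. exact: locally_dominated_continuous Fg r00 mg g0 hp gp. Qed.

(** Increments at most [r0], where the domination holds, and at most 1, as [integral_partial_quot]
    asks. *)
Let h (k : nat) : R := Num.min 1 r0 / k.+1%:R.

Let h_gt0 k : 0 < h k.
Proof. by rewrite divr_gt0// lt_min ltr01. Qed.

Let h_le k : h k <= 1 /\ h k <= r0.
Proof.
have : h k <= Num.min 1 r0.
  rewrite ler_pdivrMr// ler_peMr ?ler1n//.
  by rewrite le_min ler01 ltW.
by rewrite le_min => /andP[].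
Qed.

Let h_cvg : h @ \oo --> (0 : R).
Proof.
rewrite /h -(mulr0 (Num.min 1 r0)); apply: cvgMr.
exact: cvg_harmonic.
Qed.

Let quot i k (x : V) : R := (h k)^-1 * (F (x + h k *: e_ i) - F x).

Let norm_delta i : `|e_ i| = 1 :> R.
Proof.
apply/eqP; rewrite eq_le; apply/andP; split.
  by apply/rV_norm_le => // j; rewrite mxE eqxx /=; case: (j == i);
    rewrite ?normr1 ?normr0.
by have := coord_le_norm (e_ i) i; rewrite mxE !eqxx normr1.
Qed.

Let quot_le i k x : (`|quot i k x|%:E <= g x)%E.
Proof.
have hx : `|x + h k *: e_ i - x| <= h k.
  by rewrite addrC addKr normrZ norm_delta mulr1 ger0_norm// ltW.
have := Fg (h_gt0 k) (h_le k).2 hx (y := x + h k *: e_ i) (z := x).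
rewrite subrr normr0 => /(_ (ltW (h_gt0 k))) H.
rewrite normrM normfV (gtr0_norm (h_gt0 k)) EFinM.
by rewrite lee_pdivrMl.
Qed.

Let mquot i k : measurable_fun setT (quot i k : lebRn -> R).
Proof.
have mF := continuous_measurable_lebRn cF.
have m1 : measurable_fun setT ((fun x => F (x + h k *: e_ i)) : lebRn -> R).
  exact: (measurableT_comp mF (measurable_shift _)).
exact: (measurable_funM (measurable_cst _) (measurable_funB m1 mF)).
Qed.

(** The quotients times the weight are dominated by the integrable [G x * w x] and have a weak limit
    f. Testing against [phi / w], bounded on the support of [phi], identifies [f / w] as the weak
    partial derivative. *)
Lemma exists_weak_partial i : exists f : V -> R,
  [/\ measurable_fun setT (f : lebRn -> R), (forall x, `|f x| <= fine (g x)) &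
   forall phi : V -> R, test_function phi ->
    - (\int[mu]_x (F x * partial i phi x)) = \int[mu]_x (f x * phi x)].
Proof.
have [w [iw w01 wlow]] := exists_weight R n.
have [Lim [LimD LimZ Lim0 Lim_cvg]] := banach_limit R.
have mw : measurable_fun setT (w : lebRn -> R).
  by case/integrableP : iw => /measurable_EFinP.
pose N := [set x : V | g x = +oo%E].
have mNc : measurable (~` N : set lebRn) by exact: measurableC.
(* Where [g] is infinite its finite part [G] is 0; the quotients are set to 0 on this null set so
   that they are dominated at every point. *)
pose u k (x : V) : R := quot i k x * (\1_(~` N) x * w x).
have w0 x : 0 < w x by case/andP: (w01 x).
have muk k : measurable_fun setT (u k : lebRn -> R).
  exact: (measurable_funM (mquot i k) (measurable_funM (measurable_indic mNc) mw)).
have ug k x : `|u k x| <= G x * w x.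
  rewrite /u mulrA normrM (gtr0_norm (w0 x)) ler_wpM2r ?(ltW (w0 x))//.
  rewrite indicE; case: (boolP (x \in ~` N)) => [|_]; last by rewrite mulr0 normr0.
  rewrite inE mulr1 /N/= => gx; rewrite -lee_fin fineK; first exact: quot_le.
  by rewrite ge0_fin_numE// ltey; apply/eqP.
have mGw : measurable_fun setT ((fun x => G x * w x) : lebRn -> R).
  exact: (measurable_funM mG mw).
have iGw : mu.-integrable setT (EFin \o (fun x => G x * w x) : lebRn -> \bar R).
  apply: (@le_integrable _ lebRn R mu setT measurableT _
      (fun x => (w x)%:E + g x `^ p)%E).
  - exact/measurable_EFinP.
  - move=> x _ /=; rewrite [leRHS]gee0_abs; last first.
      by rewrite adde_ge0 ?poweR_ge0// lee_fin ltW.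
    rewrite ger0_norm; last by rewrite mulr_ge0// ltW.
    rewrite EFinM; apply: le_trans (lee_wpmul2r _ (G_le x)) _.
      by rewrite lee_fin ltW.
    rewrite muleDl ?mul1e ?ge0_adde_def ?inE ?poweR_ge0// leeD2l//.
    rewrite -[leRHS]mule1; apply: lee_wpmul2l; first exact: poweR_ge0.
    by rewrite lee_fin; case/andP: (w01 x).
  - exact: (integrableD measurableT iw igp).
have [f0 [if0 f0G f0E]] := dominated_weak_limit LimD LimZ Lim0 Lim_cvg iGw muk ug.
have Gw0 (x : lebRn) : 0 <= G x * w x by rewrite mulr_ge0// ltW.
(* The limit is so far dominated only in the sense of integrals; a change on a null set makes the
   bound pointwise. *)
have [f [if_ fG ff0]] := integral_abs_le_clamp Gw0 if0 iGw f0G.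
have mf : measurable_fun setT (f : lebRn -> R).
  by case/integrableP : if_ => /measurable_EFinP.
have fE A : measurable (A : set lebRn) ->
    Lim (fun k => \int[mu]_(x in A) u k x) = \int[mu]_(x in A) f x.
  move=> mA; rewrite f0E// /Rintegral; congr fine.
  have mf0 : measurable_fun setT (f0 : lebRn -> R).
    by case/integrableP : if0 => /measurable_EFinP.
  apply: (@ae_eq_integral _ lebRn R mu A _ _ mA).
  - by apply/measurable_EFinP; exact: measurable_funTS.
  - by apply/measurable_EFinP; exact: measurable_funTS.
  - by apply: filterS ff0 => x -> _.
have mwV : measurable_fun setT ((fun x => (w x)^-1) : lebRn -> R).
  have -> : (fun x => (w x)^-1) = (fun x => w x `^ (-1)).
    by apply/funext => x; rewrite powR_inv1// ltW.
  exact: (measurableT_comp (measurable_powR _) mw).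
exists (fun x => f x / w x); split.
- exact: (measurable_funM mf mwV).
- move=> x; rewrite normrM normfV (gtr0_norm (w0 x)) ler_pdivrMr//.
- move=> phi tphi.
  have [M [M0 pM]] := test_function_support tphi.
  have cphi := test_function_continuous tphi.
  have [K1 [K10 pK1]] := compact_support_bounded cphi pM.
  have mphi := continuous_measurable_lebRn cphi.
  have [c [c0 wc]] := wlow M.
  pose psi (x : V) : R := phi x / w x.
  have mpsi : measurable_fun setT (psi : lebRn -> R).
    exact: (measurable_funM mphi mwV).
  have psiK x : `|psi x| <= K1 / c.
    rewrite normrM normfV (gtr0_norm (w0 x)).
    have [xM|Mx] := leP `|x| M.
      by apply: ler_pM => //; rewrite ?invr_ge0 ?(ltW (w0 x))// lef_pV2 ?posrE// wc.
    by rewrite pM// normr0 mul0r divr_ge0// ltW.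
  have H := dominated_weak_limit_pairing LimD LimZ Lim0 Lim_cvg iGw muk ug if_ fE
    mpsi psiK.
  have -> : \int[mu]_x (f x / w x * phi x) = \int[mu]_x (f x * psi x).
    by apply: eq_Rintegral => x _; rewrite /psi; lra.
  rewrite -H; apply/esym; apply: Lim_cvg.
  have -> : (fun k => \int[mu]_x (u k x * psi x)) =
      (fun k => \int[mu]_x (quot i k x * phi x)).
    apply/funext => k; rewrite /Rintegral; congr fine.
    apply: (@ae_eq_integral _ lebRn R mu setT _ _ measurableT).
    + by apply/measurable_EFinP; exact: (measurable_funM (muk k) mpsi).
    + by apply/measurable_EFinP; exact: (measurable_funM (mquot i k) mphi).
    + exists N; split=> // x /= nx; apply: contrapT => Nx; apply: nx => _.
      congr EFin; rewrite /u /psi indicE mem_set//.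
      by rewrite mul1r -mulrA [w x * _]mulrC divfK// gt_eqF.
  apply: integral_partial_quot => //.
  + exact: continuous_loc_integrable.
  + by move=> k; rewrite gt_eqF.
  + by move=> k; rewrite gtr0_norm// (h_le k).1.
Qed.

Lemma exists_weak_gradient : exists G' : V -> V, is_weak_gradient F G' /\
  forall x i, `|G' x 0 i| <= fine (g x).
Proof.
have [f fP] := choice exists_weak_partial.
exists (fun x => \row_i f i x); split=> [i|x i]; last first.
  by rewrite mxE; have [_ + _] := fP i; exact.
have [mf fG fE] := fP i.
have -> : (fun x => (\row_i f i x) 0 i) = f i.
  by apply/funext => x; rewrite mxE.
split; first exact: integrable_locally_dominated_compact.
move=> phi tphi; rewrite -[LHS]opprK fE//; congr (- _).
by apply: eq_Rintegral => x _; rewrite mxE.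
Qed.

End weak_gradient_existence.

(** * Uniqueness of weak gradients *)

Section fundamental_lemma.
Variables (R : realType) (n : nat).
Local Notation V := 'rV[R]_n.+1.
Local Notation lebRn := (lebRn R n).
Local Notation mu := (@lebesgue_measure_rV R n).

Definition boxes : set (set V) := [set box u | u in [set: V * V]].

Lemma boxes_setI_closed : setI_closed boxes.
Proof.
move=> _ _ [u _ <-] [v _ <-].
exists (\row_i Num.max (u.1 0 i) (v.1 0 i), \row_i Num.min (u.2 0 i) (v.2 0 i)) => //.
apply/seteqP; split=> x /=.
  by move=> H; split=> i; have := H i; rewrite !mxE ge_max le_min;
    move=> /andP[/andP[h1 h2] /andP[h3 h4]]; apply/andP; split.
move=> [H1 H2] i; have /andP[h1 h2] := H1 i; have /andP[h3 h4] := H2 i.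
by rewrite !mxE ge_max le_min h1 h2 h3 h4.
Qed.

Lemma sigma_boxes_measurable (A : set V) : <<s boxes >> A -> measurable (A : set lebRn).
Proof.
apply: smallest_sub; first exact: (@sigma_algebra_measurable _ lebRn).
by move=> _ [u _ <-]; exact: box_measurable.
Qed.

(** The intersection of countable covers by boxes whose total volumes exceed the outer measure by
    [m.+1%:R^-1]. It links Caratheodory measurable sets to the sigma-algebra generated by boxes, on
    which a Dynkin argument is possible. *)
Lemma measurable_hull (A : set V) : (leb_outer A < +oo)%E ->
  exists B, [/\ <<s boxes >> B, A `<=` B & leb_outer B = leb_outer A].
Proof.
move=> Afin.
have Af : leb_outer A \is a fin_num by rewrite ge0_fin_numE// leb_outer_ge0.
have H (m : nat) : {w : nat -> V * V | A `<=` \bigcup_k box (w k) /\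
    (\sum_(k <oo) (box_vol (w k))%:E <= leb_outer A + (m.+1%:R^-1)%:E)%E}.
  apply: cid; have m0 : 0 < m.+1%:R^-1 :> R by rewrite invr_gt0.
  have [_ [w Aw <-] wl] := lb_ereal_inf_adherent m0 Af.
  by exists w; split=> //; exact: ltW.
pose u m := sval (H m); have uP m := svalP (H m).
rewrite -/(u _) in uP.
pose U m := \bigcup_k box (u m k).
have mbox w : @measurable _ (g_sigma_algebraType boxes) (box w).
  by apply: sub_sigma_algebra; exists w.
have mU m : @measurable _ (g_sigma_algebraType boxes) (U m).
  by apply: bigcup_measurable => k _; exact: mbox.
exists (\bigcap_m U m); split.
- exact: (@bigcap_measurable _ (g_sigma_algebraType boxes)).
- by move=> x Ax m _; exact: (uP m).1.
- apply/eqP; rewrite eq_le; apply/andP; split; last first.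
    by apply: le_leb_outer => x Ax m _; exact: (uP m).1.
  apply/lee_addgt0Pr => e e0.
  have [m me] : exists m, m.+1%:R^-1 < e.
    have [m _ /(_ m (leqnn _))] := near_infty_natSinv_lt (PosNum e0).
    by exists m.
  apply: (@le_trans _ _ (leb_outer A + (m.+1%:R^-1)%:E)%E); last first.
    by rewrite leeD2l// lee_fin ltW.
  apply: le_trans (uP m).2; apply: ereal_inf_lbound; exists (u m) => //.
  by move=> x /(_ m I).
Qed.

Variable h : V -> R.
Hypothesis lh : loc_integrable h.
Hypothesis h0 : forall phi : V -> R, test_function phi ->
  \int[mu]_x (h x * phi x) = 0.

(** The indicator of a box is the pointwise limit of products of smooth steps, two for each
    coordinate, that equal 1 on the box. *)
Lemma integral_box_eq0 (u : V * V) : \int[mu]_(x in box u) h x = 0.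
Proof.
(* The transitions of the steps below lie outside the box and have length [2 / k.+1%:R], hence the
   margin 2. *)
pose M := `|u.1| + `|u.2| + 2.
pose s k (i : 'I_n.+1) (t : R) :=
  step (k.+1%:R * (t - u.1 0 i) + 1) * step (k.+1%:R * (u.2 0 i - t) + 1).
pose phi k := prodfn (s k).
have s01 k i t : 0 <= s k i t <= 1.
  have /andP[a1 a2] := step_ge0_le1 (k.+1%:R * (t - u.1 0 i) + 1).
  have /andP[b1 b2] := step_ge0_le1 (k.+1%:R * (u.2 0 i - t) + 1).
  by rewrite mulr_ge0// mulr_ile1.
have sM k i t : M < `|t| -> s k i t = 0.
  rewrite /M ltr_normr => /orP[Mt|Mt].
    rewrite /s [step (_ * (_ - t) + 1)]step_le ?mulr0//.
    have h1 : u.2 0 i <= `|u.2| by rewrite (le_trans (ler_norm _))// coord_le_norm.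
    have h2 : u.2 0 i - t <= -2 by have := normr_ge0 u.1; lra.
    have : 1%R <= k.+1%:R :> R by rewrite ler1n.
    nra.
  rewrite /s step_le ?mul0r//.
  have h1 : - u.1 0 i <= `|u.1|.
    by rewrite (le_trans (ler_norm _))// normrN coord_le_norm.
  have h2 : t - u.1 0 i <= -2 by have := normr_ge0 u.2; lra.
  have : 1%R <= k.+1%:R :> R by rewrite ler1n.
  nra.
have tphi k : test_function (phi k).
  apply: (@prodfn_test_function _ _ _ M) => [i j|i t]; last exact: sM.
  apply: smoothnM.
    have := smoothn_affine k.+1%:R (1 - k.+1%:R * u.1 0 i) (@smoothn_step R j).
    by congr smoothn; apply/funext => t; congr step; lra.
  have := smoothn_affine (- k.+1%:R) (1 + k.+1%:R * u.2 0 i) (@smoothn_step R j).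
  by congr smoothn; apply/funext => t; congr step; lra.
have phi01 k x : 0 <= phi k x <= 1.
  rewrite /phi /prodfn; apply/andP; split.
    by apply: prodr_ge0 => i _; case/andP: (s01 k i (x 0 i)).
  by apply: prodr_ile1 => i _; exact: s01.
have phiM k (x : V) : M < `|x| -> phi k x = 0.
  move=> Mx; have M0 : 0 <= M by rewrite !addr_ge0.
  have [i xi] : exists i, M < `|x 0 i|.
    apply: contrapT => H; move: Mx; rewrite ltNge => /negP; apply.
    apply/rV_norm_le => // i; rewrite leNgt; apply/negP => xi; apply: H.
    by exists i.
  by rewrite /phi /prodfn (bigD1 i)//= sM// mul0r.
have cvphi x : (fun k => phi k x) @ \oo --> (\1_(box u) x : R).
  have [xu|xu] := pselect (box u x).
    rewrite indicE mem_set// (_ : (fun k => phi k x) = cst 1); last first.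
      apply/funext => k; rewrite /phi /prodfn big1// => i _.
      have /andP[a1 a2] := xu i; rewrite /s !step_ge ?mulr1// lerDr mulr_ge0//.
        by rewrite subr_ge0.
      by rewrite subr_ge0.
    exact: cvg_cst.
  rewrite indicE memNset//.
  have [i xi] : exists i, ~~ (u.1 0 i <= x 0 i <= u.2 0 i).
    apply: contrapT => H; apply: xu => i; apply/negPn/negP => xi; apply: H.
    by exists i.
  have big (c : R) : 0 < c -> \forall k \near \oo, 2 <= k.+1%:R * c.
    move=> c0; near=> k.
    rewrite -ler_pdivrMr//; apply: (@le_trans _ _ k%:R); last by rewrite ler_nat.
    by near: k; exact: nbhs_infty_ger.
  apply: cvg_near_cst.
  move: xi; rewrite negb_and -!ltNge => /orP[xi|xi].
    have := big (u.1 0 i - x 0 i); rewrite subr_gt0 => /(_ xi).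
    apply: filterS => k kc; rewrite /phi /prodfn (bigD1 i)//= /s step_le ?mul0r//.
    lra.
  have := big (x 0 i - u.2 0 i); rewrite subr_gt0 => /(_ xi).
  apply: filterS => k kc.
  rewrite /phi /prodfn (bigD1 i)//= /s [step (_ * (_ - x 0 i) + 1)]step_le ?mulr0 ?mul0r//.
  lra.
have mbox : measurable (box u : set lebRn) by exact: box_measurable.
have mh := lh.1.
have mphi k : measurable_fun setT (phi k : lebRn -> R).
  by apply: continuous_measurable_lebRn; exact: test_function_continuous.
have mc : measurable (cube 0 M : set lebRn) by exact: cube_measurable.
have ib : mu.-integrable setT
    (EFin \o (fun x => h x * \1_(cube 0 M) x) : lebRn -> \bar R).
  apply: (@loc_integrable_mul R n h (\1_(cube 0 M)) M 1 lh (measurable_indic mc)).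
    by move=> x; rewrite indicE; case: (_ \in _); rewrite ?normr1 ?normr0.
  move=> x Mx; rewrite indicE memNset//.
  by rewrite /cube/= subr0; apply/negP; rewrite -ltNge.
have boxM x : box u x -> `|x| <= M.
  move=> xu; apply/rV_norm_le => [|i]; first by rewrite !addr_ge0.
  have /andP[a1 a2] := xu i; rewrite ler_norml.
  have b1 : - u.1 0 i <= `|u.1|.
    by rewrite (le_trans (ler_norm _))// normrN coord_le_norm.
  have b2 : u.2 0 i <= `|u.2| by rewrite (le_trans (ler_norm _))// coord_le_norm.
  have c1 := normr_ge0 u.1; have c2 := normr_ge0 u.2.
  by rewrite /M; apply/andP; split; lra.
have -> : \int[mu]_(x in box u) h x = \int[mu]_x (h x * \1_(box u) x).
  rewrite Rintegral_mkcond; apply: eq_Rintegral => x _.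
  by rewrite patchE indicE; case: ifP => _; rewrite ?mulr1 ?mulr0.
have ibox : mu.-integrable setT
    (EFin \o (fun x => h x * \1_(box u) x) : lebRn -> \bar R).
  apply: (@loc_integrable_mul R n h (\1_(box u)) M 1 lh (measurable_indic mbox)).
    by move=> x; rewrite indicE; case: (_ \in _); rewrite ?normr1 ?normr0.
  move=> x Mx; rewrite indicE memNset// => /boxM.
  by rewrite leNgt Mx.
have cvi : (fun k => \int[mu]_x (h x * phi k x)) @ \oo -->
    \int[mu]_x (h x * \1_(box u) x).
  rewrite /Rintegral; apply: fine_cvg.
  rewrite fineK; last exact: integrable_fin_num ibox.
  apply: (@dominated_cvg _ lebRn R mu setT measurableT _ _
    (fun x => `|(h x * \1_(cube 0 M) x)%:E|%E)).
  - by move=> k; apply/measurable_EFinP; exact: (measurable_funM mh (mphi k)).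
  - move=> x _; apply: cvg_EFin; first by near=> k.
    by apply: cvgMr; exact: cvphi.
  - by [].
  - exact: integrable_abse ib.
  - move=> k x _ /=; rewrite lee_fin normrM [leRHS]normrM ler_wpM2l//.
    have [xM|Mx] := leP `|x : V| M; last by rewrite phiM// normr0.
    rewrite indicE mem_set ?normr1; last by rewrite /cube/= subr0.
    by have /andP[a1 a2] := phi01 k x; rewrite ger0_norm.
apply/esym; have -> : 0 = lim ((fun k => \int[mu]_x (h x * phi k x)) @ \oo).
  by rewrite (_ : (fun k => _) = cst 0) ?lim_cst//; apply/funext => k; exact: h0.
exact: cvg_lim cvi.
Unshelve. all: by end_near. Qed.

(** The restriction of [h] to a cube is integrable. Its integral vanishes on boxes, which are stable
    under intersection, hence on the sigma-algebra they generate; a measurable set inside the cube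
    differs from its hull by a null set. *)
Lemma integral_cube_eq0 (N : R) (A : set V) : 0 <= N ->
  measurable (A : set lebRn) -> \int[mu]_(x in A) (h x * \1_(cube 0 N) x) = 0.
Proof.
move=> N0; pose k x : R := h x * \1_(cube 0 N) x; rewrite -/k.
have mc : measurable (cube 0 N : set lebRn) by exact: cube_measurable.
have ik : mu.-integrable setT (EFin \o k : lebRn -> \bar R).
  apply: (@loc_integrable_mul R n h (\1_(cube 0 N)) N 1 lh (measurable_indic mc)).
    by move=> x; rewrite indicE; case: (_ \in _); rewrite ?normr1 ?normr0.
  move=> x Mx; rewrite indicE memNset//.
  by rewrite /cube/= subr0; apply/negP; rewrite -ltNge.
have kE B : \int[mu]_(x in B) k x = \int[mu]_(x in B `&` cube 0 N) h x.
  rewrite Rintegral_mkcondr; apply: eq_Rintegral => x _.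
  by rewrite patchE /k indicE; case: ifP => _; rewrite ?mulr1 ?mulr0.
have ikB (B : set lebRn) : measurable B -> mu.-integrable B (EFin \o k : lebRn -> \bar R).
  by move=> mB; exact: (integrableS measurableT mB (@subsetT _ B) ik).
have sB B : <<s boxes >> B -> \int[mu]_(x in B) k x = 0.
  move=> sBB; pose P B := \int[mu]_(x in B) k x = 0; rewrite -/(P B).
  have [] // : measurable (B : set lebRn) /\ P B.
  move: sBB; move: B; apply: (@lambda_system_subset V boxes boxes_setI_closed setT
    [set B : set V | measurable (B : set lebRn) /\ P B]) => //; last first.
    move=> B bB; split; first by apply: sigma_boxes_measurable; exact: sub_gen_smallest.
    have [u _ uE] : boxes (B `&` cube 0 N).
      by apply: boxes_setI_closed => //; rewrite cube_box//; eexists.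
    by rewrite /P kE -uE; exact: integral_box_eq0.
  have PE (B : set lebRn) : measurable B -> P B -> (\int[mu]_(x in B) (k x)%:E)%E = 0%E.
    move=> mB PB; rewrite -[LHS]fineK; first by rewrite [fine _]PB.
    exact: (integrable_fin_num mB (ikB _ mB)).
  apply/dynkin_lambda_system; split=> /=.
  - by split=> //; rewrite /P kE setTI cube_box//; exact: integral_box_eq0.
  - move=> B [mB PB]; split; first exact: measurableC.
    have : P setT by rewrite /P kE setTI cube_box//; exact: integral_box_eq0.
    rewrite /P -(setUv B) (@Rintegral_setU _ lebRn R mu B (~` B) k mB (measurableC mB)).
    - by rewrite PB add0r.
    - by apply: ikB; rewrite setUv.
    - by apply/disj_setPS; rewrite setICr.
  - move=> F tF Hm; have mU : measurable (\bigcup_i F i : set lebRn).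
      by apply: bigcup_measurable => i _; have [] := Hm i.
    split=> //; rewrite /P /Rintegral (@integral_bigcup _ lebRn R mu F _ tF).
    - by rewrite eseries0//= => i _ _; have [mFi /(PE _ mFi)] := Hm i.
    - by move=> i; have [] := Hm i.
    - exact: ikB.
move=> mA; have mAQ : measurable (A `&` cube 0 N : set lebRn) by exact: measurableI.
have finAQ : (leb_outer (A `&` cube 0 N) < +oo)%E.
  apply: le_lt_trans (_ : (mu (cube 0 N) < +oo)%E); first by apply: le_leb_outer => x [].
  by rewrite mu_cube// ltry.
have [B [sBB AB BA]] := measurable_hull finAQ.
have mB := sigma_boxes_measurable sBB.
pose D := B `\` (A `&` cube 0 N).
have mD : measurable (D : set lebRn) by exact: measurableD.
have muD : mu D = 0%E.
  have finB : (leb_outer B < +oo)%E by rewrite BA.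
  apply: (etrans (@measureD _ lebRn R mu B _ mB mAQ finB)).
  rewrite (setIidr AB); change (leb_outer B - leb_outer (A `&` cube 0 N) = 0)%E.
  by rewrite BA subee// ge0_fin_numE// leb_outer_ge0.
have -> : \int[mu]_(x in A) k x = \int[mu]_(x in A `&` cube 0 N) k x.
  by rewrite !kE -setIA setIid.
have BU : (A `&` cube 0 N) `|` D = B by rewrite /D setDUK.
have := sB B sBB; rewrite -BU.
rewrite (@Rintegral_setU _ lebRn R mu _ D k mAQ mD); last 2 first.
- by rewrite BU; exact: ikB.
- by apply/disj_setPS; rewrite /D setDIK.
rewrite [X in _ + X](_ : _ = 0) ?addr0//.
have [mkD _] := integrableP _ _ _ (ikB D mD).
by rewrite /Rintegral (@null_set_integral _ lebRn R mu D _ mD mkD muD).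
Qed.

Lemma fundamental_lemma : {ae mu, forall x, h x = 0}.
Proof.
pose k (N : nat) (x : V) : R := h x * \1_(cube 0 N%:R) x.
have ik N : mu.-integrable setT (EFin \o k N : lebRn -> \bar R).
  have mc : measurable (cube (0 : V) N%:R : set lebRn) by exact: cube_measurable.
  apply: (@loc_integrable_mul R n h (\1_(cube 0 N%:R)) N%:R 1 lh (measurable_indic mc)).
    by move=> x; rewrite indicE; case: (_ \in _); rewrite ?normr1 ?normr0.
  move=> x Mx; rewrite indicE memNset//.
  by rewrite /cube/= subr0; apply/negP; rewrite -ltNge.
have i0 : mu.-integrable setT (EFin \o cst 0 : lebRn -> \bar R) by exact: integrable0.
have R0 (A : set lebRn) : \int[mu]_(x in A) (cst 0 : V -> R) x = 0.
  by rewrite /Rintegral integral0.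
have kA N (A : set lebRn) : measurable A -> \int[mu]_(x in A) k N x = 0.
  by move=> mA; exact: integral_cube_eq0.
have eqle (a b : R) : a = b -> a <= b by move=> ->.
have kN N := @integral_le_negligible _ lebRn R mu (k N) (cst 0) (ik N) i0
  (fun A mA => eqle _ _ (etrans (kA N A mA) (esym (R0 A)))).
have kP N := @integral_le_negligible _ lebRn R mu (cst 0) (k N) i0 (ik N)
  (fun A mA => eqle _ _ (etrans (R0 A) (esym (kA N A mA)))).
pose Z := \bigcup_N ([set x | (0 : R) < k N x] `|` [set x | k N x < (0 : R)]) : set lebRn.
exists Z; split.
- by apply: bigcup_measurable => N _; apply: measurableU; [have [] := kN N|have [] := kP N].
- apply/eqP; rewrite eq_le measure_ge0 andbT.
  apply: le_trans (leb_outer_sigma_subadditive _) _.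
  rewrite eseries0// => N _ _; apply/eqP; rewrite eq_le leb_outer_ge0 andbT.
  have [mN N0] := kN N; have [mP P0] := kP N.
  by apply: le_trans (outer_measureU2 _ _ _) _; rewrite [X in (X + _)%E]N0 [X in (_ + X)%E]P0 adde0.
- move=> x /= /eqP hx.
  exists (Num.truncn `|x|).+1 => //=; rewrite /k indicE mem_set; last first.
    by rewrite /cube/= subr0 ltW// truncnS_gt.
  by rewrite mulr1; case: (ltgtP (h x) 0) hx => // ? _; [right|left].
Qed.

End fundamental_lemma.

Lemma weak_gradient_unique (R : realType) (n : nat) (F : 'rV[R]_n.+1 -> R)
    (G G' : 'rV[R]_n.+1 -> 'rV[R]_n.+1) :
  is_weak_gradient F G -> is_weak_gradient F G' ->
  {ae @lebesgue_measure_rV R n, forall x, G x = G' x}.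
Proof.
move=> wG wG'.
have H i : {ae @lebesgue_measure_rV R n, forall x, G x 0 i - G' x 0 i = 0}.
  have [[mG lG] GP] := wG i; have [[mG' lG'] GP'] := wG' i.
  have ll : loc_integrable (fun x => G x 0 i - G' x 0 i).
    split; first exact: (measurable_funB mG mG').
    move=> K cK; have mK := measurable_compact cK.
    by apply: eq_integrable (integrableB mK (lG K cK) (lG' K cK)).
  apply: fundamental_lemma => // phi tphi.
  have [M [M0 Mphi]] := test_function_support tphi.
  have [K [K0 Kphi]] := compact_support_bounded (test_function_continuous tphi) Mphi.
  have mphi := continuous_measurable_lebRn (test_function_continuous tphi).
  under eq_Rintegral do rewrite mulrBl.
  rewrite (@RintegralB _ (lebRn R n) R (@lebesgue_measure_rV R n) _ _ _ measurableT
    (loc_integrable_mul (wG i).1 mphi Kphi Mphi)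
    (loc_integrable_mul (wG' i).1 mphi Kphi Mphi)).
  by apply/eqP; rewrite subr_eq0 -eqr_opp -(GP phi tphi) -(GP' phi tphi).
have FF := @ae_filter_ringOfSetsType _ (lebRn R n) R (@lebesgue_measure_rV R n).
have := @filter_forall _ _ _ _ FF H.
apply: (@filterS _ _ FF) => x Hx; apply/rowP => i; apply/eqP.
by rewrite -subr_eq0 (Hx i).
Qed.

(** * Morrey's inequality *)

Section bump_means.
Variables (R : realType) (n : nat).
Local Notation V := 'rV[R]_n.+1.
Local Notation lebRn := (lebRn R n).
Local Notation mu := (@lebesgue_measure_rV R n).
Implicit Types (c x : V) (s : R) (F : V -> R) (G : V -> V).

Definition bump_cube c s : V -> R := prodfn (fun i => bumpI (c 0 i) s).

Definition bump_cube_mean F c s : R := \int[mu]_x (F x * bump_cube c s x).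

(* The m-th partial derivative of [prodfn (telescope_fn c s c' s' m)] is the
   m-th term of the telescoping sum for [bump_cube c s - bump_cube c' s']. *)
Definition telescope_fn c s c' s' (m : 'I_n.+1) : 'I_n.+1 -> R -> R := fun i =>
  if (i < m)%N then bumpI (c' 0 i) s'
  else if i == m then (fun t => stepI (c 0 i) s t - stepI (c' 0 i) s' t)
  else bumpI (c 0 i) s.

(** Neither step has compact support, but beyond both intervals and on the same side of them the two
    steps are both 0 or both 1, so their difference does. *)
Lemma telescope_fn_eq0 c s c' s' m i t : 0 < s -> 0 < s' ->
  s <= `|t - c 0 i| -> s' <= `|t - c' 0 i| -> c 0 i <= t /\ c' 0 i <= t \/ t < c 0 i /\ t < c' 0 i ->
  telescope_fn c s c' s' m i t = 0.
Proof.
move=> s0 s'0 h h' e; rewrite /telescope_fn.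
case: ifP => _; first exact: bumpI_eq0.
case: ifP => _; last exact: bumpI_eq0.
rewrite !stepI_eq//; case: e => -[]; first by move=> -> ->; rewrite subrr.
by rewrite !ltNge => /negbTE -> /negbTE ->; rewrite subrr.
Qed.

Lemma telescope_fn_test_function c s c' s' m : 0 < s -> 0 < s' ->
  test_function (prodfn (telescope_fn c s c' s' m)).
Proof.
move=> s0 s'0.
apply: (@prodfn_test_function _ _ _ (`|c| + `|c'| + s + s')) => [i k|i t].
  rewrite /telescope_fn; case: ifP => _; first exact: smoothn_bumpI.
  case: ifP => _; last exact: smoothn_bumpI.
  have := smoothnD (smoothn_stepI k (c 0 i) s)
    (smoothnM (smoothn_cst k (-1)) (smoothn_stepI k (c' 0 i) s')).
  by congr smoothn; apply/funext => t; rewrite mulN1r.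
rewrite ltr_normr => Mt.
have [c1 c2] : - `|c| <= c 0 i /\ c 0 i <= `|c|.
  by apply/andP; rewrite -ler_norml coord_le_norm.
have [d1 d2] : - `|c'| <= c' 0 i /\ c' 0 i <= `|c'|.
  by apply/andP; rewrite -ler_norml coord_le_norm.
have n1 := normr_ge0 c; have n2 := normr_ge0 c'.
apply: telescope_fn_eq0 => //.
- by rewrite ler_normr; case/orP : Mt => ?; apply/orP; [left|right]; lra.
- by rewrite ler_normr; case/orP : Mt => ?; apply/orP; [left|right]; lra.
- by case/orP : Mt => Mt; [left|right]; split; lra.
Qed.

Lemma bump_cube_telescope c s c' s' x :
  bump_cube c s x - bump_cube c' s' x =
  \sum_m partial m (prodfn (telescope_fn c s c' s' m)) x.
Proof.
rewrite /bump_cube /prodfn prod_telescope; apply: eq_bigr => m _.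
have D (t : R) : is_derive t 1 (telescope_fn c s c' s' m m)
    (bumpI (c 0 m) s t - bumpI (c' 0 m) s' t).
  rewrite /telescope_fn ltnn eqxx.
  exact: (is_deriveB (is_derive_stepI _ _ t) (is_derive_stepI _ _ t)).
rewrite (partial_prodfn D) /prodfn; apply: eq_bigr => i _.
rewrite /subst_fn /telescope_fn.
have [->|im] := eqVneq i m; first by rewrite ltnn.
by case: ifP.
Qed.

Lemma Rintegral_sum (I : finType) (f : I -> V -> R) :
  (forall i, mu.-integrable setT (EFin \o f i : lebRn -> \bar R)) ->
  \int[mu]_x (\sum_i f i x) = \sum_i \int[mu]_x f i x.
Proof.
move=> fi; suff [] : mu.-integrable setT
    (EFin \o (fun x => \sum_i f i x) : lebRn -> \bar R) /\
    \int[mu]_x (\sum_i f i x) = \sum_i \int[mu]_x f i x by [].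
elim: (index_enum I) => [|i r [ih1 ih2]].
  rewrite (_ : (fun x => _) = cst 0); last by apply/funext => x; rewrite big_nil.
  rewrite big_nil; split; first exact: integrable0.
  by rewrite /Rintegral integral0.
rewrite (_ : (fun x => _) = (fun x => f i x + \sum_(j <- r) f j x)); last first.
  by apply/funext => x; rewrite big_cons.
rewrite big_cons -ih2; split; last exact: (RintegralD measurableT (fi i) ih1).
exact: (integrableD measurableT (fi i) ih1).
Qed.

Lemma bump_cube_mean_diff F G c s c' s' : loc_integrable F ->
  is_weak_gradient F G -> 0 < s -> 0 < s' ->
  bump_cube_mean F c s - bump_cube_mean F c' s' =
  - \sum_m \int[mu]_x (G x 0 m * prodfn (telescope_fn c s c' s' m) x).
Proof.
move=> lF wG s0 s'0; rewrite -sumrN.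
have tT m := telescope_fn_test_function c c' m s0 s'0.
have iP phi m : test_function phi ->
    mu.-integrable setT (EFin \o (fun x => F x * partial m phi x) : lebRn -> \bar R).
  move=> tphi; have [M [M0 Mphi]] := test_function_support tphi.
  have cp := @partial_continuous _ _ phi tphi m.
  have Mp := partial_support m Mphi.
  have [K [K0 Kp]] := compact_support_bounded cp Mp.
  exact: (loc_integrable_mul lF (continuous_measurable_lebRn cp) Kp Mp).
have iw e t : 0 < t ->
    mu.-integrable setT (EFin \o (fun x => F x * bump_cube e t x) : lebRn -> \bar R).
  move=> t0.
  have tw : test_function (bump_cube e t).
    apply: (@prodfn_test_function _ _ _ (`|e| + t)) => [i k|i u Mu]; first exact: smoothn_bumpI.
    apply: bumpI_eq0 => //; have := coord_le_norm e i.
    by have := ler_normD (u - e 0 i) (e 0 i); rewrite subrK => *; lra.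
  have [M [M0 Mphi]] := test_function_support tw.
  have cp := test_function_continuous tw.
  have [K [K0 Kp]] := compact_support_bounded cp Mphi.
  exact: (loc_integrable_mul lF (continuous_measurable_lebRn cp) Kp Mphi).
rewrite /bump_cube_mean -(RintegralB measurableT (iw c s s0) (iw c' s' s'0)).
rewrite (eq_bigr (fun m => \int[mu]_x (F x * partial m (prodfn (telescope_fn c s c' s' m)) x))).
  rewrite -Rintegral_sum; last by move=> m; exact: iP.
  by apply: eq_Rintegral => x _; rewrite -mulrBr bump_cube_telescope mulr_sumr.
by move=> m _; rewrite (wG m).2.
Qed.

(** The assumptions on the centers and radii put both cubes inside [cube c (3 * s)]. *)
Lemma telescope_fn_support c s c' s' m x : 0 < s' -> s' <= s -> `|c' - c| <= 2 * s ->
  ~ cube c (3 * s) x -> prodfn (telescope_fn c s c' s' m) x = 0.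
Proof.
move=> s'0 s's cc xc; have s0 := lt_le_trans s'0 s's.
have [i xi] : exists i, 3 * s < `|x 0 i - c 0 i|.
  apply: contrapT => H; apply: xc; apply/rV_norm_le; first by lra.
  by move=> i; rewrite !mxE leNgt; apply/negP => xi; apply: H; exists i.
rewrite /prodfn (bigD1 i)//= telescope_fn_eq0 ?mul0r//.
- by lra.
- have := coord_le_norm (c' - c) i; rewrite !mxE => h.
  by have := ler_normD (x 0 i - c' 0 i) (c' 0 i - c 0 i); rewrite addrA subrK => *; lra.
- have /andP[h1 h2] : - (2 * s) <= c' 0 i - c 0 i <= 2 * s.
    by have := coord_le_norm (c' - c) i; rewrite !mxE -ler_norml => /le_trans; apply.
  by move: xi; rewrite ltr_normr => /orP[xi|xi]; [left|right]; split; lra.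
Qed.

Variable K : R.
Hypothesis bK : forall t : R, bump t <= K.

(** Of the n.+1 factors, one is a difference of steps, at most 1 in absolute value, and the other n
    are bumps of height at most [K / s']. The exponent n, one less than the dimension, leaves one
    power of the radius when multiplied by the volume of a cube. *)
Lemma telescope_fn_bound c s c' s' m x : 0 < s' -> s' <= s ->
  `|prodfn (telescope_fn c s c' s' m) x| <= (K / s') ^+ n.
Proof.
move=> s'0 s's; have s0 := lt_le_trans s'0 s's.
have bI e t y : s' <= t -> `|bumpI e t y| <= K / s'.
  move=> st; have t0 := lt_le_trans s'0 st.
  rewrite ger0_norm ?bumpI_ge0// /bumpI; apply: ler_pM; rewrite ?bump_ge0 ?invr_ge0 ?(ltW t0)//.
  by rewrite lef_pV2.
rewrite /prodfn normr_prod (bigD1 m)//= -[leRHS]mul1r.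
apply: ler_pM => //; first by apply: prodr_ge0.
  rewrite /telescope_fn ltnn eqxx.
  have /andP[a1 a2] := step_ge0_le1 ((x 0 m - c 0 m) / s).
  have /andP[b1 b2] := step_ge0_le1 ((x 0 m - c' 0 m) / s').
  by rewrite /stepI ler_norml; apply/andP; split; lra.
rewrite -[X in _ ^+ X](_ : #|[pred i : 'I_n.+1 | i != m]| = n); last first.
  by rewrite cardC1 card_ord.
rewrite -prodr_const; apply: ler_prod => i im; rewrite normr_ge0/= /telescope_fn.
by rewrite (negbTE im); case: ifP => _; exact: bI.
Qed.

End bump_means.

(** * Comparison of means on nearby cubes *)

Section morrey.
Variables (R : realType) (n : nat).
Local Notation V := 'rV[R]_n.+1.
Local Notation lebRn := (lebRn R n).
Local Notation mu := (@lebesgue_measure_rV R n).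

Definition bump_mass : R := bump_cube_mean (cst 1) (0 : V) 1.

(** The difference of two means of the constant 1 is expressed through its weak gradient, which is
    0; this replaces a change of variables. *)
Lemma bump_cube_mass (c : V) (s : R) : 0 < s -> bump_cube_mean (cst 1) c s = bump_mass.
Proof.
move=> s0; have l1 : loc_integrable (cst 1 : V -> R).
  by apply: continuous_loc_integrable; exact: cst_continuous.
have w1 : is_weak_gradient (cst 1 : V -> R) (fun=> 0).
  move=> i; split.
    under eq_fun do rewrite mxE.
    by apply: continuous_loc_integrable; exact: cst_continuous.
  move=> phi tphi; under [in RHS]eq_Rintegral do rewrite mxE mul0r.
  have h1 : (fun k => (k.+1%:R^-1 : R)) @ \oo --> (0 : R) by exact: cvg_harmonic.
  have := @integral_partial_quot _ _ (cst 1) phi i (fun k => k.+1%:R^-1) l1 tphi.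
  have a1 k : (k.+1%:R^-1 : R) != 0 by rewrite invr_eq0 pnatr_eq0.
  have a2 k : `|k.+1%:R^-1 : R| <= 1.
    by rewrite ger0_norm// invf_le1// ler1n.
  move=> /(_ a1 a2 h1).
  rewrite (_ : (fun k => _) = cst 0); last first.
    apply/funext => k; under eq_Rintegral do rewrite /= subrr mulr0 mul0r.
    by rewrite /Rintegral integral0.
  move=> h; have e : - (\int[mu]_x (cst 1 x * partial i phi x)) = 0.
    exact: (cvg_unique _ h (cvg_cst (0 : R))).
  by rewrite -[LHS]opprK e oppr0 /Rintegral integral0 oppr0.
apply/eqP; rewrite -subr_eq0 (bump_cube_mean_diff c 0 l1 w1 s0 ltr01).
rewrite big1 ?oppr0// => m _; under eq_Rintegral do rewrite mxE mul0r.
by rewrite /Rintegral integral0.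
Qed.

Lemma bump_cube_ge0 (c x : V) (s : R) : 0 < s -> 0 <= bump_cube c s x.
Proof. by move=> s0; apply: prodr_ge0 => i _; exact: bumpI_ge0. Qed.

Lemma bump_cube_eq0 (c x : V) (s : R) : 0 < s -> s <= `|x - c| -> bump_cube c s x = 0.
Proof.
move=> s0; rewrite leNgt => /negP H.
have [i xi] : exists i, s <= `|x 0 i - c 0 i|.
  apply: contrapT => H'; apply: H; apply/(rV_norm_lt _ s0) => i.
  by rewrite !mxE ltNge; apply/negP => xi; apply: H'; exists i.
by rewrite /bump_cube /prodfn (bigD1 i)//= bumpI_eq0// mul0r.
Qed.

Lemma bump_cube_continuous (c : V) (s : R) : continuous (bump_cube c s).
Proof.
apply: continuous_prodfn => i.
exact: smoothn_continuous (smoothn_bumpI 0 (c 0 i) s).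
Qed.

Lemma bump_cube_integrable F (c : V) (s : R) : 0 < s -> loc_integrable F ->
  mu.-integrable setT (EFin \o (fun x => F x * bump_cube c s x) : lebRn -> \bar R).
Proof.
move=> s0 lF; have cw := @bump_cube_continuous c s.
have Mw (x : V) : `|c| + s < `|x| -> bump_cube c s x = 0.
  move=> Mx; apply: bump_cube_eq0 => //.
  by have := ler_normD (x - c) c; rewrite subrK; lra.
have [K [K0 Kw]] := compact_support_bounded cw Mw.
exact: (loc_integrable_mul lF (continuous_measurable_lebRn cw) Kw Mw).
Qed.

Lemma bump_mass_gt0 : 0 < bump_mass.
Proof.
have b0 : 0 < bump_cube (0 : V) 1 0.
  apply: prodr_gt0 => i _; rewrite /bumpI mxE subrr mul0r divr1.
  exact: bump_gt0.
have cw := @bump_cube_continuous (0 : V) 1.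
pose e : R := bump_cube (0 : V) 1 (0 : V) / 2; have e0 : 0 < e by rewrite divr_gt0.
have [d /= d0 dP] : exists2 d : R, 0 < d & forall x : V, `|x| < d -> e < bump_cube 0 1 x.
  have /cvgrPdist_lt/(_ e e0) := cw (0 : V).
  move=> /nbhs_ballP[d /= d0 dP]; exists d => // x xd.
  have := dP x; rewrite -ball_normE /= sub0r normrN => /(_ xd).
  by rewrite ltr_norml /e => /andP[]; lra.
have l1 : loc_integrable (cst 1 : V -> R).
  by apply: continuous_loc_integrable; exact: cst_continuous.
have i1 := bump_cube_integrable (0 : V) ltr01 l1.
have mc : measurable (cube (0 : V) (d / 2) : set lebRn).
  by apply: cube_measurable; rewrite divr_ge0// ltW.
have d2 : 0 < d / 2 by rewrite divr_gt0.
have ic : mu.-integrable setT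
    (EFin \o (fun x => e * \1_(cube (0 : V) (d / 2)) x) : lebRn -> \bar R).
  apply: (@loc_integrable_mul _ _ (cst e) (\1_(cube (0 : V) (d / 2))) (d / 2) 1).
  - by apply: continuous_loc_integrable; exact: cst_continuous.
  - exact: (measurable_indic mc).
  - by move=> x; rewrite indicE; case: (_ \in _); rewrite ?normr1 ?normr0.
  - move=> x Mx; rewrite indicE memNset//.
    by rewrite /cube/= subr0; apply/negP; rewrite -ltNge.
apply: (@lt_le_trans _ _ (\int[mu]_x (e * \1_(cube (0 : V) (d / 2)) x))).
  rewrite (_ : Rintegral _ _ _ = \int[mu]_(x in cube (0 : V) (d / 2)) e).
    rewrite (Rintegral_cst mu mc) mulr_gt0// [ltRHS](congr1 fine (mu_cube 0 (ltW d2))).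
    by rewrite /= exprn_gt0// mulr_gt0.
  rewrite [RHS]Rintegral_mkcond; apply: eq_Rintegral => x _.
  by rewrite patchE indicE; case: ifP => _; rewrite ?mulr1 ?mulr0.
apply: (le_Rintegral measurableT ic i1) => x _; rewrite mul1r indicE.
have [/set_mem xd|_] := boolP (x \in _); last by rewrite mulr0 bump_cube_ge0.
rewrite mulr1 ltW// dP//; move: xd; rewrite /cube/= subr0; lra.
Qed.

Variables (F : V -> R) (G : V -> V) (g : V -> R) (q K lam : R).
Hypothesis cF : continuous F.
Hypothesis wG : is_weak_gradient F G.
Hypothesis mg : measurable_fun setT (g : lebRn -> R).
Hypothesis Gg : forall x i, `|G x 0 i| <= g x.
Hypothesis hq : n.+1%:R < q.
Hypothesis K1 : 1 <= K.
Hypothesis bK : forall t : R, bump t <= K.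
Hypothesis lam0 : 0 < lam.

(* Young's inequality in the form [g <= l + l `^ (1 - q) * tail_pow] for
   [lam <= l] replaces Hoelder's: it keeps only the values of g above lam, as
   the strong-type estimate requires. *)
Definition tail_pow (x : V) : R := if lam < g x then g x `^ q else 0.

Lemma tail_pow_ge0 x : 0 <= tail_pow x.
Proof. by rewrite /tail_pow; case: ifP => // _; exact: powR_ge0. Qed.

Lemma measurable_tail_pow : measurable_fun setT (tail_pow : lebRn -> R).
Proof.
have mb : measurable_fun setT ((fun x => lam < g x) : lebRn -> bool).
  exact: (measurable_fun_ltr (measurable_cst lam) mg).
have mp : measurable_fun setT ((fun x => g x `^ q) : lebRn -> R).
  exact: (measurableT_comp (measurable_powR q) mg).
exact: (measurable_fun_ifT mb mp (@measurable_cst _ _ lebRn R setT 0)).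
Qed.

Let q1 : 1 < q. Proof. by rewrite (le_lt_trans _ hq)// ler1n. Qed.

(** Where [g] exceeds [l], write it as its power [q] times its power [1 - q]; the latter exponent is
    negative, so that factor is largest at [l]. *)
Lemma le_tail_pow (l : R) x : lam <= l -> g x <= l + l `^ (1 - q) * tail_pow x.
Proof.
move=> ll; have l0 := lt_le_trans lam0 ll.
have [gl|lg] := leP (g x) l.
  by rewrite ler_wpDr// mulr_ge0 ?powR_ge0 ?tail_pow_ge0.
have gx0 := lt_trans l0 lg.
rewrite ler_wpDl ?(ltW l0)// /tail_pow (le_lt_trans ll lg).
rewrite -{1}[g x]powRr1 ?(ltW gx0)// -[X in g x `^ X](subrK q 1) powRD; last first.
  by rewrite (gt_eqF gx0) implybT.
rewrite ler_wpM2r ?powR_ge0// -(opprB q) !powRN lef_pV2 ?posrE ?powR_gt0//.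
by rewrite ge0_ler_powR ?nnegrE ?ltW// subr_gt0.
Qed.

(** Each of the n.+1 telescoping terms is at most the supremum of the test function times the
    integral of [g] over [cube c (3 * s)], a cube of side [6 * s]. Since [s <= 2 * s'], the supremum
    is at most the n-th power of [2 * K / s]. *)
Lemma bump_cube_mean_diff_le (c c' : V) (s s' l J : R) : 0 < s' -> s' <= s ->
  s <= 2 * s' -> `|c' - c| <= 2 * s -> lam <= l ->
  (\int[mu]_(x in cube c (3 * s)) (tail_pow x)%:E <= J%:E)%E ->
  `|bump_cube_mean F c s - bump_cube_mean F c' s'| <=
    n.+1%:R * ((2 * K / s) ^+ n * (l * (6 * s) ^+ n.+1 + l `^ (1 - q) * J)).
Proof.
move=> s'0 s's ss cc ll hJ; have s0 := lt_le_trans s'0 s's.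
have l0 := lt_le_trans lam0 ll.
have lF := continuous_loc_integrable cF.
rewrite (bump_cube_mean_diff c c' lF wG s0 s'0) normrN.
apply: le_trans (ler_norm_sum _ _ _) _.
set B := (2 * K / s) ^+ n; set Y := B * _.
have K0 : 0 <= K by rewrite (le_trans ler01).
have [s0' s'0' l0'] : [/\ 0 <= s, 0 <= s' & 0 <= l] by rewrite !ltW.
have B0 : 0 <= B by rewrite exprn_ge0// divr_ge0// mulr_ge0.
have -> : n.+1%:R * Y = \sum_(m < n.+1) Y by rewrite sumr_const card_ord mulr_natl.
apply: ler_sum => m _.
pose T := prodfn (telescope_fn c s c' s' m).
have tT : test_function T := telescope_fn_test_function c c' m s0 s'0.
have TB x : `|T x| <= B.
  apply: (le_trans (telescope_fn_bound bK c c' m x s'0 s's)).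
  rewrite lerXn2r ?nnegrE ?divr_ge0 ?mulr_ge0//.
  by rewrite ler_pdivrMr// mulrAC ler_pdivlMr// [leRHS]mulrAC mulrC ler_wpM2r.
have T0 x : ~ cube c (3 * s) x -> T x = 0 by exact: telescope_fn_support.
have [M [M0 MT]] := test_function_support tT.
have mT := continuous_measurable_lebRn (test_function_continuous tT).
have iGT := loc_integrable_mul (wG m).1 mT TB MT.
have mQ : measurable (cube c (3 * s) : set lebRn).
  by apply: cube_measurable; rewrite mulr_ge0.
have mh : measurable_fun (cube c (3 * s) : set lebRn) (EFin \o tail_pow : lebRn -> \bar R).
  apply/measurable_EFinP; apply: measurable_funTS; exact: measurable_tail_pow.
have h0 x : cube c (3 * s) x -> (0 <= (EFin \o tail_pow) x)%E.
  by move=> _; rewrite lee_fin tail_pow_ge0.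
pose a := B * l; pose b := B * l `^ (1 - q).
have a0 : 0 <= a by rewrite mulr_ge0.
have b0 : 0 <= b by rewrite mulr_ge0// powR_ge0.
rewrite -lee_fin.
apply: le_trans (_ : (\int[mu]_x `|(G x 0 m * T x)%:E|)%E <= _)%E.
  apply: (@le_trans _ _ (`|\int[mu]_x (G x 0 m * T x)%:E|%E)).
    rewrite /Rintegral -[leLHS]/(`|(fine _)%:E|%E) fineK//.
    exact: (integrable_fin_num measurableT iGT).
  have [mGT _] := integrableP _ _ _ iGT.
  exact: (@le_abse_integral _ lebRn R mu setT _ measurableT mGT).
apply: (@le_trans _ _ (\int[mu]_(x in cube c (3 * s)) (a%:E + b%:E * (tail_pow x)%:E))%E).
  rewrite [leRHS]integral_mkcond; apply: (@ge0_le_integral _ lebRn R mu setT measurableT).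
  - by move=> x _; exact: abse_ge0.
  - by case/integrableP : iGT => mi _; exact: (measurableT_comp (@abse_measurable R setT) mi).
  - apply/(measurable_restrictT _ mQ).
    exact: (emeasurable_funD (measurable_cst _) (emeasurable_funM (measurable_cst _) mh)).
  - move=> x _; rewrite patchE; case: ifPn => [_|/negP xQ].
      rewrite -EFinM -EFinD lee_fin normrM /a /b -mulrA -mulrDr mulrC.
      apply: ler_pM => //; apply: (le_trans (Gg x m)); exact: le_tail_pow.
    rewrite T0 ?mulr0 /= ?normr0; first exact: lexx.
    by move=> /mem_set.
rewrite (@ge0_integralD _ lebRn R mu _ mQ); last 4 first.
- by move=> x _; rewrite lee_fin.
- exact: measurable_cst.
- by move=> x Qx; rewrite mule_ge0//; exact: h0.
- exact: (emeasurable_funM (measurable_cst _) mh).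
have b0' : (0 <= b%:E)%E by rewrite lee_fin.
have s30 : 0 <= 3 * s by rewrite mulr_ge0.
apply: (@le_trans _ _ (a%:E * ((2 * (3 * s)) ^+ n.+1)%:E + b%:E * J%:E)%E).
  apply: leeD.
    by rewrite (integral_cst mu mQ) [X in (_ * X)%E](mu_cube c s30).
  rewrite [leLHS](@ge0_integralZl _ lebRn R mu _ mQ _ mh b%:E h0 b0').
  by rewrite lee_wpmul2l.
rewrite -!EFinM -EFinD lee_fin /Y /a /b mulrDr !mulrA.
by rewrite (_ : 2 * 3 = 6 :> R)// -natrM.
Qed.

Lemma bump_cube_mean_near (y : V) (e : R) : 0 < e ->
  exists s1 : R, 0 < s1 /\ forall s : R, 0 < s -> s <= s1 ->
    `|bump_cube_mean F y s - F y * bump_mass| <= e * bump_mass.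
Proof.
move=> e0; have lF := continuous_loc_integrable cF.
have l1 : loc_integrable (cst 1 : V -> R).
  by apply: continuous_loc_integrable; exact: cst_continuous.
have [d /= d0 dP] : exists2 d : R, 0 < d & forall x : V, `|x - y| < d -> `|F x - F y| <= e.
  have /cvgrPdist_le/(_ e e0) := @cF y.
  move=> /nbhs_ballP[d /= d0 dP]; exists d => // x xd.
  by have := dP x; rewrite -ball_normE /= !(distrC y x) => /(_ xd); rewrite distrC.
exists d; split=> // s s0 sd.
have iF := bump_cube_integrable y s0 lF.
have i1 := bump_cube_integrable y s0 l1.
have i2 := integrableZl measurableT (F y) i1.
have i3 := integrableZl measurableT e i1.
rewrite -(bump_cube_mass y s0) /bump_cube_mean -(RintegralZl _ measurableT i1).
rewrite -(RintegralB measurableT iF i2) -(RintegralZl _ measurableT i1).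
apply: (le_trans (le_normr_Rintegral measurableT (integrableB measurableT iF i2))).
apply: (le_Rintegral measurableT _ i3).
  exact: (integrable_norm (integrableB measurableT iF i2)).
move=> x _; rewrite /= mul1r -mulrBl normrM (ger0_norm (bump_cube_ge0 _ _ s0)).
have [sx|xs] := leP s `|x - y|; first by rewrite bump_cube_eq0// !mulr0.
by rewrite ler_wpM2r ?bump_cube_ge0// dP// (lt_le_trans xs).
Qed.

Variables (rho beta : R).
Hypothesis rho1 : 1 <= rho.
Hypothesis rhob : rho / 2 <= beta.
Hypothesis rhoq : rho `^ (1 - q) * 2 ^+ n <= beta.
Hypothesis beta1 : beta < 1.

Definition morrey_step : R := n.+1%:R * ((2 * K) ^+ n * (6 ^+ n.+1 + 1)).

Let K0 : 0 <= K. Proof. by rewrite (le_trans ler01). Qed.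

(** At scale r / 2^k Young's inequality is used at the level lam rho^k. Its two terms become lam r
    (rho / 2)^k and lam r (rho^(1-q) 2^n)^k up to constants collected in [morrey_step]. The integral
    of [tail_pow] is bounded the same way at all scales; raising the level compensates for the
    growth 2^(k n) this causes. *)
Lemma bump_cube_mean_step (y y' : V) (r s s' : R) k : 0 < r -> s = r / 2 ^+ k ->
  0 < s' -> s' <= s -> s <= 2 * s' -> `|y' - y| <= 2 * s ->
  (\int[mu]_(x in cube y (3 * s)) (tail_pow x)%:E <= (lam `^ q * r ^+ n.+1)%:E)%E ->
  `|bump_cube_mean F y s - bump_cube_mean F y' s'| <=
    morrey_step * (lam * r) * beta ^+ k.
Proof.
move=> r0 sE s'0 s's ss yy hJ.
have p2 : 0 < 2 ^+ k :> R by rewrite exprn_gt0.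
have s0 := lt_le_trans s'0 s's.
have rk1 : 1 <= rho ^+ k by rewrite exprn_ege1.
have ll : lam <= lam * rho ^+ k by rewrite ler_peMr// ltW.
apply: (le_trans (bump_cube_mean_diff_le s'0 s's ss yy ll hJ)).
have b0 : 0 <= beta by rewrite (le_trans _ rhob)// divr_ge0// (le_trans ler01).
rewrite expr_div_n /morrey_step -!mulrA ler_wpM2l// ler_wpM2l ?exprn_ge0 ?mulr_ge0//.
rewrite [leLHS]mulrDr [leRHS]mulrDl [X in _ <= _ + X]mul1r; apply: lerD.
  rewrite exprMn [s ^+ n.+1]exprSr.
  have sn : s ^+ n != 0 by rewrite expf_neq0// gt_eqF.
  have e1 : (s ^+ n)^-1 * s ^+ n = 1 by rewrite mulVf.
  set S := 6 ^+ _; set N := s ^+ n in sn e1 *; set X := rho ^+ k.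
  have -> : N^-1 * (lam * (X * (S * (N * s)))) = (N^-1 * N) * (S * (lam * (X * s))) by lra.
  rewrite e1 mul1r {e1 sn}/S {}/X {N}.
  rewrite ler_wpM2l ?exprn_ge0// ler_wpM2l ?(ltW lam0)// sE mulrCA ler_wpM2l ?(ltW r0)//.
  by rewrite -expr_div_n lerXn2r ?nnegrE// divr_ge0// (le_trans ler01).
have rho0 : 0 < rho by rewrite (lt_le_trans ltr01).
rewrite powRM ?(ltW lam0) ?exprn_ge0 ?(ltW rho0)//.
have -> : lam `^ (1 - q) = lam * (lam `^ q)^-1.
  by rewrite powRD ?(gt_eqF lam0) ?implybT// powRr1 ?(ltW lam0)// powRN.
have -> : (rho ^+ k) `^ (1 - q) = (rho `^ (1 - q)) ^+ k.
  by rewrite -(powR_mulrn k (ltW rho0)) -(powR_mulrn k (powR_ge0 rho (1 - q))) -!powRrM mulrC.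
have lq : lam `^ q != 0 by rewrite gt_eqF// powR_gt0.
have [A0 rA] : 0 <= rho `^ (1 - q) /\ rho `^ (1 - q) * 2 ^+ n <= beta by rewrite powR_ge0.
move: (rho `^ (1 - q)) A0 rA => A A0 rA.
have -> : (s ^+ n)^-1 * (lam * (lam `^ q)^-1 * A ^+ k * (lam `^ q * r ^+ n.+1)) =
    lam * (r * (A * 2 ^+ n) ^+ k).
  rewrite sE expr_div_n invf_div exprMn -!exprM (mulnC k n) [r ^+ n.+1]exprSr.
  have rn : r ^+ n != 0 by rewrite expf_neq0// gt_eqF.
  set P := 2 ^+ _; set L := lam `^ q in lq *; set N := r ^+ n in rn *; set X := A ^+ k.
  have e1 : N^-1 * N = 1 by rewrite mulVf.
  have e2 : L^-1 * L = 1 by rewrite mulVf.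
  have -> : P / N * (lam / L * X * (L * (N * r))) =
    (N^-1 * N) * (L^-1 * L) * (lam * (r * (X * P))) by lra.
  by rewrite e1 e2 !mul1r.
rewrite ler_wpM2l ?(ltW lam0)// ler_wpM2l ?(ltW r0)//.
by rewrite lerXn2r ?nnegrE// mulr_ge0 ?exprn_ge0.
Qed.

Lemma bump_cube_mean_chain (y : V) (r : R) k : 0 < r ->
  (\int[mu]_(x in cube y (3 * r)) (tail_pow x)%:E <= (lam `^ q * r ^+ n.+1)%:E)%E ->
  `|bump_cube_mean F y r - bump_cube_mean F y (r / 2 ^+ k)| <=
    morrey_step * (lam * r) * \sum_(j < k) beta ^+ j.
Proof.
move=> r0 hJ; elim: k => [|k ih].
  by rewrite expr0 divr1 subrr normr0 big_ord0 mulr0.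
have p2 : 0 < 2 ^+ k :> R by rewrite exprn_gt0.
have s0 : 0 < r / 2 ^+ k by rewrite divr_gt0.
have e : r / 2 ^+ k.+1 = r / 2 ^+ k / 2 by rewrite exprSr invfM mulrA.
rewrite big_ord_recr /= mulrDr; apply: (le_trans (ler_distD (bump_cube_mean F y (r / 2 ^+ k)) _ _)).
apply: lerD ih _; rewrite e.
have [h1 h2 h3 h4] : [/\ 0 < r / 2 ^+ k / 2, r / 2 ^+ k / 2 <= r / 2 ^+ k,
    r / 2 ^+ k <= 2 * (r / 2 ^+ k / 2) & `|y - y| <= 2 * (r / 2 ^+ k)].
  by rewrite subrr normr0; move: (r / 2 ^+ k) s0 => t t0; split; lra.
apply: (bump_cube_mean_step r0 erefl h1 h2 h3 h4).
apply: le_trans hJ; have rr : r / 2 ^+ k <= r.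
  by rewrite ler_pdivrMr// ler_peMr ?(ltW r0)// exprn_ege1// ler1n.
apply: (@ge0_subset_integral _ lebRn R mu).
- by apply: cube_measurable; lra.
- by apply: cube_measurable; lra.
- by apply/measurable_EFinP; apply: measurable_funTS; exact: measurable_tail_pow.
- by move=> x _; rewrite lee_fin tail_pow_ge0.
- by move=> x; rewrite /cube/= => h; lra.
Qed.

Lemma morrey_step_ge0 : 0 <= morrey_step.
Proof. by rewrite mulr_ge0// mulr_ge0 ?addr_ge0 ?exprn_ge0 ?mulr_ge0. Qed.

(** The means around y tend to a multiple of [F y], with errors summed by a geometric series of
    ratio [beta]; likewise around z. Two such series and one comparison of the cubes of radius r
    around y and z give the factor [1 + 2 / (1 - beta)]. All cubes used lie in [cube x (4 * r)]. *)
Lemma morrey_aux (x y z : V) (r : R) : 0 < r -> `|y - x| <= r -> `|z - x| <= r ->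
  (\int[mu]_(x in cube x (4 * r)) (tail_pow x)%:E <= (lam `^ q * r ^+ n.+1)%:E)%E ->
  `|F y - F z| * bump_mass <= morrey_step * (1 + 2 / (1 - beta)) * (lam * r).
Proof.
move=> r0 yx zx hJ.
have b0 : 0 <= beta by rewrite (le_trans _ rhob)// divr_ge0// (le_trans ler01).
have sub w : `|w - x| <= r ->
    (\int[mu]_(x in cube w (3 * r)) (tail_pow x)%:E <= (lam `^ q * r ^+ n.+1)%:E)%E.
  move=> wx; apply: le_trans hJ; apply: (@ge0_subset_integral _ lebRn R mu).
  - by apply: cube_measurable; lra.
  - by apply: cube_measurable; lra.
  - by apply/measurable_EFinP; apply: measurable_funTS; exact: measurable_tail_pow.
  - by move=> u _; rewrite lee_fin tail_pow_ge0.
  - move=> u; rewrite /cube/= => h.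
    by have := ler_normD (u - w) (w - x); rewrite addrA subrK; lra.
have m0 := bump_mass_gt0.
have S0 := morrey_step_ge0.
have lr0 : 0 <= lam * r by rewrite mulr_ge0 ?ltW.
have near w e : `|w - x| <= r -> 0 < e ->
    `|F w * bump_mass - bump_cube_mean F w r| <=
      e + morrey_step * (lam * r) * (1 - beta)^-1.
  move=> wx e0; have em0 : 0 < e / bump_mass by rewrite divr_gt0.
  have [s1 [s10 s1P]] := bump_cube_mean_near w em0.
  have [k ks] : exists k, r / 2 ^+ k <= s1.
    have /cvgrPdist_le/(_ s1 s10)[k _ /(_ k (leqnn k))] :
        (fun k => r * (1 / 2) ^+ k) @ \oo --> (0 : R).
      by apply: cvg_geometric; rewrite ger0_norm; lra.
    rewrite sub0r normrN => h; exists k; apply: le_trans h.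
    by rewrite (le_trans _ (ler_norm _))// expr_div_n expr1n mul1r.
  have sk0 : 0 < r / 2 ^+ k by rewrite divr_gt0// exprn_gt0.
  have := s1P _ sk0 ks; rewrite divfK ?gt_eqF// => h1.
  have h2 := bump_cube_mean_chain k r0 (sub w wx).
  have h3 : \sum_(j < k) beta ^+ j <= (1 - beta)^-1.
    rewrite -[leRHS]mul1r ler_pdivlMr ?subr_gt0// mulrC.
    by rewrite -opprB mulNr -subrX1 opprB gerBl exprn_ge0.
  apply: (le_trans (ler_distD (bump_cube_mean F w (r / 2 ^+ k)) _ _)).
  rewrite [X in X + _]distrC [X in _ + X]distrC; apply: lerD h1 _.
  by apply: (le_trans h2); rewrite ler_wpM2l// mulr_ge0.
have step : `|bump_cube_mean F y r - bump_cube_mean F z r| <= morrey_step * (lam * r).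
  have zy : `|z - y| <= 2 * r.
    by have := ler_normD (z - x) (x - y); rewrite addrA subrK (distrC x y); lra.
  have r1 : r = r / 2 ^+ 0 by rewrite expr0 divr1.
  have r2 : r <= 2 * r by lra.
  have := @bump_cube_mean_step y z r r r 0 r0 r1 r0 (lexx r) r2 zy (sub y yx).
  by rewrite expr0 mulr1.
apply/ler_addgt0Pr => e e0.
have e20 : 0 < e / 2 by rewrite divr_gt0.
have hy := near y _ yx e20; have hz := near z _ zx e20.
rewrite -{1}(gtr0_norm m0) -normrM mulrBl.
set a := F y * _ in hy *; set b := F z * _ in hz *.
set A := bump_cube_mean F y r in hy step *; set B := bump_cube_mean F z r in hz step *.
clearbody a b A B.
apply: (le_trans (ler_distD A _ _)).
have := ler_distD B A b; rewrite (distrC B b).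
set Y := morrey_step * (lam * r) in hy hz step *.
have -> : morrey_step * (1 + 2 / (1 - beta)) * (lam * r) = Y + 2 * (Y * (1 - beta)^-1).
  by rewrite /Y; lra.
by lra.
Qed.

End morrey.

Lemma morrey (R : realType) (n : nat) (q : R) : n.+1%:R < q -> exists C : R, 0 < C /\
  forall (F : 'rV[R]_n.+1 -> R) (G : 'rV[R]_n.+1 -> 'rV[R]_n.+1) (g : 'rV[R]_n.+1 -> R)
    (lam : R), continuous F -> is_weak_gradient F G ->
  measurable_fun setT (g : lebRn R n -> R) -> 
  (forall x i, `|G x 0 i| <= g x) -> 0 < lam ->
  forall (x y z : 'rV[R]_n.+1) (r : R), 0 < r -> `|y - x| <= r -> `|z - x| <= r ->
  (\int[@lebesgue_measure_rV R n]_(x in cube x (4 * r)) (tail_pow g q lam x)%:E <=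
    (lam `^ q * r ^+ n.+1)%:E)%E ->
  `|F y - F z| <= C * (lam * r).
Proof.
move=> hq; have [K [K1 bK]] := @bump_bounded R.
have q1 : 1 < q by rewrite (le_lt_trans _ hq)// ler1n.
have m0 := @bump_mass_gt0 R n.
(* With rho = 2^th, the two ratios are 2^(th - 1) and 2^(n - th (q - 1)). Both are below 1 when th
   lies strictly between n / (q - 1) and 1, an interval that is nonempty since q > n + 1; the
   midpoint is taken. *)
pose th : R := (n%:R / (q - 1) + 1) / 2.
have nq : n%:R / (q - 1) < 1.
  by rewrite ltr_pdivrMr ?subr_gt0// mul1r ltrBrDr natr1.
have nq0 : 0 <= n%:R / (q - 1) by rewrite divr_ge0// subr_ge0 ltW.
have th1 : th < 1 by rewrite /th; lra.
have th2 : n%:R / (q - 1) < th by rewrite /th; lra.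
have lt_pow2 (x y : R) : x < y -> (2 : R) `^ x < 2 `^ y.
  by move=> xy; rewrite /powR pnatr_eq0 /= ltr_expR ltr_pM2r// ln_gt0// ltr1n.
pose rho : R := 2 `^ th.
have rho1 : 1 <= rho by rewrite -(powRr0 2) ler_powR ?ler1n//; lra.
have rho2 : rho / 2 < 1.
  by rewrite ltr_pdivrMr// mul1r -[ltRHS]powRr1// lt_pow2.
have rhoq : rho `^ (1 - q) * 2 ^+ n < 1.
  rewrite -powRrM -powR_mulrn// -powRD ?pnatr_eq0 ?implybT//.
  rewrite -[ltRHS](powRr0 2) lt_pow2//.
  by move: th2; rewrite ltr_pdivrMr ?subr_gt0//; lra.
pose beta := Num.max (rho / 2) (rho `^ (1 - q) * 2 ^+ n).
have b1 : beta < 1 by rewrite gt_max rho2.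
pose C1 := morrey_step n K * (1 + 2 / (1 - beta)).
have C10 : 0 <= C1.
  by rewrite mulr_ge0 ?morrey_step_ge0// addr_ge0// divr_ge0// subr_ge0 ltW.
exists ((C1 + 1) / bump_mass R n); split; first by rewrite divr_gt0// ltr_wpDl.
move=> F G g lam cF wG mg Gg lam0 x y z r r0 yx zx hJ.
rewrite mulrAC ler_pdivlMr//.
have := @morrey_aux R n F G g q K lam cF wG mg Gg hq K1 bK lam0 rho beta rho1 _ _ b1
  x y z r r0 yx zx hJ.
move=> h; apply: le_trans (h _ _) _; rewrite ?le_max ?lexx ?orbT//.
by rewrite -/C1 ler_wpM2r ?mulr_ge0 ?(ltW lam0) ?(ltW r0)// lerDl.
Qed.

(** * The sharp maximal function *)

(** Greedy selection by decreasing radius, as an induction on the list sorted by increasing radius: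
    the head has the smallest radius, so it is dropped if it meets a selected set and added
    otherwise. *)
Lemma finite_vitali (T : Type) (R : realType) (I : choiceType) (B : I -> set T)
    (r : I -> R) (s : seq I) : (forall i, B i !=set0) ->
  exists D : seq I, [/\ uniq D, {subset D <= s}, trivIset [set` D] B &
    forall i, i \in s -> exists j, [/\ j \in D, B i `&` B j !=set0 & r i <= r j]].
Proof.
move=> B0; pose le_r i j := r i <= r j.
suff H t : sorted le_r t ->
    exists D : seq I, [/\ uniq D, {subset D <= t}, trivIset [set` D] B &
    forall i, i \in t -> exists j, [/\ j \in D, B i `&` B j !=set0 & r i <= r j]].
  have [|D [uD Ds tD DP]] := H (sort le_r s).
    by apply: sort_sorted => i j; exact: le_total.
  exists D; split=> //; first by move=> i /Ds; rewrite mem_sort.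
  by move=> i si; apply: DP; rewrite mem_sort.
elim: t => [_|i t ih]; first by exists [::]; split=> //; exact: trivIset_set0.
rewrite /= (path_sortedE (fun _ _ _ => @le_trans _ _ _ _ _)).
move=> /andP[/allP it st]; have [D [uD Dt tD DP]] := ih st.
have [[j [Dj ij]]|H] := pselect (exists j, j \in D /\ B i `&` B j !=set0).
  exists D; split=> // [k /Dt kt|k]; first by rewrite inE kt orbT.
  rewrite inE => /predU1P[->|]; last exact: DP.
  by exists j; split=> //; apply: it; exact: Dt.
have Hi k : k \in D -> B i `&` B k = set0.
  move=> Dk; apply/seteqP; split=> // x Bx; apply: H; exists k; split=> //.
  by exists x.
exists (i :: D); split.
- rewrite /= uD andbT; apply/negP => iD; have [x Bx] := B0 i.
  by have := Hi i iD => /seteqP[+ _] => /(_ x); apply.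
- by move=> k; rewrite !inE => /predU1P[->|/Dt ->]; rewrite ?eqxx ?orbT.
- move=> j k /=; rewrite !inE => /predU1P[->|Dj] /predU1P[->|Dk] //.
  + by rewrite (Hi k Dk) => -[].
  + by rewrite setIC (Hi j Dj) => -[].
  + exact: tD.
- move=> k; rewrite inE => /predU1P[->|/DP[j [Dj kj rkj]]].
    by exists i; rewrite inE eqxx setIid.
  by exists j; rewrite inE Dj orbT.
Qed.

(** * Measurability and a covering estimate *)

Section sharp.
Variables (R : realType) (n : nat).
Local Notation V := 'rV[R]_n.+1.
Local Notation lebRn := (lebRn R n).
Local Notation mu := (@lebesgue_measure_rV R n).
Implicit Types (S : set V) (f : V -> R) (x y z : V).

Lemma sharp_ge0 S f x : (0 <= sharp S f x)%E.
Proof. by apply: ereal_sup_ubound; left. Qed.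

Lemma sharp_ge S f x y z (r : R) : 0 < r -> cube x r y -> cube x r z -> S y -> S z ->
  ((`|f y - f z| / r)%:E <= sharp S f x)%E.
Proof.
by move=> r0 xy xz Sy Sz; apply: ereal_sup_ubound; right; exists r, y, z.
Qed.

Lemma sharp_le S f x y z (r : R) : 0 < r -> cube x r y -> cube x r z -> S y -> S z ->
  ((`|f y - f z|)%:E <= r%:E * sharp S f x)%E.
Proof.
move=> r0 xy xz Sy Sz; rewrite -lee_pdivrMl// -EFinM mulrC.
exact: sharp_ge.
Qed.

Lemma lt_sharp S f x (a : R) : 0 <= a -> (a%:E < sharp S f x)%E ->
  exists r y z, [/\ 0 < r, cube x r y /\ S y, cube x r z /\ S z & a * r < `|f y - f z|].
Proof.
move=> a0 /ereal_sup_gt[_ [->|[r [y [z [r0 yS zS ->]]]]]].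
  by rewrite lte_fin ltNge a0.
by rewrite lte_fin ltr_pdivlMr// => h; exists r, y, z.
Qed.

Lemma sharp_ub S f x (a : \bar R) : (0 <= a)%E ->
  (forall r y z, 0 < r -> cube x r y -> cube x r z -> S y -> S z ->
    (`|f y - f z|%:E <= r%:E * a)%E) -> (sharp S f x <= a)%E.
Proof.
move=> a0 H; apply: ge_ereal_sup => _ [->//|[r [y [z [r0 [xy Sy] [xz Sz] ->]]]]].
by rewrite mulrC EFinM lee_pdivrMl//; exact: H.
Qed.

(** The sets where it exceeds [a >= 0] are open: a pair y, z that is a strict witness at x with
    radius r remains one at nearby points with a slightly larger radius. *)
Lemma measurable_sharp S f : measurable_fun setT (sharp S f : lebRn -> \bar R).
Proof.
apply: (measurability _ (ErealGenOInfty.measurableE R)) => // _ [_ [a ->] <-].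
rewrite setTI preimage_itvoy.
have [a0|a0] := ltP a 0.
  rewrite (_ : [set _ | _] = setT)//; apply/seteqP; split=> // x _ /=.
  by rewrite (lt_le_trans _ (sharp_ge0 S f x))// lte_fin.
apply: open_measurable_lebRn; rewrite openE => x /= ax.
have [r [y [z [r0 [xy Sy] [xz Sz] h]]]] := lt_sharp a0 ax.
have [e e0 he] : exists2 e : R, 0 < e & a * (r + e) < `|f y - f z|.
  exists ((`|f y - f z| - a * r) / 2 / (a + 1)).
    by rewrite divr_gt0 ?ltr_wpDl// divr_gt0// subr_gt0.
  rewrite mulrDr -ltrBrDl mulrA ltr_pdivrMr ?ltr_wpDl//.
  by move: h; rewrite -subr_gt0; set d := _ - _ => d0; nra.
apply/nbhs_ballP; exists e => //= x' xx'.
have xe : `|x - x'| < e by move: xx'; rewrite -ball_normE.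
have re : 0 < r + e by rewrite addr_gt0.
apply: (@lt_le_trans _ _ (`|f y - f z| / (r + e))%:E).
  by rewrite lte_fin ltr_pdivlMr.
apply: sharp_ge => //; rewrite /cube/=.
  by have := ler_normD (y - x) (x - x'); rewrite addrA subrK; move: xy; rewrite /cube/=; lra.
by have := ler_normD (z - x) (x - x'); rewrite addrA subrK; move: xz; rewrite /cube/=; lra.
Qed.

(** The cubes are replaced by rational ones, so that E lies in an increasing union of finite unions.
    The finite Vitali lemma bounds each of these uniformly, and continuity from below concludes. *)
Lemma cube_vitali_estimate (h : V -> \bar R) (a : R) (E : set V) :
  measurable_fun setT (h : lebRn -> \bar R) -> (forall x, (0 <= h x)%E) -> 0 < a ->
  (forall x, E x -> exists r : R, 0 < r /\
    ((a * r ^+ n.+1)%:E <= \int[mu]_(y in cube x (4 * r)) h y)%E) ->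
  (leb_outer E <= ((100 ^+ n.+1 / a)%:E * \int[mu]_y h y))%E.
Proof.
move=> mh h0 a0 Er; pose I := ('rV[rat]_n.+1 * rat)%type.
pose c (i : I) : V := map_mx ratr i.1.
pose r (i : I) : R := ratr i.2.
pose P (i : I) := (0 < r i) /\
  ((a * (r i / 2) ^+ n.+1)%:E <= \int[mu]_(y in cube (c i) (8 * r i)) h y)%E.
have mc x (t : R) : measurable (cube x t : set lebRn) by exact: cube_measurable.
have sub A B : measurable (A : set lebRn) -> measurable (B : set lebRn) -> A `<=` B ->
    (\int[mu]_(y in A) h y <= \int[mu]_(y in B) h y)%E.
  move=> mA mB AB; apply: (@ge0_subset_integral _ lebRn R mu _ _ mA mB _ _ _ AB).
    exact: measurable_funTS.
  by move=> x _; exact: h0.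
have EP x : E x -> exists i, P i /\ cube (c i) (r i) x.
  move=> /Er[t [t0 ht]].
  (* A rational radius between t and 2t and a rational center within t of x: the cube of radius 8 q1
     then contains [cube x (4 * t)], while q1 / 2 < t keeps the lower bound of the integral. *)
  have [q1] := @rat_in_itvoo R t (2 * t) ltac:(lra).
  rewrite in_itv/= => /andP[tq qt]; have [q2 q2x] := rat_rV_dense x t0.
  exists (q2, q1); rewrite /P /c /r /=.
  have ? : `|x - map_mx ratr q2| < t by rewrite distrC.
  split; last by rewrite /cube/=; lra.
  split; first by lra.
  apply: (@le_trans _ _ (a * t ^+ n.+1)%:E).
    by rewrite lee_fin ler_wpM2l ?(ltW a0)// lerXn2r ?nnegrE//; lra.
  apply: (le_trans ht); apply: sub => // y; rewrite /cube/= => yx.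
  by have := ler_normD (y - x) (x - map_mx ratr q2); rewrite addrA subrK; lra.
(* The admissible rational cubes with code below [N]; their unions [U N] increase with [N]. *)
pose s N := [seq i <- pmap (@pickle_inv I) (iota 0 N) | `[< P i >]].
pose U N : set V := \bigcup_(i in [set` s N]) cube (c i) (r i).
have mU N : measurable (U N : set lebRn).
  apply: (@fin_bigcup_measurable _ lebRn) => //; exact: finite_seq.
have ndU : nondecreasing_seq U.
  move=> N M NM; apply/subsetPset; apply: bigcup_subset => i /=.
  rewrite !mem_filter => /andP[->/=]; rewrite -(subnKC NM) iotaD pmap_cat mem_cat => ->.
  by [].
have UX N : (mu (U N) <= (100 ^+ n.+1 / a)%:E * \int[mu]_y h y)%E.
  (* The absolute value keeps the cube nonempty for every index, as [finite_vitali] requires;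
     admissible radii are positive. *)
  have B0 (i : I) : cube (c i) (8 * `|r i|) !=set0.
    by exists (c i); rewrite /cube/= subrr normr0 mulr_ge0.
  have [D [uD Ds tD DP]] := finite_vitali r (s N) B0.
  have PD j : j \in D -> P j by move=> /Ds; rewrite mem_filter => /andP[/asboolP].
  (* If the cubes of radii 8 r_i and 8 r_j meet and r_i <= r_j, then [cube (c i) (r i)] lies within
     17 r_j of the center of the other, so 25 suffices. The volume of the cube of radius 25 r_j is
     100^(n+1) times that of a cube of side r_j / 2. *)
  apply: (@le_trans _ _ (mu (\bigcup_(j in [set` D]) cube (c j) (25 * r j)))).
    apply: le_leb_outer => x [i /= si xi]; have [j [Dj [z [zi zj]] ij]] := DP i si.
    have [rj0 _] := PD j Dj.
    have [ri0 _] : P i by move: si; rewrite mem_filter => /andP[/asboolP].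
    exists j => //; move: zi zj xi; rewrite /cube/= !gtr0_norm//.
    have := ler_normD (x - c i) (c i - z); have := ler_normD (x - z) (z - c j).
    by rewrite ![_ + (_ - _)]addrA !subrK (distrC (c i) z); lra.
  apply: (@le_trans _ _ (\sum_(j <- D) mu (cube (c j) (25 * r j)))%E).
    elim: D {uD Ds tD DP PD} => [|j D ih].
      by rewrite big_nil (_ : \bigcup_(j in _) _ = set0) ?measure0//; apply/seteqP; split=> x // [].
    rewrite big_cons; apply: (@le_trans _ _ (mu (cube (c j) (25 * r j)) +
        mu (\bigcup_(j in [set` D]) cube (c j) (25 * r j)))%E); last exact: leeD2l.
    apply: le_trans (outer_measureU2 _ _ _); apply: le_leb_outer => x [k /=].
    by rewrite inE => /predU1P[->|Dk] xk; [left|right; exists k].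
  apply: (@le_trans _ _ (\sum_(j <- D) ((100 ^+ n.+1 / a)%:E *
      \int[mu]_(y in cube (c j) (8 * `|r j|)) h y))%E).
    rewrite big_seq [leRHS]big_seq; apply: lee_sum => j Dj; have [rj0 hj] := PD j Dj.
    have rj25 : 0 <= 25 * r j by rewrite mulr_ge0// ltW.
    rewrite [leLHS](mu_cube (c j) rj25) (gtr0_norm rj0).
    apply: (@le_trans _ _ ((100 ^+ n.+1 / a)%:E * (a * (r j / 2) ^+ n.+1)%:E)%E); last first.
      by rewrite lee_wpmul2l// lee_fin divr_ge0 ?exprn_ge0 ?(ltW a0).
    rewrite -EFinM lee_fin [leRHS]mulrA divfK ?gt_eqF// -exprMn.
    by rewrite lerXn2r ?nnegrE//; lra.
  rewrite -ge0_sume_distrr; last by move=> j _; apply: integral_ge0 => y _.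
  rewrite lee_wpmul2l ?lee_fin ?divr_ge0 ?exprn_ge0 ?(ltW a0)//.
  have := @ge0_integral_bigsetU _ lebRn R mu I (fun j => cube (c j) (8 * `|r j|)) h D
    (fun j => mc _ _) uD tD _ _.
  move=> <-; last 2 first.
  - exact: measurable_funTS.
  - by move=> x _; exact: h0.
  apply: sub => //; apply: bigsetU_measurable => j _; exact: mc.
apply: (@le_trans _ _ (mu (\bigcup_N U N))).
  apply: le_leb_outer => x /EP[i [Pi xi]]; exists (pickle i).+1 => //; exists i => //=.
  rewrite mem_filter; apply/andP; split; first exact/asboolP.
  rewrite mem_pmap; apply/mapP; exists (pickle i); last by rewrite pickleK_inv.
  by rewrite mem_iota /= add0n ltnSn.
have mUU : measurable (\bigcup_N U N : set lebRn) by exact: bigcup_measurable.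
have := @nondecreasing_cvg_mu _ lebRn R mu U mU mUU ndU => cv.
rewrite -(cvg_lim _ cv)//; apply: lime_le; first by apply/cvg_ex; eexists; exact: cv.
by apply: nearW => N; exact: UX.
Qed.

End sharp.

(** * Dyadic summation and the strong-type bound *)

Lemma nneseries_ge_term (R : realType) (u : (\bar R)^nat) k :
  (forall n, (0 <= u n)%E) -> (u k <= \sum_(n <oo) u n)%E.
Proof.
move=> u0; apply: le_trans (@nneseries_lim_ge R u xpredT 0%N k.+1 (fun n _ _ => u0 n)).
by rewrite big_nat_recr//= leeDr// sume_ge0.
Qed.

(** The superlevel set of [c * 2 ^+ k], weighted by the p-th power of the next dyadic level. *)
Definition layer (R : realType) (p c : R) (t : \bar R) (k : nat) : \bar R :=
  if ((c * 2 ^+ k)%:E < t)%E then ((c * 2 ^+ k.+1) `^ p)%:E else 0%E.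

(** For finite t a single term suffices, that of the dyadic interval containing t. For infinite t
    the terms are unbounded. *)
Lemma dyadic_layers (R : realType) (p c : R) (t : \bar R) : 0 < p -> 0 < c ->
  (c%:E < t)%E -> (t `^ p <= \sum_(k <oo) layer p c t k)%E.
Proof.
move=> p0 c0 ct.
have u0 k : (0 <= layer p c t k)%E by rewrite /layer; case: ifP => // _; rewrite lee_fin powR_ge0.
have c2 k : 0 <= c * 2 ^+ k by rewrite mulr_ge0 ?exprn_ge0 ?ltW.
have big (A : R) : exists k, A <= c * 2 ^+ k.
  exists (Num.truncn `|A / c|).+1; rewrite mulrC -ler_pdivrMr//.
  rewrite (le_trans (ler_norm _))// (le_trans (ltW (truncnS_gt _)))// -natrX ler_nat.
  exact: ltnW (ltn_expl _ _).
case: t ct u0 => [t|_ u0|//]; last first.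
  rewrite poweRyr ?gt_eqF//; rewrite leye_eq; apply/eqP/eqyP => A A0.
  have [k Ak] := big (A `^ p^-1).
  apply: le_trans (nneseries_ge_term k u0); rewrite /layer ltry lee_fin.
  have -> : A = (A `^ p^-1) `^ p by rewrite -powRrM mulVf ?lt0r_neq0// powRr1 ?ltW.
  rewrite ge0_ler_powR ?nnegrE ?(ltW p0) ?powR_ge0//.
  by rewrite (le_trans Ak)// exprS mulrCA ler_peMl// ler1n.
rewrite lte_fin => ct u0; rewrite poweR_EFin.
case: (ex_minnP (big t)) => k tk kmin.
have {kmin} [j kj tj] : exists2 j, k = j.+1 & c * 2 ^+ j < t.
  case: k tk kmin => [|j _ kmin]; first by rewrite expr0 mulr1 leNgt ct.
  by exists j => //; rewrite ltNge; apply/negP => /kmin; rewrite ltnn.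
apply: le_trans (nneseries_ge_term j u0); rewrite /layer lte_fin tj lee_fin -kj.
by rewrite ge0_ler_powR ?nnegrE ?(ltW p0) ?(le_trans (ltW c0) (ltW ct)).
Qed.

(** A geometric sum of ratio 2^b whose last term is below t^b. The sum is left multiplied by 2^b -
    1. *)
Lemma dyadic_powR_sum (R : realType) (b c t : R) K : 0 < b -> 0 < c ->
  \sum_(k < K) (if c * 2 ^+ k < t then (c * 2 ^+ k) `^ b else 0) * (2 `^ b - 1) <=
  2 `^ b * t `^ b.
Proof.
move=> b0 c0; elim: K => [|K ih]; first by rewrite big_ord0 mulr_ge0 ?powR_ge0.
rewrite big_ord_recr/=; case: ifPn => [Kt|_]; last by rewrite mul0r addr0.
have cb k : (c * 2 ^+ k) `^ b = c `^ b * (2 `^ b) ^+ k.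
  rewrite powRM ?exprn_ge0 ?(ltW c0)//; congr (_ * _).
  rewrite -(powR_mulrn k (powR_ge0 2 b)) -(powR_mulrn k (ler0n R 2)).
  by rewrite -!powRrM mulrC.
have -> : \sum_(k < K) (if c * 2 ^+ k < t then (c * 2 ^+ k) `^ b else 0) * (2 `^ b - 1)
   = c `^ b * ((2 `^ b) ^+ K - 1).
  rewrite subrX1 mulr_sumr mulr_sumr; apply: eq_bigr => k _.
  rewrite ifT ?cb; first by rewrite -mulrA; congr (_ * _); rewrite mulrC.
  rewrite (lt_trans _ Kt)// ltr_pM2l// ltr_eXn2l// ltr1n//.
apply: (@le_trans _ _ (2 `^ b * (c * 2 ^+ K) `^ b)).
  rewrite cb; set X := _ ^+ K; set B := 2 `^ b.
  have : 0 <= c `^ b by exact: powR_ge0.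
  by lra.
rewrite ler_wpM2l ?powR_ge0// ge0_ler_powR ?nnegrE ?(ltW b0) ?(ltW Kt)//.
  by rewrite mulr_ge0 ?exprn_ge0 ?ltW.
by rewrite (le_trans _ (ltW Kt))// mulr_ge0 ?exprn_ge0 ?ltW.
Qed.

(** Where the sharp function exceeds [C * lam], the hypothesis of Morrey's inequality fails on some
    cube; this failure is the lower bound of the integral that [cube_vitali_estimate] needs. *)
Lemma sharp_weak_type (R : realType) (n : nat) (q : R) : n.+1%:R < q ->
  exists C : R, 0 < C /\
  forall (F : 'rV[R]_n.+1 -> R) (G : 'rV[R]_n.+1 -> 'rV[R]_n.+1) (g : 'rV[R]_n.+1 -> R),
  continuous F -> is_weak_gradient F G ->
  measurable_fun setT (g : lebRn R n -> R) -> (forall x i, `|G x 0 i| <= g x) ->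
  forall lam : R, 0 < lam ->
  (leb_outer [set x | (C * lam)%:E < sharp setT F x] <=
   (100 ^+ n.+1 / lam `^ q)%:E *
     \int[@lebesgue_measure_rV R n]_x (tail_pow g q lam x)%:E)%E.
Proof.
move=> hq; have [C [C0 CP]] := @morrey R n q hq.
exists C; split=> // F G g cF wG mg Gg lam lam0.
apply: cube_vitali_estimate.
- by apply/measurable_EFinP; exact: measurable_tail_pow.
- by move=> x; rewrite lee_fin tail_pow_ge0.
- by rewrite powR_gt0.
- move=> x /= hx; have [|r [y [z [r0 [xy _] [xz _] h]]]] := lt_sharp _ hx.
    by rewrite mulr_ge0 ?ltW.
  exists r; split=> //; rewrite leNgt; apply/negP => /ltW hI.
  by have := CP F G g lam cF wG mg Gg lam0 x y z r r0 xy xz hI; rewrite mulrA leNgt h.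
Qed.

Section strong_type.
Variables (R : realType) (n : nat).
Local Notation V := 'rV[R]_n.+1.
Local Notation lebRn := (lebRn R n).
Local Notation mu := (@lebesgue_measure_rV R n).

Lemma sharp_strong_type (p : R) : n.+1%:R < p ->
  exists C : R, 0 < C /\
  forall (F : V -> R) (G : V -> V) (g : V -> R),
  continuous F -> is_weak_gradient F G ->
  measurable_fun setT (g : lebRn -> R) -> (forall x i, `|G x 0 i| <= g x) ->
  (\int[mu]_x (sharp setT F x `^ p) <=
   C%:E * \int[mu]_x (g x `^ p)%:E)%E.
Proof.
(* The midpoint of n.+1 and p: q > n.+1 is needed for the weak-type bound, and b = p - q > 0 makes
   the sum over levels geometric. *)
move=> hp; pose q : R := (p + n.+1%:R) / 2; pose b := p - q.
have hq : n.+1%:R < q by rewrite /q; lra.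
have b0 : 0 < b by rewrite /b /q; lra.
have n0 : 0 <= n.+1%:R :> R by [].
have p0 : 0 < p by lra.
have [C [C0 CP]] := @sharp_weak_type R n q hq.
have B1 : 0 < 2 `^ b - 1 :> R.
  by rewrite subr_gt0 /powR pnatr_eq0/= expR_gt1 mulr_gt0// ln_gt0// ltr1n.
pose A : R := (2 * C) `^ p * 100 ^+ n.+1.
have A0 : 0 <= A by rewrite mulr_ge0 ?powR_ge0 ?exprn_ge0.
pose D := A * (2 `^ b / (2 `^ b - 1)) + 1.
exists D; split; first by rewrite ltr_wpDl// mulr_ge0// divr_ge0 ?powR_ge0 ?ltW.
move=> F G g cF wG mg Gg; pose P := sharp setT F.
have mP : measurable_fun setT (P : lebRn -> \bar R) by exact: measurable_sharp.
have mPp : measurable_fun setT ((fun x => P x `^ p)%E : lebRn -> \bar R).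
  exact: (measurableT_comp (measurable_poweR p) mP).
have mE (a : R) : measurable ([set x | a%:E < P x]%E : set lebRn).
  have := mP measurableT _ (emeasurable_itv `]a%:E, +oo[%O).
  by rewrite setTI preimage_itvoy.
have g0 x : 0 <= g x by exact: le_trans (Gg x 0).
have mgp : measurable_fun setT ((fun x => (g x `^ p)%:E) : lebRn -> \bar R).
  by apply/measurable_EFinP; exact: (measurableT_comp (measurable_powR p) mg).
have main (lam : R) : 0 < lam ->
    (\int[mu]_(x in [set x | (C * lam)%:E < P x]) (P x `^ p) <=
     D%:E * \int[mu]_x (g x `^ p)%:E)%E.
  move=> lam0; set E := [set x | _].
  pose l k : R := lam * 2 ^+ k.
  have l0 k : 0 < l k by rewrite mulr_gt0 ?exprn_gt0.
  pose L k := [set x : V | (C * lam * 2 ^+ k)%:E < P x]%E.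
  have layE k : (fun x : lebRn => layer p (C * lam) (P x) k) =
      (fun x : lebRn => ((C * lam * 2 ^+ k.+1) `^ p)%:E * (\1_(L k) x)%:E)%E.
    apply/funext => x; rewrite /layer indicE.
    by case: ifPn => h; [rewrite mem_set// mule1|rewrite memNset ?mule0//; exact/negP].
  have ml k : measurable_fun setT ((fun x => layer p (C * lam) (P x) k) : lebRn -> \bar R).
    rewrite layE.
    apply: (emeasurable_funM (measurable_cst _)).
    by apply/measurable_EFinP; exact: (measurable_indic (mE _)).
  have lay0 k x : (0 <= layer p (C * lam) (P x) k)%E.
    by rewrite /layer; case: ifP => // _; rewrite lee_fin powR_ge0.
  pose T k x : \bar R := (A * (l k `^ b * tail_pow g q (l k) x))%:E.
  have T0 k x : (0 <= T k x)%E.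
    by rewrite lee_fin mulr_ge0// mulr_ge0 ?powR_ge0 ?tail_pow_ge0.
  have mtail k := @measurable_tail_pow _ _ g q (l k) mg.
  have mT k : measurable_fun setT (T k : lebRn -> \bar R).
    apply/measurable_EFinP.
    exact: (measurable_funM (measurable_cst _) (measurable_funM (measurable_cst _) (mtail k))).
  apply: (@le_trans _ _ (\int[mu]_x (\sum_(k <oo) layer p (C * lam) (P x) k))%E).
    rewrite integral_mkcond; apply: (@ge0_le_integral _ lebRn R mu setT measurableT).
    - by move=> x _; rewrite patchE; case: ifP => // _; exact: poweR_ge0.
    - apply/(measurable_restrictT _ (mE _)); exact: measurable_funTS.
    - by apply: ge0_emeasurable_sum => // k x _ _; exact: lay0.
    - move=> x _; rewrite patchE; case: ifP => [/set_mem Ex|_]; last first.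
        by apply: nneseries_ge0 => k _ _; exact: lay0.
      by apply: dyadic_layers => //; rewrite mulr_gt0.
  rewrite (@integral_nneseries _ lebRn R mu setT measurableT _ ml (fun k x _ => lay0 k x)).
  apply: (@le_trans _ _ (\sum_(k <oo) \int[mu]_x T k x)%E).
    apply: lee_nneseries => [k _ _|k _]; first by apply: integral_ge0 => x _; exact: lay0.
    rewrite layE.
    have i0 (x : lebRn) : setT x -> (0 <= (\1_(L k) x : R)%:E)%E by rewrite lee_fin.
    have mi : measurable_fun setT ((fun x => (\1_(L k) x : R)%:E) : lebRn -> \bar R).
      by apply/measurable_EFinP; exact: (measurable_indic (mE _)).
    have k0 : (0 <= ((C * lam * 2 ^+ k.+1) `^ p)%:E)%E by rewrite lee_fin powR_ge0.
    rewrite (@ge0_integralZl _ lebRn R mu setT measurableT _ mi _ i0 k0).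
    rewrite (@integral_indic _ lebRn R mu setT measurableT _ (mE _)) setIT.
    apply: (@le_trans _ _ (((C * lam * 2 ^+ k.+1) `^ p)%:E *
        ((100 ^+ n.+1 / l k `^ q)%:E * \int[mu]_x (tail_pow g q (l k) x)%:E)))%E.
      rewrite lee_wpmul2l// -mulrA; exact: (CP F G g cF wG mg Gg (l k) (l0 k)).
    rewrite /T; under [leRHS]eq_integral do rewrite mulrA EFinM.
    have t0 (x : lebRn) : setT x -> (0 <= (tail_pow g q (l k) x)%:E)%E.
      by rewrite lee_fin tail_pow_ge0.
    have Al : (0 <= (A * l k `^ b)%:E)%E by rewrite lee_fin mulr_ge0 ?powR_ge0.
    have mtE : measurable_fun setT ((fun x => (tail_pow g q (l k) x)%:E) : lebRn -> \bar R).
      by apply/measurable_EFinP; exact: mtail.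
    rewrite [leRHS](@ge0_integralZl _ lebRn R mu setT measurableT _ mtE _ t0 Al).
    have e : (C * lam * 2 ^+ k.+1) `^ p * (100 ^+ n.+1 / l k `^ q) = A * l k `^ b.
      rewrite (_ : C * lam * 2 ^+ k.+1 = 2 * C * l k); last by rewrite /l exprS; lra.
      have -> : l k `^ b = l k `^ p / l k `^ q.
        by rewrite -powRN -powRD// (gt_eqF (l0 k)) implybT.
      by rewrite (powRM _ (mulr_ge0 (ler0n R 2) (ltW C0)) (ltW (l0 k))) /A; lra.
    by rewrite muleA -EFinM e.
  rewrite -(@integral_nneseries _ lebRn R mu setT measurableT _ mT (fun k x _ => T0 k x)).
  rewrite -(@ge0_integralZl _ lebRn R mu setT measurableT _ mgp D%:E); last 2 first.
  - by move=> x _; rewrite lee_fin powR_ge0.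
  - by rewrite lee_fin addr_ge0// mulr_ge0// divr_ge0 ?powR_ge0 ?ltW.
  apply: (@ge0_le_integral _ lebRn R mu setT measurableT).
  - by move=> x _; apply: nneseries_ge0 => k _ _; exact: T0.
  - by apply: ge0_emeasurable_sum => // k x _ _; exact: T0.
  - exact: (emeasurable_funM (measurable_cst _) mgp).
  - move=> x _; apply: lime_le.
      by apply: is_cvg_nneseries => k _ _; exact: T0.
    apply: nearW => K; rewrite /T sumEFin -EFinM lee_fin -mulr_sumr big_mkord.
    (* At fixed x only the levels below [g x] contribute. The sum of their b-th powers is controlled
       by the b-th power of [g x], and the remaining factor of exponent q completes the power p. *)
    apply: (@le_trans _ _ (A * (2 `^ b / (2 `^ b - 1)) * g x `^ p)); last first.
      by rewrite ler_wpM2r ?powR_ge0// lerDl.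
    rewrite -mulrA ler_wpM2l// mulrAC ler_pdivlMr// mulr_suml.
    have -> : g x `^ p = g x `^ b * g x `^ q.
      rewrite -powRD ?subrK//; by rewrite (gt_eqF p0).
    rewrite mulrA; apply: le_trans (ler_wpM2r (powR_ge0 (g x) q) (dyadic_powR_sum (g x) K b0 lam0)).
    rewrite mulr_suml; apply: ler_sum => k _; rewrite /tail_pow -/(l k).
    by case: ifP => _; [lra|rewrite mulr0 !mul0r].
(* The constant D does not depend on [lam], so [lam] can tend to 0 along powers of 1/2; the sets
   [E N] exhaust the points where the sharp function is positive. *)
pose E N := [set x | (C * (1 / 2) ^+ N)%:E < P x]%E.
have ndE : nondecreasing_seq E.
  move=> N M NM; apply/subsetPset => x /=; apply: le_lt_trans.
  by rewrite lee_fin ler_wpM2l ?(ltW C0)// ler_wiXn2l//; lra.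
have cv := @ge0_nondecreasing_set_cvg_integral _ lebRn R E (fun x => P x `^ p)%E mu ndE
  (fun N => mE _) (fun N => measurable_funTS mPp) (fun N x _ => poweR_ge0 _ _).
have -> : (\int[mu]_x (P x `^ p) = \int[mu]_(x in \bigcup_N E N) (P x `^ p))%E.
  rewrite [RHS]integral_mkcond; apply: eq_integral => x _; rewrite patchE.
  case: ifPn => // /negP xE; have -> : P x = 0%E; last by rewrite poweR0r// gt_eqF.
  apply/eqP; rewrite eq_le sharp_ge0 andbT leNgt; apply/negP => Px; apply: xE.
  apply/mem_set; have [e e0 eP] : exists2 e : R, 0 < e & (e%:E < P x)%E.
    case: (P x) Px => [t|_|//]; last by exists 1 => //; exact: ltry.
    by rewrite lte_fin => t0; exists (t / 2); rewrite ?divr_gt0// lte_fin; lra.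
  have /cvgrPdist_le/(_ e e0)[N _ /(_ N (leqnn N))] :
      (fun k => C * (1 / 2) ^+ k) @ \oo --> (0 : R).
    by apply: cvg_geometric; rewrite ger0_norm; lra.
  rewrite sub0r normrN => h; exists N => //=; apply: le_lt_trans eP.
  by rewrite lee_fin (le_trans _ h)// ler_norm.
rewrite -(cvg_lim _ cv)//; apply: lime_le; first by apply/cvg_ex; eexists; exact: cv.
by apply: nearW => N; apply: main; rewrite exprn_gt0.
Qed.

End strong_type.

(** * The extension operator *)

Section dist.
Variables (R : realType) (n : nat) (S : set 'rV[R]_n.+1).
Local Notation V := 'rV[R]_n.+1.
Implicit Types (x y a : V).
Hypothesis cS : closed S.
Hypothesis S0 : S !=set0.

Definition dist x : R := inf [set `|x - a| | a in S].

Let has_inf_dist x : has_inf [set `|x - a| | a in S].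
Proof.
split; first by have [a Sa] := S0; exists `|x - a|, a.
by exists 0 => _ [a _ <-].
Qed.

Lemma dist_le x a : S a -> dist x <= `|x - a|.
Proof. by move=> Sa; apply: ge_inf; [exact: (has_inf_dist x).2|exists a]. Qed.

Lemma dist_ge0 x : 0 <= dist x.
Proof. by apply: lb_le_inf; [exact: (has_inf_dist x).1|move=> _ [a _ <-]]. Qed.

Lemma dist_lt x (e : R) : dist x < e -> exists a, S a /\ `|x - a| < e.
Proof. by move=> /(inf_lt (has_inf_dist x).1)[_ [a Sa <-] ae]; exists a. Qed.

Lemma dist_lip x y : dist y <= dist x + `|x - y|.
Proof.
apply/ler_addgt0Pr => e e0.
have [a [Sa xa]] : exists a, S a /\ `|x - a| < dist x + e by apply: dist_lt; rewrite ltrDl.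
apply: (le_trans (dist_le y Sa)).
by have := ler_normD (y - x) (x - a); rewrite addrA subrK (distrC y x); lra.
Qed.

Lemma dist_eq0 x : dist x = 0 -> S x.
Proof.
move=> dx; apply: cS => U /nbhs_ballP[e /= e0 eU].
have [|a [Sa xa]] := @dist_lt x e; first by rewrite dx.
by exists a; split=> //; apply: eU; rewrite -ball_normE.
Qed.

Lemma dist_mem x : S x -> dist x = 0.
Proof.
by move=> Sx; apply/eqP; rewrite eq_le dist_ge0 andbT (le_trans (dist_le x Sx))// subrr normr0.
Qed.

Lemma edistE x y : edist (x, y) = `|x - y|%:E.
Proof.
apply/eqP; rewrite eq_le; apply/andP; split.
  apply/lee_addgt0Pr => e e0; apply: ereal_inf_lbound; exists (`|x - y| + e) => //=.
  split; first by rewrite ltr_wpDl.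
  by rewrite -ball_normE /= ltrDl.
apply: le_ereal_inf_tmp => _ [r [r0 xy] <-]; rewrite lee_fin.
by move: xy; rewrite -ball_normE /= => /ltW.
Qed.

Lemma edist_infE x : edist_inf S x = (dist x)%:E.
Proof.
apply/eqP; rewrite eq_le; apply/andP; split.
  apply/lee_addgt0Pr => e e0.
  have [|a [Sa xa]] := @dist_lt x (dist x + e); first by rewrite ltrDl.
  apply: (@le_trans _ _ `|x - a|%:E); last by rewrite -EFinD lee_fin ltW.
  by rewrite -edistE; apply: ereal_inf_lbound; exists a.
apply: le_ereal_inf_tmp => _ [a Sa <-]; rewrite edistE lee_fin; exact: dist_le.
Qed.

End dist.

(** * Averages of monotone functions under a shift *)

Section riemann_average.
Variables (R : realType).
Implicit Types (u v : R -> R).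

(** Riemann sums for the mean of [u] over [2, 3]. The mean itself is taken as a [Lim] of them,
    because the estimates hold for each [N] up to an error tending to 0. *)
Definition riemann_avg u (N : nat) : R :=
  N.+1%:R^-1 * \sum_(j < N.+1) u (2 + j%:R / N.+1%:R).

Lemma riemann_avg_ge u (lo : R) N : (forall s, 2 <= s <= 3 -> lo <= u s) ->
  lo <= riemann_avg u N.
Proof.
move=> H; rewrite /riemann_avg mulrC ler_pdivlMr ?ltr0n//.
rewrite mulr_natr -[X in _ *+ X]card_ord -sumr_const; apply: ler_sum => j _; apply: H.
have h0 : 0 <= j%:R / N.+1%:R :> R by rewrite divr_ge0.
have h1 : j%:R / N.+1%:R <= 1 :> R.
  by rewrite ler_pdivrMr ?ltr0n// mul1r ler_nat ltnW.
by move: (_ / _) h0 h1 => t h0 h1; apply/andP; split; lra.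
Qed.

Lemma riemann_avg_opp u N : riemann_avg (fun s => - u s) N = - riemann_avg u N.
Proof. by rewrite /riemann_avg sumrN mulrN. Qed.

Lemma riemann_avg_le u (hi : R) N : (forall s, 2 <= s <= 3 -> u s <= hi) ->
  riemann_avg u N <= hi.
Proof.
move=> H; rewrite -[leRHS]opprK -[leLHS]opprK lerN2 -riemann_avg_opp.
by apply: riemann_avg_ge => s /H; rewrite lerN2.
Qed.

(* Shifting a nonincreasing function by [eta] moves at most a fraction
   [eta + 1 / N] of the sample points across its oscillation [M]. *)
Lemma riemann_avg_shift u v (eta M : R) N : 0 <= eta -> eta <= 1 ->
  (forall s t, 2 <= s -> s <= t -> u t <= u s) ->
  (forall s t, 2 <= s <= 5 -> 2 <= t <= 5 -> u s - u t <= M) ->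
  (forall s, 2 <= s <= 3 -> u (s + eta) <= v s) ->
  riemann_avg u N - (eta + N.+1%:R^-1) * M <= riemann_avg v N.
Proof.
move=> eta0 eta1 uanti uM uv.
have N0 : 0 < N.+1%:R :> R by [].
(* The number of sample points that covers a shift by [eta]: [k / N.+1] lies between [eta] and
   [eta + 1 / N.+1]. *)
pose k := (Num.truncn (eta * N.+1%:R)).+1.
have k1 : eta <= k%:R / N.+1%:R by rewrite ler_pdivlMr// ltW// truncnS_gt.
have k2 : k%:R / N.+1%:R <= eta + N.+1%:R^-1.
  rewrite ler_pdivrMr// mulrDl mulVf ?gt_eqF// /k -natr1 lerD2r.
  by rewrite truncn_le// mulr_ge0.
have M0 : 0 <= M.
  have /(_ 2 2) := uM; rewrite subrr; apply; lra.
pose w (j : nat) : R := u (2 + j%:R / N.+1%:R).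
(* Both sides are the sum of [w] over the indices below [N.+1 + k]. *)
have split_sum : \sum_(0 <= j < N.+1) w (j + k)%N + \sum_(0 <= j < k) w j =
    \sum_(0 <= j < N.+1) w j + \sum_(0 <= j < k) w (j + N.+1)%N.
  have key a b : \sum_(0 <= j < a) w (j + b)%N + \sum_(0 <= j < b) w j =
      \sum_(0 <= j < a + b) w j.
    rewrite [RHS](@big_cat_nat _ _ _ b)//= ?leq_addl// addrC; congr (_ + _).
    by rewrite -[b in RHS]add0n big_addn addnK.
  by rewrite key addnC -key addrC.
have kN : k%:R <= N.+1%:R + 1 :> R.
  by move: k2; rewrite ler_pdivrMr// mulrDl mulVf ?gt_eqF//; nra.
(* Since [eta <= 1], k is at most N + 2 and the shifted sample points stay below 5; this is the
   range on which the oscillation of [u] is assumed bounded. *)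
have in25 (j : nat) : j%:R <= N.+1%:R + k%:R :> R ->
      (2 : R) <= 2 + j%:R / N.+1%:R <= (5 : R).
  move=> jN; have h0 : 0 <= j%:R / N.+1%:R :> R by rewrite divr_ge0.
  have h1 : j%:R / N.+1%:R <= 3 :> R.
    rewrite ler_pdivrMr//; have : 1 <= N.+1%:R :> R by rewrite ler1n.
    by move: (N.+1%:R) kN jN => m; lra.
  by move: (_ / _) h0 h1 => t h0 h1; apply/andP; split; lra.
have osc : \sum_(0 <= j < k) w j - \sum_(0 <= j < k) w (j + N.+1)%N <= k%:R * M.
  rewrite -sumrB !big_mkord mulr_natl -[X in _ *+ X]card_ord -sumr_const.
  apply: ler_sum => j _; have jk : j%:R <= k%:R :> R by rewrite ler_nat ltnW.
  by apply: uM; apply: in25; rewrite ?natrD; lra.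
have uv_sum : \sum_(0 <= j < N.+1) w (j + k)%N <=
    \sum_(j < N.+1) v (2 + j%:R / N.+1%:R).
  rewrite big_mkord; apply: ler_sum => j _.
  have h0 : 0 <= j%:R / N.+1%:R :> R by rewrite divr_ge0.
  have h1 : j%:R / N.+1%:R <= 1 :> R.
    by rewrite ler_pdivrMr// mul1r ler_nat ltnW.
  apply: le_trans (uv _ _); last first.
    by move: (_ / _) h0 h1 => t h0 h1; apply/andP; split; lra.
  apply: uanti; last by rewrite natrD mulrDl addrA lerD2l.
  by move: (_ / _) h0 h1 => t h0 h1; lra.
rewrite /riemann_avg -(big_mkord xpredT w).
have : N.+1%:R^-1 * (\sum_(0 <= j < N.+1) w j - k%:R * M) <=
    N.+1%:R^-1 * \sum_(j < N.+1) v (2 + j%:R / N.+1%:R).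
  by rewrite ler_pM2l ?invr_gt0//; lra.
apply: le_trans; rewrite mulrBr lerD2l lerN2 mulrA.
by rewrite ler_wpM2r// mulrC.
Qed.

End riemann_average.

(** * The averaged infimum and its sharp function *)

Section extension.
Variables (R : realType) (n : nat) (S : set 'rV[R]_n.+1) (f : 'rV[R]_n.+1 -> R).
Local Notation V := 'rV[R]_n.+1.
Implicit Types (x y a : V).
Hypothesis cS : closed S.
Hypothesis S0 : S !=set0.
Hypothesis fb : forall x (rho : R), exists M, forall a, S a -> cube x rho a -> `|f a| <= M.

Definition low x (rho : R) : R := inf [set f a | a in S `&` cube x rho].

Let lbound_low x rho : has_lbound [set f a | a in S `&` cube x rho].
Proof.
have [M MP] := fb x rho; exists (- M) => _ [a [Sa xa] <-].
by have := MP a Sa xa; rewrite ler_norml => /andP[].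
Qed.

Lemma low_le x rho a : S a -> cube x rho a -> low x rho <= f a.
Proof. by move=> Sa xa; apply: ge_inf => //; exists a. Qed.

Lemma low_ge x rho (lo : R) a : S a -> cube x rho a ->
  (forall b, S b -> cube x rho b -> lo <= f b) -> lo <= low x rho.
Proof.
by move=> Sa xa H; apply: lb_le_inf; [exists (f a), a|move=> _ [b [Sb xb] <-]; exact: H].
Qed.

Definition profile x (s : R) : R := low x (s * dist S x).

(** A factor above 1 leaves room for an almost nearest point of S. If the distance is 0, closedness
    of S makes x itself such a point. *)
Lemma near_point x (s : R) : 2 <= s -> exists a, S a /\ cube x (s * dist S x) a.
Proof.
move=> s2; have d0 := dist_ge0 S0 x.
have [dx|dx] := eqVneq (dist S x) 0.
  by exists x; split; [exact: dist_eq0 dx|rewrite /cube/= subrr normr0 dx mulr0].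
have [|a [Sa xa]] := @dist_lt _ _ S S0 x (2 * dist S x); first by lra.
exists a; split=> //; rewrite /cube/= distrC (le_trans (ltW xa))//.
by rewrite ler_wpM2r.
Qed.

Lemma profile_anti x (s t : R) : 2 <= s -> s <= t -> profile x t <= profile x s.
Proof.
move=> s2 st; have [a [Sa xa]] := near_point x s2.
apply: (low_ge Sa xa) => b Sb xb; apply: low_le => //.
rewrite /cube/=; apply: le_trans xb _; rewrite ler_wpM2r// dist_ge0//.
Qed.

Lemma profile_ge x (s lo t : R) : 2 <= s -> s <= t ->
  (forall a, S a -> cube x (t * dist S x) a -> lo <= f a) -> lo <= profile x s.
Proof.
move=> s2 st H; have [a [Sa xa]] := near_point x s2.
apply: (low_ge Sa xa) => b Sb xb; apply: H => //.
rewrite /cube/=; apply: le_trans xb _; rewrite ler_wpM2r// dist_ge0//.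
Qed.

Lemma profile_le x (s hi t : R) : 2 <= s -> s <= t ->
  (forall a, S a -> cube x (t * dist S x) a -> f a <= hi) -> profile x s <= hi.
Proof.
move=> s2 st H; have [a [Sa xa]] := near_point x s2.
apply: (le_trans (low_le Sa xa)); apply: H => //.
rewrite /cube/=; apply: le_trans xa _; rewrite ler_wpM2r// dist_ge0//.
Qed.

Variable Lim : (nat -> R) -> R.
Hypothesis LimD : forall a b : nat -> R, bounded_set (range a) -> bounded_set (range b) ->
  Lim (fun k => a k + b k) = Lim a + Lim b.
Hypothesis LimZ : forall (c : R) (a : nat -> R), bounded_set (range a) ->
  Lim (fun k => c * a k) = c * Lim a.
Hypothesis Lim_ge0 : forall a : nat -> R, bounded_set (range a) ->
  (forall k, 0 <= a k) -> 0 <= Lim a.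
Hypothesis Lim_cvg : forall (a : nat -> R) (l : R), a @ \oo --> l -> Lim a = l.

(* An average over the dilation factor s in [2, 3] of the infimum of f over the
   points of S within s * dist x of x; averaging makes it locally Lipschitz
   off S. *)
Definition extension x : R := Lim (riemann_avg (profile x)).

Let avg_bound x : exists M, forall N, `|riemann_avg (profile x) N| <= M.
Proof.
have [M MP] := fb x (3 * dist S x); exists M => N; rewrite ler_norml; apply/andP; split.
  apply: riemann_avg_ge => s /andP[s2 s3]; apply: (profile_ge s2 s3) => a Sa xa.
  by have := MP a Sa xa; rewrite ler_norml => /andP[].
apply: riemann_avg_le => s /andP[s2 s3]; apply: (profile_le s2 s3) => a Sa xa.
by have := MP a Sa xa; rewrite ler_norml => /andP[].
Qed.

Lemma extension_ge x (lo : R) :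
  (forall a, S a -> cube x (3 * dist S x) a -> lo <= f a) -> lo <= extension x.
Proof.
move=> H; rewrite -[lo](Lim_cst Lim_cvg) /extension; have [M MP] := avg_bound x.
apply: (Lim_le LimD LimZ Lim_ge0 (M := Num.max M `|lo|)) => [N|N|N].
- by rewrite le_max lexx orbT.
- by rewrite le_max MP.
- by apply: riemann_avg_ge => s /andP[s2 s3]; exact: (profile_ge s2 s3).
Qed.

Lemma extension_le x (hi : R) :
  (forall a, S a -> cube x (3 * dist S x) a -> f a <= hi) -> extension x <= hi.
Proof.
move=> H; rewrite -[hi](Lim_cst Lim_cvg) /extension; have [M MP] := avg_bound x.
apply: (Lim_le LimD LimZ Lim_ge0 (M := Num.max M `|hi|)) => [N|N|N].
- by rewrite le_max MP.
- by rewrite le_max lexx orbT.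
- by apply: riemann_avg_le => s /andP[s2 s3]; exact: (profile_le s2 s3).
Qed.

Lemma extension_mem x : S x -> extension x = f x.
Proof.
move=> Sx; have E a : cube x (3 * dist S x) a -> a = x.
  rewrite (dist_mem S0 Sx) mulr0 /cube/= normr_le0 subr_eq0.
  by move/eqP.
by apply/eqP; rewrite eq_le extension_le ?extension_ge// => a _ /E ->.
Qed.

(** For s <= 3, the cube of radius s dist(y, S) around y lies in the one around x of radius s
    dist(x, S) + (s + 1) |x - y|. With (s + 1) |x - y| <= 4 |x - y| = eta dist(x, S), this is a
    shift of s by eta, which [riemann_avg_shift] turns into the stated loss. *)
Lemma extension_shift x y (M : R) : 0 < dist S x -> 4 * `|x - y| <= dist S x ->
  (forall a b, S a -> cube x (5 * dist S x) a -> S b -> cube x (5 * dist S x) b ->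
    f a - f b <= M) ->
  extension x - 4 * `|x - y| / dist S x * M <= extension y.
Proof.
move=> d0 xyd HM; set eta := 4 * `|x - y| / dist S x.
have eta0 : 0 <= eta by rewrite divr_ge0 ?mulr_ge0 ?(ltW d0).
have eta1 : eta <= 1 by rewrite ler_pdivrMr// mul1r.
have etaE : eta * dist S x = 4 * `|x - y| by rewrite divfK// gt_eqF.
have key N : riemann_avg (profile x) N - (eta + N.+1%:R^-1) * M <= riemann_avg (profile y) N.
  apply: riemann_avg_shift => //; first exact: profile_anti.
    move=> s t /andP[s2 s5] /andP[t2 t5]; rewrite lerBlDr.
    have [a [Sa xa]] := near_point x s2.
    have [b [Sb xb]] := near_point x t2.
    have sub (u : R) c : u <= 5 -> cube x (u * dist S x) c -> cube x (5 * dist S x) c.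
      by move=> u5; rewrite /cube/= => /le_trans; apply; rewrite ler_wpM2r// ltW.
    rewrite -lerBlDl; apply: (low_ge Sb xb) => c Sc xc.
    have := HM a c Sa (sub _ _ s5 xa) Sc (sub _ _ t5 xc).
    by have := low_le Sa xa; rewrite -/(profile x s); lra.
  move=> s /andP[s2 s3]; have [a [Sa ya]] := near_point y s2.
  apply: (low_ge Sa ya) => b Sb yb; apply: low_le => //.
  move: yb; rewrite /cube/= => yb.
  have := ler_normD (b - y) (y - x); rewrite addrA subrK (distrC y x).
  have := dist_lip S0 x y.
  rewrite mulrDl etaE; have := normr_ge0 (x - y); set e := `|x - y|.
  move=> e0 h1 h2.
  have h3 : s * dist S y <= s * (dist S x + e) by rewrite ler_wpM2l//; lra.
  have h4 : s * e <= 3 * e by rewrite ler_wpM2r.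
  by rewrite mulrDr in h3; lra.
have [Mx MxP] := avg_bound x; have [My MyP] := avg_bound y.
have cvc : (fun N : nat => - ((eta + N.+1%:R^-1) * M)) @ \oo --> - (eta * M).
  rewrite -{2}[eta]addr0; apply: cvgN; apply: cvgMl; apply: cvgD; first exact: cvg_cst.
  exact: cvg_harmonic.
have bc (N : nat) : `|- ((eta + N.+1%:R^-1) * M)| <= (eta + 1) * `|M|.
  rewrite normrN normrM ler_wpM2r// ger0_norm; last by rewrite addr_ge0// invr_ge0.
  by rewrite lerD2l invf_le1// ler1n.
have <- : Lim (fun N => riemann_avg (profile x) N + - ((eta + N.+1%:R^-1) * M)) =
    extension x - eta * M.
  rewrite LimD; [by rewrite (Lim_cvg cvc)|exact: bounded_range MxP|].
  exact: bounded_range bc.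
apply: (Lim_le LimD LimZ Lim_ge0 (M := Num.max (Mx + (eta + 1) * `|M|) My)) => [N|N|N].
- by rewrite le_max (le_trans (ler_normD _ _) (lerD (MxP N) (bc N))).
- by rewrite le_max MyP orbT.
- exact: key.
Qed.

(** If dist(x, S) <= 9 r, all points of S used for y and z lie in Q(x, 51 r), and comparison with
    one value of f costs twice 51 r f#(x). Otherwise y and z are close relative to their distance to
    S: the oscillation 6 dist f#(x) in [extension_shift] gives 24 |y - z| f#(x), at most 48 r f#(x).
    The constant 110 covers both cases. *)
Lemma sharp_extension x : (sharp setT extension x <= 110%:E * sharp S f x)%E.
Proof.
have := sharp_ge0 S f x; case E : (sharp S f x) => [L| |] // L0; last first.
  by rewrite gt0_muley ?lte_fin// leey.
rewrite lee_fin in L0.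
have osc (rho : R) a b : 0 < rho -> S a -> cube x rho a -> S b -> cube x rho b ->
    `|f a - f b| <= rho * L.
  move=> rho0 Sa xa Sb xb; rewrite -lee_fin EFinM -E.
  exact: (sharp_le f rho0 xa xb Sa Sb).
apply: sharp_ub => [|r y z r0 xy xz _ _]; first by rewrite mule_ge0// lee_fin.
rewrite -!EFinM lee_fin; rewrite /cube/= in xy xz.
have [dr|dr] := leP (dist S x) (9 * r).
  have near w : `|w - x| <= r -> forall a, cube w (3 * dist S w) a -> cube x (51 * r) a.
    move=> wx a; rewrite /cube/= => wa.
    have := ler_normD (a - w) (w - x); rewrite addrA subrK.
    by have := dist_lip S0 x w; rewrite (distrC x w); lra.
  have r51 : 0 < 51 * r by lra.
  have bound w : `|w - x| <= r -> forall b, S b -> cube x (51 * r) b ->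
      `|extension w - f b| <= 51 * r * L.
    move=> wx b Sb xb; rewrite ler_distl; apply/andP; split.
      apply: extension_ge => a Sa /(near w wx) xa.
      by have := osc _ _ _ r51 Sa xa Sb xb; rewrite ler_distl => /andP[].
    apply: extension_le => a Sa /(near w wx) xa.
    by have := osc _ _ _ r51 Sa xa Sb xb; rewrite ler_distl => /andP[].
  have [a [Sa ya]] := near_point y (lexx 2).
  have xa : cube x (51 * r) a.
    apply: (near y xy); move: ya; rewrite /cube/= => /le_trans; apply.
    by rewrite ler_wpM2r ?dist_ge0//; lra.
  have h1 := bound y xy a Sa xa; have h2 := bound z xz a Sa xa.
  have := ler_normD (extension y - f a) (f a - extension z).
  rewrite addrA subrK (distrC (f a)).
  have : 0 <= r * L by rewrite mulr_ge0// ltW.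
  rewrite [r * (110 * L)]mulrCA; move: h1 h2; rewrite -[51 * r * L]mulrA.
  by move: (r * L) => t h1 h2 t0 h3; lra.
have half u w : `|u - x| <= r -> `|w - x| <= r -> extension u - extension w <= 110 * (r * L).
  move=> ux wx; have d1 := dist_lip S0 u x; have d2 := dist_lip S0 x u.
  rewrite (distrC x u) in d2.
  have d0 : 0 < dist S u by lra.
  have uw : `|u - w| <= 2 * r.
    by have := ler_normD (u - x) (x - w); rewrite addrA subrK (distrC x w); lra.
  have uwd : 4 * `|u - w| <= dist S u by lra.
  have HM a b : S a -> cube u (5 * dist S u) a -> S b -> cube u (5 * dist S u) b ->
      f a - f b <= 6 * dist S u * L.
    have sub c : cube u (5 * dist S u) c -> cube x (6 * dist S u) c.
      rewrite /cube/= => uc; have := ler_normD (c - u) (u - x); rewrite addrA subrK; lra.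
    move=> Sa /sub xa Sb /sub xb; apply: (le_trans (ler_norm _)); apply: osc => //.
    by rewrite mulr_gt0.
  have := extension_shift d0 uwd HM.
  have -> : 4 * `|u - w| / dist S u * (6 * dist S u * L) = 24 * (`|u - w| * L).
    rewrite -[6 * _ * L]mulrA [6 * _]mulrCA [_ / _ * _]mulrA divfK ?gt_eqF//; lra.
  have h1 : `|u - w| * L <= 2 * r * L by rewrite ler_wpM2r.
  have h2 : 0 <= r * L by rewrite mulr_ge0// ltW.
  by rewrite -mulrA in h1; move: (r * L) (`|u - w| * L) h1 h2 => s t *; lra.
have h1 := half y z xy xz; have h2 := half z y xz xy.
by rewrite [r * (110 * L)]mulrCA ler_norml; apply/andP; split; lra.
Qed.

End extension.

(** One point where the sharp function of f is finite makes f bounded on bounded parts of S, so the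
    infima in the construction are those of bounded sets. *)
Lemma extension_exists (R : realType) (n : nat) (S : set 'rV[R]_n.+1)
    (f : 'rV[R]_n.+1 -> R) : closed S -> S !=set0 ->
  (exists x, (sharp S f x < +oo)%E) ->
  exists F : 'rV[R]_n.+1 -> R, (forall x, S x -> F x = f x) /\
    forall x, (sharp setT F x <= 110%:E * sharp S f x)%E.
Proof.
move=> cS S0 [x0 x0fin].
have [Lim [LimD LimZ Lim_ge0 Lim_cvg]] := banach_limit R.
have [a0 Sa0] := S0.
have fb x (rho : R) : exists M, forall a, S a -> cube x rho a -> `|f a| <= M.
  have := sharp_ge0 S f x0; case E : (sharp S f x0) x0fin => [L| |] // _ _.
  pose r : R := `|rho| + `|x - x0| + `|a0 - x0| + 1.
  have r0 : 0 < r by rewrite ltr_wpDl// !addr_ge0.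
  exists (`|f a0| + r * L) => a Sa xa.
  have : `|f a - f a0| <= r * L.
    rewrite -lee_fin EFinM -E; apply: (sharp_le f r0) => //; rewrite /cube/= /r.
      have := ler_normD (a - x) (x - x0); rewrite addrA subrK; move: xa; rewrite /cube/=.
      by have := ler_norm rho; have := normr_ge0 (a0 - x0); lra.
    by have := normr_ge0 rho; have := normr_ge0 (x - x0); lra.
  by have := ler_normD (f a - f a0) (f a0); rewrite subrK; lra.
exists (extension S f Lim); split.
  by move=> x Sx; exact: (extension_mem cS S0 fb LimD LimZ Lim_ge0 Lim_cvg Sx).
by move=> x; exact: (sharp_extension cS S0 fb LimD LimZ Lim_ge0 Lim_cvg).
Qed.

(** * Trace norms *)

Lemma poweRD_le (R : realType) (u v : \bar R) (r : R) : 0 < r -> (0 <= u)%E -> (0 <= v)%E ->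
  ((u + v) `^ r <= (2 `^ r)%:E * (u `^ r + v `^ r))%E.
Proof.
move=> r0; wlog uv : u v / (u <= v)%E.
  move=> H u0 v0; have [uv|/ltW vu] := leP u v; first exact: H.
  by rewrite addeC [X in (_ * X)%E]addeC; exact: H.
move=> u0 v0; apply: (@le_trans _ _ ((2%:E * v) `^ r)%E).
  apply: lee_poweR; [exact: ltW|exact: adde_ge0|].
  by rewrite mule_natl mule2n leeD2r.
rewrite poweRM// ?lee_fin// poweR_EFin lee_wpmul2l ?lee_fin ?powR_ge0//.
by rewrite leeDr// poweR_ge0.
Qed.

Section lpnorm.
Variables (R : realType) (n : nat) (p : R).
Local Notation V := 'rV[R]_n.+1.
Local Notation lebRn := (lebRn R n).
Local Notation mu := (@lebesgue_measure_rV R n).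
Implicit Types (D : set V) (g h k : V -> \bar R).
Hypothesis p1 : 1 <= p.

Let p0 : 0 < p. Proof. exact: lt_le_trans p1. Qed.

Let pV0 : 0 < p^-1. Proof. by rewrite invr_gt0. Qed.

Lemma lpnormE D g : lpnorm p D g = ((\int[mu]_(x in D) (`|g x| `^ p)) `^ p^-1)%E.
Proof.
rewrite /lpnorm unlock [in RHS]integral_mkcond; congr (_ `^ _)%E.
apply: eq_integral => x _; rewrite !patchE; case: ifP => // _.
by rewrite abse0 poweR0r// gt_eqF.
Qed.

Lemma lpnorm_ge0 D g : (0 <= lpnorm p D g)%E.
Proof. by rewrite lpnormE poweR_ge0. Qed.

Lemma lpnorm_lty D g : (lpnorm p D g < +oo)%E ->
  (\int[mu]_(x in D) (`|g x| `^ p) < +oo)%E.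
Proof.
rewrite lpnormE => H; have := @poweR_lty R _ p H; rewrite -poweRrM mulVf ?gt_eqF//.
by rewrite poweRe1//; apply: integral_ge0 => x _; exact: poweR_ge0.
Qed.

Lemma measurable_abse_poweR D g : measurable_fun (D : set lebRn) (g : lebRn -> \bar R) ->
  measurable_fun (D : set lebRn) ((fun x => `|g x| `^ p)%E : lebRn -> \bar R).
Proof.
move=> mg; apply: (measurableT_comp (measurable_poweR p)).
exact: (measurableT_comp (@abse_measurable R setT) mg).
Qed.

Lemma lpnorm_le_integral D E g h (c : R) : 0 <= c ->
  (\int[mu]_(x in D) (`|g x| `^ p) <= c%:E * \int[mu]_(x in E) (`|h x| `^ p))%E ->
  (lpnorm p D g <= (c `^ p^-1)%:E * lpnorm p E h)%E.
Proof.
move=> c0 H; have i0 (B : set V) (u : V -> \bar R) : (0 <= \int[mu]_(x in B) (`|u x| `^ p))%E.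
  by apply: integral_ge0 => x _; exact: poweR_ge0.
rewrite !lpnormE -poweR_EFin -poweRM ?lee_fin//.
apply: lee_poweR; [exact: ltW|exact: i0|exact: H].
Qed.

Lemma lpnorm_le D g h (c : R) : measurable (D : set lebRn) ->
  measurable_fun (D : set lebRn) (g : lebRn -> \bar R) ->
  measurable_fun (D : set lebRn) (h : lebRn -> \bar R) -> 0 <= c ->
  (forall x, D x -> (`|g x| <= c%:E * `|h x|)%E) ->
  (lpnorm p D g <= c%:E * lpnorm p D h)%E.
Proof.
move=> mD mg mh c0 H.
have -> : c = (c `^ p) `^ p^-1 by rewrite -powRrM mulfV ?gt_eqF// powRr1.
apply: lpnorm_le_integral; first exact: powR_ge0.
have mh' := measurable_abse_poweR mh.
have h0 (x : lebRn) : D x -> (0 <= `|h x| `^ p)%E by move=> _; exact: poweR_ge0.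
have cp0 : (0 <= (c `^ p)%:E)%E by rewrite lee_fin powR_ge0.
rewrite -(@ge0_integralZl _ lebRn R mu D mD _ mh' _ h0 cp0).
apply: (@ge0_le_integral _ lebRn R mu D mD).
- by move=> x _; exact: poweR_ge0.
- exact: measurable_abse_poweR mg.
- exact: (emeasurable_funM (measurable_cst _) mh').
- move=> x Dx; rewrite -poweR_EFin -poweRM ?lee_fin//.
  by apply: lee_poweR; [exact: ltW|exact: abse_ge0|exact: H].
Qed.

Lemma lpnorm_subset D E g : measurable (D : set lebRn) -> measurable (E : set lebRn) ->
  measurable_fun (E : set lebRn) (g : lebRn -> \bar R) -> D `<=` E ->
  (lpnorm p D g <= lpnorm p E g)%E.
Proof.
move=> mD mE mg DE; rewrite !lpnormE; apply: lee_poweR; first exact: ltW.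
  by apply: integral_ge0 => x _; exact: poweR_ge0.
apply: (@ge0_subset_integral _ lebRn R mu _ _ mD mE _ (measurable_abse_poweR mg) _ DE).
by move=> x _; exact: poweR_ge0.
Qed.

(** A triangle inequality with a loss: [poweRD_le] is used with exponent p and then with 1/p, and 4
    bounds the resulting 2 times 2^(1/p). *)
Lemma lpnorm_add_le D g h k : measurable (D : set lebRn) ->
  measurable_fun (D : set lebRn) (g : lebRn -> \bar R) ->
  measurable_fun (D : set lebRn) (h : lebRn -> \bar R) ->
  measurable_fun (D : set lebRn) (k : lebRn -> \bar R) ->
  (forall x, D x -> (`|g x| <= `|h x| + `|k x|)%E) ->
  (lpnorm p D g <= 4%:E * (lpnorm p D h + lpnorm p D k))%E.
Proof.
move=> mD mg mh mk H; rewrite !lpnormE.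
set a := (\int[mu]_(x in D) (`|h x| `^ p))%E; set b := (\int[mu]_(x in D) (`|k x| `^ p))%E.
have [a0 b0] : (0 <= a)%E /\ (0 <= b)%E.
  by split; apply: integral_ge0 => x _; exact: poweR_ge0.
have mh' := measurable_abse_poweR mh; have mk' := measurable_abse_poweR mk.
have pw0 (u : V -> \bar R) (x : lebRn) : D x -> (0 <= `|u x| `^ p)%E.
  by move=> _; exact: poweR_ge0.
have c0 : (0 <= (2 `^ p)%:E :> \bar R)%E by rewrite lee_fin powR_ge0.
have le1 : (\int[mu]_(x in D) (`|g x| `^ p) <= (2 `^ p)%:E * (a + b))%E.
  rewrite /a /b -(@ge0_integralD _ lebRn R mu D mD _ _ (pw0 h) mh' (pw0 k) mk').
  have s0 (x : lebRn) : D x -> (0 <= `|h x| `^ p + `|k x| `^ p)%E.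
    by move=> _; rewrite adde_ge0 ?poweR_ge0.
  rewrite -(@ge0_integralZl _ lebRn R mu D mD _ (emeasurable_funD mh' mk') _ s0 c0).
  apply: (@ge0_le_integral _ lebRn R mu D mD).
  - exact: pw0.
  - exact: measurable_abse_poweR mg.
  - exact: (emeasurable_funM (measurable_cst _) (emeasurable_funD mh' mk')).
  - move=> x Dx; apply: le_trans (poweRD_le p0 (abse_ge0 _) (abse_ge0 _)).
    by apply: lee_poweR; [exact: ltW|exact: abse_ge0|exact: H].
apply: (@le_trans _ _ (((2 `^ p)%:E * (a + b)) `^ p^-1)%E).
  by apply: lee_poweR; [exact: ltW|apply: integral_ge0 => x; exact: pw0|].
rewrite (poweRM _ c0 (adde_ge0 a0 b0)) poweR_EFin -powRrM mulfV ?gt_eqF// powRr1//.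
apply: (@le_trans _ _ (2%:E * ((2 `^ p^-1)%:E * (a `^ p^-1 + b `^ p^-1)))%E).
  by rewrite lee_wpmul2l// poweRD_le.
rewrite muleA -EFinM lee_wpmul2r ?adde_ge0 ?poweR_ge0// lee_fin.
have : (2 : R) `^ p^-1 <= 2 by rewrite -[leRHS]powRr1// ler_powR ?ler1n// invf_le1.
by lra.
Qed.

End lpnorm.

(** * Gradient norms and dominating functions *)

Section dominated_gradient.
Variables (R : realType) (n : nat).
Local Notation V := 'rV[R]_n.+1.
Local Notation lebRn := (lebRn R n).
Local Notation mu := (@lebesgue_measure_rV R n).

Lemma coord_le_eucl_norm (v : V) i : `|v 0 i| <= eucl_norm v.
Proof.
rewrite /eucl_norm -sqrtr_sqr ler_wsqrtr// (bigD1 i)//= lerDl.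
by apply: sumr_ge0 => j _; exact: sqr_ge0.
Qed.

Lemma eucl_norm_le (v : V) (c : R) : 0 <= c -> (forall i, `|v 0 i| <= c) ->
  eucl_norm v <= n.+1%:R * c.
Proof.
move=> c0 vc; rewrite /eucl_norm -[leRHS]ger0_norm ?mulr_ge0// -sqrtr_sqr ler_wsqrtr//.
apply: (@le_trans _ _ (\sum_(i < n.+1) c ^+ 2)).
  apply: ler_sum => i _; rewrite -real_normK ?num_real//.
  by rewrite lerXn2r ?nnegrE.
rewrite sumr_const card_ord -[leLHS]mulr_natl exprMn ler_wpM2r ?sqr_ge0//.
by rewrite expr2 ler_peMr// ler1n.
Qed.

Lemma measurable_eucl_norm (G : V -> V) :
  (forall i, measurable_fun setT ((fun x => G x 0 i) : lebRn -> R)) ->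
  measurable_fun setT ((fun x => eucl_norm (G x)) : lebRn -> R).
Proof.
have msqrt : measurable_fun setT (@Num.sqrt R).
  by apply: continuous_measurable_fun; exact: sqrt_continuous.
move=> mG; apply: (measurableT_comp msqrt).
apply: (@measurable_sum _ lebRn R setT _ _ (fun i x => G x 0 i ^+ 2)) => i.
exact: (measurable_funX 2 (mG i)).
Qed.

Lemma weak_gradientP (F : V -> R) : (exists G, is_weak_gradient F G) ->
  is_weak_gradient F (weak_gradient F).
Proof. by move=> [G wG]; rewrite /weak_gradient; apply: xgetPex; exists G. Qed.

Variable p : R.
Hypothesis hp : n.+1%:R < p.

Let p1 : 1 <= p. Proof. by rewrite (le_trans _ (ltW hp))// ler1n. Qed.

(** The bound is known for the gradient that was constructed; uniqueness almost everywhere carries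
    it to [weak_gradient F], since only integrals enter the norm. *)
Lemma locally_dominated_L1p (F : V -> R) (g : V -> \bar R) (r0 : R) :
  locally_dominated F g r0 -> 0 < r0 -> in_Lp p setT g -> (forall x, (0 <= g x)%E) ->
  [/\ continuous F, L1p p F & (L1p_norm p F <= n.+1%:R%:E * lpnorm p setT g)%E].
Proof.
move=> Fg r00 [mg gfin] g0.
have gp : (\int[mu]_x (g x `^ p) < +oo)%E.
  have := lpnorm_lty p1 gfin; congr (_ < _)%E; apply: eq_integral => x _.
  by rewrite gee0_abs.
have cF : continuous F := locally_dominated_continuous Fg r00 mg g0 hp gp.
have [G [wG Gg]] := exists_weak_gradient Fg r00 mg g0 hp gp.
have wF : is_weak_gradient F (weak_gradient F) by apply: weak_gradientP; exists G.
have mgrad : measurable_fun setT (grad_abs F : lebRn -> \bar R).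
  apply/measurable_EFinP; apply: measurable_eucl_norm => i; exact: (wF i).1.1.
have le_norm : (L1p_norm p F <= n.+1%:R%:E * lpnorm p setT g)%E.
  pose E x : \bar R := (eucl_norm (G x))%:E.
  have mE : measurable_fun setT (E : lebRn -> \bar R).
    by apply/measurable_EFinP; apply: measurable_eucl_norm => i; exact: (wG i).1.1.
  have -> : L1p_norm p F = lpnorm p setT E.
    rewrite /L1p_norm (lpnormE p1 setT (grad_abs F)) (lpnormE p1 setT E).
    apply: (congr1 (fun t => t `^ p^-1)%E).
    apply: (@ae_eq_integral _ lebRn R mu setT _ _ measurableT
      (measurable_abse_poweR p mgrad) (measurable_abse_poweR p mE)).
    have FF := @ae_filter_ringOfSetsType _ lebRn R mu.
    apply: (@filterS _ _ FF) (weak_gradient_unique wF wG) => x e _.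
    by rewrite /grad_abs /E e.
  apply: lpnorm_le => // x _.
  rewrite (gee0_abs (g0 x)) abse_EFin ger0_norm ?sqrtr_ge0//.
  case: (g x) (g0 x) (Gg x) => [t| |]//= t0 Gt; last by rewrite gt0_muley ?lte_fin ?leey.
  by rewrite -EFinM lee_fin eucl_norm_le.
split=> //; split; first exact: continuous_loc_integrable.
- by exists G.
- split=> //; apply: le_lt_trans le_norm _.
  by rewrite lte_mul_pinfty// lee_fin.
Qed.

Lemma sharp_L1p_norm : exists C : R, 1 <= C /\ forall F : V -> R, continuous F ->
  L1p p F -> (lpnorm p setT (sharp setT F) <= C%:E * L1p_norm p F)%E.
Proof.
have [C [C0 CP]] := @sharp_strong_type R n p hp.
exists (Num.max 1 (C `^ p^-1)); split; first by rewrite le_max lexx.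
move=> F cF [lF exG [mgrad _]].
have wF := weak_gradientP exG.
have mg : measurable_fun setT ((fun x => eucl_norm (weak_gradient F x)) : lebRn -> R).
  exact/measurable_EFinP.
apply: (@le_trans _ _ ((C `^ p^-1)%:E * L1p_norm p F)%E).
  apply: (lpnorm_le_integral p1 (ltW C0)).
  have := CP F _ _ cF wF mg (fun x i => coord_le_eucl_norm _ i).
  congr (_ <= _ * _)%E; apply: eq_integral => x _; first by rewrite gee0_abs// sharp_ge0.
  by rewrite /grad_abs abse_EFin ger0_norm ?sqrtr_ge0.
by rewrite lee_wpmul2r ?(lpnorm_ge0 p1)// lee_fin le_max lexx orbT.
Qed.

End dominated_gradient.

(** * Extensions and restrictions for the two spaces *)

Section traces.
Variables (R : realType) (n : nat).
Local Notation V := 'rV[R]_n.+1.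
Local Notation lebRn := (lebRn R n).
Local Notation mu := (@lebesgue_measure_rV R n).
Implicit Types (S : set V) (f F : V -> R) (x y z : V).

Lemma le_sharp S f F x : (forall y, S y -> F y = f y) ->
  (sharp S f x <= sharp setT F x)%E.
Proof.
move=> Ff; apply: sharp_ub; first exact: sharp_ge0.
by move=> r y z r0 xy xz Sy Sz; rewrite -!Ff//; exact: sharp_le.
Qed.

Lemma sharp_locally_dominated F (g : V -> \bar R) r0 :
  (forall x, (sharp setT F x <= g x)%E) -> locally_dominated F g r0.
Proof.
move=> Fg x y z r r0' _ xy xz.
apply: le_trans (sharp_le F r0' xy xz I I) _.
by rewrite lee_wpmul2l// lee_fin ltW.
Qed.

(** The map T is measurable into the Borel sets only, so F composed with T requires Borel
    measurability of F. *)
Lemma continuous_measurable_borelRn F : continuous F ->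
  measurable_fun setT (F : borelRn R n -> R).
Proof.
move=> cF; apply: (measurability _ (RGenOpens.measurableE R)) => _ [_ [a [b ->] <-]].
rewrite setTI; apply: sub_sigma_algebra; apply: open_comp; last exact: interval_open.
by move=> x _; exact: cF.
Qed.

Lemma eps_nbhdE (eps : R) S : S !=set0 -> eps_nbhd eps S = [set x | dist S x < eps].
Proof.
move=> S0; apply/seteqP; split=> x; rewrite /eps_nbhd/= edist_infE// lte_fin//.
Qed.

Lemma eps_nbhd0 (eps : R) : eps_nbhd eps (set0 : set V) = set0.
Proof.
by apply/seteqP; split=> // x; rewrite /eps_nbhd /edist_inf /= image_set0 ereal_inf0.
Qed.

Lemma measurable_eps_nbhd (eps : R) S : measurable (eps_nbhd eps S : set lebRn).
Proof.
have [->|/set0P S0] := eqVneq S set0; first by rewrite eps_nbhd0.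
rewrite eps_nbhdE//; apply: open_measurable_lebRn; rewrite openE => x /= xe.
apply/nbhs_ballP; exists (eps - dist S x); rewrite /= ?subr_gt0// => y.
rewrite -ball_normE /= => xy; have := dist_lip S0 x y; lra.
Qed.

(** Otherwise [g] would be infinite on a set of positive measure. It supplies the point of finite
    sharp function that [extension_exists] asks for. *)
Lemma exists_lty (p : R) (D : set V) (g : V -> \bar R) : 1 <= p ->
  measurable (D : set lebRn) -> (0 < mu D)%E ->
  (lpnorm p D g < +oo)%E -> exists x, D x /\ (g x < +oo)%E.
Proof.
move=> p1 mD D0 /(lpnorm_lty p1) H; apply: contrapT => H'; move: H; apply/negP.
rewrite -leNgt leye_eq (eq_integral (cst +oo%E)); last first.
  move=> x /set_mem Dx; have -> : g x = +oo%E.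
    by apply/eqP; rewrite -leye_eq leNgt; apply/negP => gx; apply: H'; exists x.
  by rewrite poweRyr// gt_eqF// (lt_le_trans ltr01).
by rewrite (integral_cst mu mD) gt0_mulye.
Qed.

Lemma measure_cube_gt0 (D : set V) x (r : R) : 0 < r -> cube x r `<=` D -> (0 < leb_outer D)%E.
Proof.
move=> r0 xD; apply: lt_le_trans (le_leb_outer xD).
by rewrite [ltRHS](mu_cube x (ltW r0)) lte_fin exprn_gt0// mulr_gt0.
Qed.

Variable p : R.
Hypothesis hp : n.+1%:R < p.

Let p1 : 1 <= p. Proof. by rewrite (le_trans _ (ltW hp))// ler1n. Qed.

Lemma in_Lp_scale (D : set V) (g : V -> \bar R) (c : R) : measurable (D : set lebRn) ->
  0 <= c -> in_Lp p D g ->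
  in_Lp p D (fun x => c%:E * g x)%E /\
  (lpnorm p D (fun x => c%:E * g x) <= c%:E * lpnorm p D g)%E.
Proof.
move=> mD c0 [mg gfin].
have mcg : measurable_fun (D : set lebRn) ((fun x => c%:E * g x)%E : lebRn -> \bar R).
  exact: (emeasurable_funM (measurable_cst _) mg).
have le1 : (lpnorm p D (fun x => c%:E * g x) <= c%:E * lpnorm p D g)%E.
  by apply: lpnorm_le => // x _; rewrite abseM abse_EFin ger0_norm.
split=> //; split=> //; apply: le_lt_trans le1 _.
by rewrite lte_mul_pinfty// lee_fin.
Qed.

Lemma lpnorm_cst0 (D : set V) : lpnorm p D (cst 0%E) = 0%E.
Proof.
have pn0 : p != 0 by rewrite gt_eqF// (lt_le_trans ltr01 p1).
rewrite (lpnormE p1) (eq_integral (cst 0%E)); last first.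
  by move=> x _; rewrite abse0 poweR0r.
by rewrite integral0 poweR0r// invr_neq0.
Qed.

(** The zero function serves as the extension when S is empty, a case outside the scope of
    [extension_exists]. *)
Lemma cst0_L1p : [/\ in_Lp p setT (EFin \o (cst 0 : V -> R)) /\ continuous (cst 0 : V -> R),
  L1p p (cst 0 : V -> R) &
  L1p_norm p (cst 0 : V -> R) = 0%E].
Proof.
have dom : locally_dominated (cst 0 : V -> R) (cst 0%E) 1.
  by move=> x y z r _ _ _ _; rewrite /= subrr normr0 mule0.
have Lp0 : in_Lp p [set: V] (cst 0%E) by split; [exact: measurable_cst|rewrite lpnorm_cst0].
have [c0 L0 N0] := locally_dominated_L1p hp dom ltr01 Lp0 (fun=> lexx _).
have E0 : EFin \o (cst 0 : V -> R) = cst 0%E by [].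
split; [by rewrite E0|exact: L0|apply/eqP].
rewrite eq_le [X in _ && X](lpnorm_ge0 p1) andbT.
by move: N0; rewrite lpnorm_cst0 mule0.
Qed.

Lemma L1p_extension S f : closed S -> in_Lp p setT (sharp S f) ->
  exists F, extensions (L1p p) S f F /\
    (L1p_norm p F <= (n.+1%:R * 110)%:E * lpnorm p setT (sharp S f))%E.
Proof.
move=> cS Lp; have [S0|/set0P S0] := eqVneq S set0.
  have [[_ c0] L0 N0] := cst0_L1p; exists (cst 0); split; first by rewrite S0; split.
  by rewrite N0 mule_ge0 ?lee_fin ?mulr_ge0// (lpnorm_ge0 p1).
have [x0 [_ x0fin]] : exists x, setT x /\ (sharp S f x < +oo)%E.
  apply: (exists_lty p1 measurableT _ Lp.2).
  exact: (@measure_cube_gt0 setT 0 1 ltr01 (@subsetT _ _)).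
have [F [Ff FS]] := extension_exists cS S0 (ex_intro _ x0 x0fin).
have [Lp110 N110] := in_Lp_scale measurableT (ler0n R 110) Lp.
have dom := @sharp_locally_dominated F _ 1 FS.
have [|cF LF NF] := locally_dominated_L1p hp dom ltr01 Lp110.
  by move=> x; rewrite mule_ge0// sharp_ge0.
exists F; split=> //; apply: le_trans NF _.
by rewrite EFinM -muleA lee_wpmul2l.
Qed.

Variables (eps theta : R).
Hypothesis eps0 : 0 < eps.
Hypothesis theta1 : 1 <= theta.

Let theta0 : 0 < theta. Proof. exact: lt_le_trans theta1. Qed.

Definition near_retraction S (T : V -> V) :=
  (forall x, eps_nbhd eps S x -> S (T x)) /\
  (forall x, eps_nbhd eps S x -> (`|T x - x|%:E <= theta%:E * edist_inf S x)%E).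

Lemma near_retraction_cube S T x : near_retraction S T -> eps_nbhd eps S x ->
  cube x (theta * eps) (T x).
Proof.
move=> [_ H] xS; rewrite /cube/= -lee_fin; apply: le_trans (H x xS) _.
by rewrite EFinM lee_wpmul2l ?lee_fin ?ltW.
Qed.

Lemma W1p_necessity : exists C : R, 1 <= C /\ forall S (T : V -> V) f F,
  measurable_fun (eps_nbhd eps S : set lebRn) (T : lebRn -> borelRn R n) ->
  near_retraction S T -> extensions (W1p p) S f F ->
  [/\ in_Lp p (eps_nbhd eps S) (EFin \o f \o T), in_Lp p (eps_nbhd eps S) (sharp S f) &
   (lpnorm p (eps_nbhd eps S) (EFin \o f \o T) + lpnorm p (eps_nbhd eps S) (sharp S f)
     <= C%:E * W1p_norm p F)%E].
Proof.
have [C [C1 CP]] := sharp_L1p_norm hp.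
have C0 : 0 <= C by rewrite (le_trans ler01).
have te0 : 0 < theta * eps by rewrite mulr_gt0.
have tC0 : 0 <= 4 * (theta * eps * C) by rewrite !mulr_ge0// ltW.
(* The first two summands bound [f \o T] through [lpnorm_add_le], the third bounds the sharp
   function. *)
exists (4 + 4 * (theta * eps * C) + C); split; first by lra.
move=> S T f F mT ret [[[mF Ffin] LF] cF Ff]; set D := eps_nbhd eps S in mT *.
have mD : measurable (D : set lebRn) := measurable_eps_nbhd eps S.
have msh A (h : V -> R) : measurable_fun (D : set lebRn) (sharp A h : lebRn -> \bar R).
  exact: measurable_funTS (measurable_sharp A h).
have mFT : measurable_fun (D : set lebRn) (EFin \o f \o T : lebRn -> \bar R).
  apply: (@eq_measurable_fun _ _ _ _ _ (EFin \o F \o T : lebRn -> \bar R)).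
    by move=> x /set_mem xD; rewrite /= Ff//; exact: ret.1.
  apply/measurable_EFinP.
  exact: (measurableT_comp (continuous_measurable_borelRn cF) mT).
have mFD : measurable_fun (D : set lebRn) (EFin \o F : lebRn -> \bar R).
  exact: measurable_funTS mF.
have LFfin : (L1p_norm p F < +oo)%E by case: LF => _ _ [].
have sF : (lpnorm p D (sharp setT F) <= C%:E * L1p_norm p F)%E.
  apply: le_trans (CP F cF LF).
  exact: (lpnorm_subset p1 mD measurableT (measurable_sharp _ _) (@subsetT _ _)).
have sS : (lpnorm p D (sharp S f) <= C%:E * L1p_norm p F)%E.
  apply: le_trans sF; rewrite -[leRHS]mul1e; apply: (lpnorm_le p1 mD) => // x _.
  by rewrite mul1e !gee0_abs ?sharp_ge0// le_sharp.
have CFfin : (C%:E * L1p_norm p F < +oo)%E by rewrite lte_mul_pinfty// lee_fin.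
have LpsF : in_Lp p D (sharp setT F) by split=> //; exact: le_lt_trans sF CFfin.
have [[mk _] ks] := in_Lp_scale mD (ltW te0) LpsF.
have fT : (lpnorm p D (EFin \o f \o T) <= 4%:E * (lpnorm p setT (EFin \o F) +
    (theta * eps)%:E * (C%:E * L1p_norm p F)))%E.
  apply: le_trans (lpnorm_add_le p1 mD mFT mFD mk _) _.
    move=> x xD; rewrite [X in (_ + X)%E]gee0_abs ?mule_ge0 ?lee_fin ?(ltW te0) ?sharp_ge0//.
    have STx := ret.1 x xD; have Tx := near_retraction_cube ret xD.
    have xx : cube x (theta * eps) x by rewrite /cube/= subrr normr0 ltW.
    apply: le_trans (_ : (`|F x|%:E + `|F (T x) - F x|%:E <= _)%E).
      by rewrite /= -EFinD lee_fin -(Ff _ STx) -{1}[F (T x)](subrK (F x)) addrC ler_normD.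
    by rewrite leeD2l//; exact: (sharp_le F te0 Tx xx).
  rewrite lee_wpmul2l//; apply: leeD.
    exact: (lpnorm_subset p1 mD measurableT mF (@subsetT _ _)).
  by apply: le_trans ks _; rewrite lee_wpmul2l// lee_fin ltW.
have a0 : (0 <= lpnorm p setT (EFin \o F))%E := lpnorm_ge0 p1 _ _.
have b0 : (0 <= L1p_norm p F)%E := lpnorm_ge0 p1 _ _.
split.
- split=> //; apply: le_lt_trans fT _.
  rewrite lte_mul_pinfty// lte_add_pinfty//.
  by rewrite lte_mul_pinfty ?lee_fin ?(ltW te0).
- by split=> //; exact: le_lt_trans sS CFfin.
- apply: le_trans (leeD fT sS) _; rewrite /W1p_norm.
  set a := lpnorm p setT (EFin \o F) in a0 *; set b := L1p_norm p F in b0 *.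
  rewrite ge0_muleDr ?mule_ge0 ?lee_fin ?(ltW te0)//.
  rewrite [leRHS]ge0_muleDr// -addeA; apply: leeD.
    by rewrite lee_wpmul2r// lee_fin; lra.
  rewrite !muleA -!EFinM -ge0_muleDl ?lee_fin//.
    by rewrite -EFinD lee_wpmul2r// lee_fin; lra.
  by rewrite -mulrA.
Qed.

(** It vanishes from distance [eps / 2] on, and not only from [eps]: a cube of radius [eps / 4]
    around a point outside the neighborhood then meets only zeros of it. *)
Definition cutoff S x : R := Num.max 0 (1 - 2 / eps * dist S x).

Lemma cutoff_ge0 S x : 0 <= cutoff S x.
Proof. by rewrite le_max lexx. Qed.

Lemma cutoff_le1 S x : S !=set0 -> cutoff S x <= 1.
Proof.
move=> S0; rewrite ge_max ler01 gerBl mulr_ge0 ?dist_ge0//.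
by rewrite divr_ge0 ?ltW.
Qed.

Lemma cutoff_mem S x : S !=set0 -> S x -> cutoff S x = 1.
Proof. by move=> S0 Sx; rewrite /cutoff dist_mem// mulr0 subr0; apply/max_idPr. Qed.

Lemma cutoff_eq0 S x : eps / 2 <= dist S x -> cutoff S x = 0.
Proof.
move=> h; apply/max_idPl; rewrite subr_le0 mulrAC ler_pdivlMr//; lra.
Qed.

Lemma cutoff_lip S x y : S !=set0 -> `|cutoff S x - cutoff S y| <= 2 / eps * `|x - y|.
Proof.
move=> S0; have d1 := dist_lip S0 x y; have d2 := dist_lip S0 y x.
rewrite (distrC y x) in d2.
have e0 : 0 <= 2 / eps by rewrite divr_ge0 ?ltW.
have m1 : 2 / eps * dist S y <= 2 / eps * (dist S x + `|x - y|) by rewrite ler_wpM2l.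
have m2 : 2 / eps * dist S x <= 2 / eps * (dist S y + `|x - y|) by rewrite ler_wpM2l.
have m3 : 0 <= 2 / eps * `|x - y| by rewrite mulr_ge0.
rewrite !mulrDr in m1 m2; rewrite /cutoff.
move: (2 / eps * dist S x) (2 / eps * dist S y) (2 / eps * `|x - y|) m1 m2 m3.
move=> a b c m1 m2 m3; rewrite ler_norml.
by have [h1|h1] := leP 0 (1 - a); have [h2|h2] := leP 0 (1 - b);
  rewrite ?subr0; apply/andP; split; lra.
Qed.

(** Up to a constant it dominates the oscillation of the cutoff extension at small scales as well as
    its values, and its L_p norm is comparable to the right-hand side of (ii). *)
Definition trace_density S f (T : V -> V) : V -> \bar R :=
  ((fun x => `|f (T x)|%:E + sharp S f x) \_ (eps_nbhd eps S))%E.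

Lemma trace_density_ge0 S f T x : (0 <= trace_density S f T x)%E.
Proof.
by rewrite /trace_density patchE; case: ifP => // _; rewrite adde_ge0 ?lee_fin// sharp_ge0.
Qed.

(** The sum of the coefficients of f#(x) and of |f(T x)| in the product rule for the cutoff
    extension: 110 from the oscillation of F, 110 (1 + 4 theta) and 4 / eps from the value of F
    times the slope of the cutoff. *)
Definition trace_const : R := 110 * (2 + 4 * theta) + 4 / eps.

Lemma trace_const_ge0 : 0 <= trace_const.
Proof.
have : 0 <= 4 / eps by rewrite divr_ge0 ?ltW.
by have := theta0; rewrite /trace_const; lra.
Qed.

Section cutoff_extension.
Variables (S : set V) (f : V -> R) (T : V -> V) (F : V -> R).
Hypothesis S0 : S !=set0.
Hypothesis ret : near_retraction S T.
Hypothesis Ff : forall x, S x -> F x = f x.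
Hypothesis FS : forall x, (sharp setT F x <= 110%:E * sharp S f x)%E.

Let osc x (L : R) y z (rho : R) : sharp S f x = L%:E -> 0 < rho -> cube x rho y ->
  cube x rho z -> `|F y - F z| <= rho * (110 * L).
Proof.
move=> E rho0 xy xz; rewrite -lee_fin; apply: le_trans (sharp_le F rho0 xy xz I I) _.
by rewrite EFinM lee_wpmul2l ?lee_fin ?(ltW rho0)// EFinM -E.
Qed.

(** A product rule: the oscillation of F is multiplied by a cutoff at most 1, and the oscillation of
    the cutoff by the value [F z]. The latter is estimated by its difference with [F (T x)], which
    is [f (T x)]. *)
Lemma cutoff_extension_dominated :
  locally_dominated (fun x => F x * cutoff S x)
    (fun x => trace_const%:E * trace_density S f T x)%E (eps / 4).
Proof.
move=> x y z r r0 re xy xz.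
have tc0 := trace_const_ge0; have td0 := trace_density_ge0 S f T x.
have [xD|xD] := pselect (eps_nbhd eps S x); last first.
  (* For x outside the neighborhood, points within [eps / 4] of x are at distance at least
     [3 * eps / 4] from S, beyond the support of the cutoff. *)
  have far w : `|w - x| <= r -> cutoff S w = 0.
    move=> wx; apply: cutoff_eq0; have := dist_lip S0 w x.
    by move: xD; rewrite eps_nbhdE//= => /negP; rewrite -leNgt; lra.
  by rewrite !far// !mulr0 subrr normr0 !mule_ge0// lee_fin// ltW.
move: td0; rewrite /trace_density patchE mem_set//.
have := sharp_ge0 S f x; case E : (sharp S f x) => [L| |] // L0 td0; last first.
  rewrite addey// gt0_muley; last first.
    rewrite lte_fin /trace_const; have := theta0.
    by have : 0 < 4 / eps; [rewrite divr_gt0|lra].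
  by rewrite gt0_muley ?lte_fin// leey.
rewrite lee_fin in L0; rewrite -EFinD -!EFinM lee_fin.
have a0 := normr_ge0 (f (T x)); set a := `|f (T x)| in a0 *.
have te0 : 0 < theta * eps by rewrite mulr_gt0.
have xTx : cube x (r + theta * eps) (T x).
  by have := near_retraction_cube ret xD; rewrite /cube/=; lra.
have xzr : cube x (r + theta * eps) z by rewrite /cube/=; lra.
have rt0 : 0 < r + theta * eps by lra.
have h1 := osc E r0 xy xz.
have h2 := osc E rt0 xzr xTx.
have h3 : `|F z| <= a + (r + theta * eps) * (110 * L).
  have := ler_normD (F z - F (T x)) (F (T x)); rewrite subrK.
  by rewrite [`|F (T x)|](congr1 Num.norm (Ff (ret.1 x xD))) -/a; lra.
have h4 : `|cutoff S y - cutoff S z| <= 4 / eps * r.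
  apply: le_trans (cutoff_lip y z S0) _.
  have yz : `|y - z| <= 2 * r.
    by have := ler_normD (y - x) (x - z); rewrite addrA subrK (distrC x z); lra.
  have e0 : 0 <= 2 / eps by rewrite divr_ge0 ?ltW.
  by have := ler_wpM2l e0 yz; lra.
have h5 : `|F y * cutoff S y - F z * cutoff S z| <=
    `|F y - F z| + `|F z| * `|cutoff S y - cutoff S z|.
  have -> : F y * cutoff S y - F z * cutoff S z =
    (F y - F z) * cutoff S y + F z * (cutoff S y - cutoff S z) by lra.
  apply: le_trans (ler_normD _ _) _; rewrite !normrM lerD2r.
  by rewrite ler_piMr// ger0_norm ?cutoff_ge0// cutoff_le1.
have h6 : `|F z| * `|cutoff S y - cutoff S z| <=
    (a + (r + theta * eps) * (110 * L)) * (4 / eps * r) by exact: ler_pM.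
(* Here the restriction [r <= eps / 4] on the scale is used. *)
have h7 : (r + theta * eps) * (4 / eps) <= 1 + 4 * theta.
  by rewrite mulrA ler_pdivrMr//; lra.
have h8 : (r + theta * eps) * (4 / eps) * (r * (110 * L)) <= (1 + 4 * theta) * (r * (110 * L)).
  by rewrite ler_wpM2r// mulr_ge0 ?(ltW r0)// mulr_ge0.
have h9 : 0 <= r * (110 * (2 + 4 * theta) * a).
  have t0 : 0 <= 2 + 4 * theta by have := theta0; lra.
  by rewrite mulr_ge0 ?(ltW r0)// mulr_ge0// mulr_ge0.
have h10 : 0 <= r * (4 / eps * L).
  by rewrite mulr_ge0 ?(ltW r0)// mulr_ge0// divr_ge0// ltW.
apply: (le_trans h5); apply: (le_trans (lerD h1 h6)).
rewrite /trace_const; move: (4 / eps) h8 h10 => e h8 h10.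
by lra.
Qed.

Lemma cutoff_extension_le x :
  (`|(F x * cutoff S x)%:E| <= (1 + 110 * (theta * eps))%:E * trace_density S f T x)%E.
Proof.
have te0 : 0 < theta * eps by rewrite mulr_gt0.
rewrite /trace_density patchE; case: ifPn => [/set_mem xD|/negP xD]; last first.
  rewrite cutoff_eq0 ?mulr0 ?abse0 ?mule0//.
  have : ~ (dist S x < eps) by move=> h; apply: xD; apply/mem_set; rewrite eps_nbhdE.
  by move=> /negP; rewrite -leNgt => h; have := eps0; lra.
have := sharp_ge0 S f x; case E : (sharp S f x) => [L| |] // L0; last first.
  by rewrite addey// gt0_muley ?leey// lte_fin; lra.
rewrite lee_fin in L0; rewrite -EFinD -EFinM abse_EFin lee_fin normrM.
have xx : cube x (theta * eps) x by rewrite /cube/= subrr normr0 ltW.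
have h := osc E te0 xx (near_retraction_cube ret xD).
have h3 : `|F x| <= `|f (T x)| + theta * eps * (110 * L).
  have := ler_normD (F x - F (T x)) (F (T x)); rewrite subrK.
  by rewrite [`|F (T x)|](congr1 Num.norm (Ff (ret.1 x xD))); lra.
apply: (@le_trans _ _ `|F x|); first by rewrite ler_piMr// ger0_norm ?cutoff_ge0// cutoff_le1.
apply: (le_trans h3).
have : 0 <= theta * eps * (110 * `|f (T x)|) by rewrite mulr_ge0 ?(ltW te0)// mulr_ge0.
move: (theta * eps) => t; lra.
Qed.

End cutoff_extension.

Lemma W1p_extension : exists C : R, 1 <= C /\ forall S (T : V -> V) f, closed S ->
  near_retraction S T -> in_Lp p (eps_nbhd eps S) (EFin \o f \o T) ->
  in_Lp p (eps_nbhd eps S) (sharp S f) ->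
  exists F, extensions (W1p p) S f F /\ (W1p_norm p F <= C%:E *
    (lpnorm p (eps_nbhd eps S) (EFin \o f \o T) + lpnorm p (eps_nbhd eps S) (sharp S f)))%E.
Proof.
have te0 : 0 < theta * eps by rewrite mulr_gt0.
have tc0 := trace_const_ge0.
pose c1 : R := 1 + 110 * (theta * eps); pose c2 : R := n.+1%:R * trace_const.
have c10 : 0 <= c1 by rewrite /c1; lra.
have c20 : 0 <= c2 by rewrite mulr_ge0.
exists ((c1 + c2) * 4); split; first by rewrite /c1; lra.
move=> S T f cS ret LpT LpS; set D := eps_nbhd eps S in LpT LpS *.
have mD : measurable (D : set lebRn) := measurable_eps_nbhd eps S.
have rhs0 : (0 <= lpnorm p D (EFin \o f \o T) + lpnorm p D (sharp S f))%E.
  by rewrite adde_ge0// (lpnorm_ge0 p1).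
have [S0|/set0P S0] := eqVneq S set0.
  have [[W0 cc0] L0 N0] := cst0_L1p; exists (cst 0); split.
    by split; [exact: (conj W0 L0)|exact: cc0|move=> x; rewrite S0].
  rewrite /W1p_norm N0 [X in (X + _)%E](_ : _ = 0%E); last exact: lpnorm_cst0.
  by rewrite adde0 mule_ge0// lee_fin mulr_ge0// addr_ge0.
(* The neighborhood contains a cube of radius [eps / 2] around a point of S, so it has positive
   measure and the sharp function is finite somewhere in it. *)
have [x0 [_ x0fin]] : exists x, D x /\ (sharp S f x < +oo)%E.
  apply: (exists_lty p1 mD _ LpS.2); have [a Sa] := S0.
  apply: (@measure_cube_gt0 D a (eps / 2)); first by rewrite divr_gt0.
  move=> x; rewrite /D eps_nbhdE// /cube/= => xa.
  by have := dist_le S0 x Sa; have := eps0; lra.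
have [F [Ff FS]] := extension_exists cS S0 (ex_intro _ x0 x0fin).
pose h := trace_density S f T.
have mh' : measurable_fun (D : set lebRn)
    ((fun x => `|f (T x)|%:E + sharp S f x)%E : lebRn -> \bar R).
  apply: emeasurable_funD LpS.1.
  exact: (measurableT_comp (@abse_measurable R setT) LpT.1).
have mh : measurable_fun setT (h : lebRn -> \bar R) by apply/(measurable_restrictT _ mD).
have hle : (lpnorm p setT h <= 4%:E *
    (lpnorm p D (EFin \o f \o T) + lpnorm p D (sharp S f)))%E.
  have -> : lpnorm p setT h = lpnorm p D (fun x => `|f (T x)|%:E + sharp S f x)%E.
    by rewrite /lpnorm patch_setT.
  apply: (lpnorm_add_le p1 mD mh' LpT.1 LpS.1) => x _.
  rewrite gee0_abs ?adde_ge0 ?lee_fin ?sharp_ge0//.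
  by rewrite [X in (_ <= _ + X)%E]gee0_abs ?sharp_ge0.
have hfin : (lpnorm p setT h < +oo)%E.
  apply: le_lt_trans hle _; rewrite lte_mul_pinfty// lte_add_pinfty//.
    exact: LpT.2.
  exact: LpS.2.
have [Lpg gle] := in_Lp_scale measurableT tc0 (conj mh hfin).
have dom := cutoff_extension_dominated S0 ret Ff FS.
have e40 : 0 < eps / 4 by rewrite divr_gt0.
have g0 x : (0 <= trace_const%:E * trace_density S f T x)%E.
  by rewrite mule_ge0 ?lee_fin// trace_density_ge0.
have [cF LF NF] := locally_dominated_L1p hp dom e40 Lpg g0.
pose F' x : R := F x * cutoff S x.
have mF' : measurable_fun setT (EFin \o F' : lebRn -> \bar R).
  by apply/measurable_EFinP; exact: continuous_measurable_lebRn cF.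
have F'le : (lpnorm p setT (EFin \o F') <= c1%:E * lpnorm p setT h)%E.
  apply: (lpnorm_le p1 measurableT mF' mh c10) => x _.
  rewrite [X in (_ <= _ * X)%E]gee0_abs ?trace_density_ge0//.
  exact: (cutoff_extension_le S0 ret Ff FS x).
exists F'; split.
  have LpF' : in_Lp p setT (EFin \o F').
    by split=> //; apply: le_lt_trans F'le _; rewrite lte_mul_pinfty// lee_fin.
  split; [exact: (conj LpF' LF)|exact: cF|].
  by move=> x Sx; rewrite /F' cutoff_mem// mulr1 Ff.
rewrite /W1p_norm; apply: (@le_trans _ _ ((c1 + c2)%:E * lpnorm p setT h)%E).
  rewrite EFinD ge0_muleDl ?lee_fin//; apply: leeD; first exact: F'le.
  by apply: le_trans NF _; rewrite /c2 EFinM -muleA lee_wpmul2l.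
by rewrite EFinM -muleA lee_wpmul2l// lee_fin addr_ge0.
Qed.

End traces.

Lemma equivalent_up_toP (R : realType) (n : nat) (X : set ('rV[R]_n.+1 -> R))
    (N : ('rV[R]_n.+1 -> R) -> \bar R) S f (C1 C2 : R) (b : \bar R) :
  1 <= C1 -> (0 <= b)%E -> (forall F, (0 <= N F)%E) ->
  (forall F, extensions X S f F -> (b <= C1%:E * N F)%E) ->
  (exists F, extensions X S f F /\ (N F <= C2%:E * b)%E) ->
  equivalent_up_to (Num.max C1 C2) (trace_norm X N S f) b.
Proof.
move=> C11 b0 N0 H1 [F [XF FC2]]; set C := Num.max C1 C2.
have C0 : 0 < C by rewrite lt_max (lt_le_trans ltr01 C11).
have aN : (trace_norm X N S f <= N F)%E by apply: ereal_inf_lbound; exists F.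
split.
  rewrite lee_pdivrMl//; apply: le_trans aN _; apply: le_trans FC2 _.
  by rewrite lee_wpmul2r// lee_fin le_max lexx orbT.
rewrite -lee_pdivrMl//; apply: le_ereal_inf_tmp => _ [F' XF' <-].
rewrite lee_pdivrMl//; apply: le_trans (H1 F' XF') _.
by rewrite lee_wpmul2r// lee_fin le_max lexx.
Qed.

Theorem theorem1p4 (R : realType) (n : nat) (p : R) (hp : n.+1%:R < p) :
  (exists C : R, 1 <= C /\
    forall S : set 'rV[R]_n.+1, closed S ->
    forall f : 'rV[R]_n.+1 -> R,
      (in_trace (L1p p) S f <-> in_Lp p setT (sharp S f)) /\
      (in_trace (L1p p) S f ->
        equivalent_up_to C (trace_norm (L1p p) (L1p_norm p) S f)
                           (lpnorm p setT (sharp S f)))) /\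
  (forall eps theta : R, 0 < eps -> 1 <= theta ->
   exists C : R, 1 <= C /\
    forall S : set 'rV[R]_n.+1, closed S ->
    forall T : 'rV[R]_n.+1 -> 'rV[R]_n.+1,
      measurable_fun (eps_nbhd eps S : set (lebRn R n))
                     (T : lebRn R n -> borelRn R n) ->
      (forall x, eps_nbhd eps S x -> S (T x)) ->
      (forall x, eps_nbhd eps S x ->
        (`|T x - x|%:E <= theta%:E * edist_inf S x)%E) ->
    forall f : 'rV[R]_n.+1 -> R,
      (in_trace (W1p p) S f <->
        in_Lp p (eps_nbhd eps S) (EFin \o f \o T) /\
        in_Lp p (eps_nbhd eps S) (sharp S f)) /\
      (in_trace (W1p p) S f ->
        equivalent_up_to C (trace_norm (W1p p) (W1p_norm p) S f)
          (lpnorm p (eps_nbhd eps S) (EFin \o f \o T)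
           + lpnorm p (eps_nbhd eps S) (sharp S f))%E)).
Proof.
have p1 : 1 <= p by rewrite (le_trans _ (ltW hp))// ler1n.
split.
  have [C [C1 CP]] := sharp_L1p_norm hp.
  exists (Num.max C (n.+1%:R * 110)); split; first by rewrite le_max C1.
  move=> S cS f; have nec F : extensions (L1p p) S f F ->
      in_Lp p setT (sharp S f) /\ (lpnorm p setT (sharp S f) <= C%:E * L1p_norm p F)%E.
    move=> [LF cF Ff]; have mS := measurable_sharp S f.
    have le1 : (lpnorm p setT (sharp S f) <= C%:E * L1p_norm p F)%E.
      apply: le_trans (CP F cF LF); rewrite -[leRHS]mul1e.
      apply: (lpnorm_le p1 measurableT mS (measurable_sharp setT F) ler01) => x _.
      by rewrite mul1e !gee0_abs ?sharp_ge0// le_sharp.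
    split=> //; split=> //; apply: le_lt_trans le1 _.
    have [_ _ [_ Lfin]] := LF; rewrite lte_mul_pinfty// lee_fin.
    exact: le_trans ler01 C1.
  split; first split.
  - by move=> [F /nec[]].
  - by move=> /(L1p_extension hp cS)[F [XF _]]; exists F.
  - move=> [F0 /nec[Lp _]]; apply: equivalent_up_toP => //.
    + exact: lpnorm_ge0.
    + by move=> F; exact: lpnorm_ge0.
    + by move=> F /nec[].
    + exact: L1p_extension.
move=> eps theta eps0 theta1.
have [C [C1 CP]] := W1p_necessity hp eps0 theta1.
have [C' [C'1 C'P]] := W1p_extension hp eps0 theta1.
exists (Num.max C C'); split; first by rewrite le_max C1.
move=> S cS T mT TS Tdist f; have ret : near_retraction eps theta S T by [].
split; first split.
- by move=> [F XF]; have [] := CP S T f F mT ret XF.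
- by move=> [LT LS]; have [F [XF _]] := C'P S T f cS ret LT LS; exists F.
- move=> [F0 XF0]; have [LT LS _] := CP S T f F0 mT ret XF0.
  apply: equivalent_up_toP => //.
  + by rewrite adde_ge0// lpnorm_ge0.
  + by move=> F; rewrite adde_ge0// lpnorm_ge0.
  + by move=> F XF; have [] := CP S T f F mT ret XF.
  + exact: C'P.
Qed.
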